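(* Let $\phi:\mathbb{D}\to\mathbb{D}$ be analytic. Suppose that the closure $\overline{\phi(\mathbb{D})}$ is contained in the open unit disk $\mathbb{D}$ and that $|\phi'|^2\,dA$ is a Carleson measure for the Dirichlet space $\mathcal{D}$. Then for every $\psi\in\mathcal{D}$, the weighted composition operator $C_{\psi,\phi}$ is compact on $\mathcal{D}$.
   Context: $\mathbb{D}=\{z\in\mathbb{C}:|z|<1\}$ and $dA$ is area Lebesgue measure on $\mathbb{D}$. The Dirichlet space $\mathcal{D}$ is the Hilbert space of all holomorphic $f$ on $\mathbb{D}$ with $\int_{\mathbb{D}}|f'|^2dA<\infty$, with norm $\|f\|_{\mathcal{D}}^2=\|f\|_{H^2(\mathbb{D})}^2+\frac1\pi\int_{\mathbb{D}}|f'(z)|^2dA(z)$, where $H^2(\mathbb{D})$ is the Hardy space; equivalently, for $f(z)=\sum_{n\ge0}\hat f_nz^n$ and $g(z)=\sum_{n\ge0}\hat g_nz^n$, the inner product is $\langle f,g\rangle_{\mathcal{D}}=\sum_{n\ge0}(n+1)\hat f_n\overline{\hat g_n}$. A positive Borel measure $\mu$ on $\mathbb{D}$ is a Carleson measure for $\mathcal{D}$ if there is a constant $c>0$ with $\int_{\mathbb{D}}|f|^2d\mu\le c\|f\|_{\mathcal{D}}^2$ for all $f\in\mathcal{D}$. For $\psi$ analytic on $\mathbb{D}$ and $\phi$ an analytic self-map of $\mathbb{D}$, the weighted composition operator is $(C_{\psi,\phi}f)(z)=\psi(z)f(\phi(z))$ for $f\in\mathcal{D}$, $z\in\mathbb{D}$.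 *)

(* Defs.v *)
From mathcomp Require Import all_boot all_order all_algebra.
From mathcomp Require Import complex.
From mathcomp Require Import all_classical all_reals all_analysis.

Set Implicit Arguments.
Unset Strict Implicit.
Unset Printing Implicit Defensive.

Import Order.TTheory GRing.Theory Num.Theory.
Import numFieldNormedType.Exports.
Import ComplexField.

Local Open Scope classical_set_scope.
Local Open Scope ring_scope.
Local Open Scope complex_scope.

(* Functions on the disk are represented by total functions [R[i] -> R[i]];
   every notion below only depends on their values on [disk R]. *)

Definition disk (R : realType) : set R[i] := [set z | `|z| < 1].
Arguments disk R : clear implicits.

Definition holomorphic_on_disk (R : realType) (f : R[i] -> R[i]) : Prop :=
  forall z, disk R z -> derivable (f : R[i]^o -> R[i]^o) z 1.

Definition cderiv (R : realType) (f : R[i] -> R[i]) : R[i] -> R[i] :=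
  derive1 (f : R[i]^o -> R[i]^o).

(* [R[i]] carries no measurable structure in the libraries, so integrals over
   the disk are taken in real coordinates. The product sigma-algebra on
   [R * R] is the Borel one. *)
Definition toC (R : realType) (p : measurableTypeR R * measurableTypeR R) : R[i] :=
  p.1 +i* p.2.

Definition plane_disk (R : realType) :
    set (measurableTypeR R * measurableTypeR R) :=
  @toC R @^-1` disk R.
Arguments plane_disk R : clear implicits.

Definition area (R : realType) :
    {measure set (measurableTypeR R * measurableTypeR R) -> \bar R} :=
  (@lebesgue_measure R \x @lebesgue_measure R)%E.

Definition sqmod (R : realType) (z : R[i]) : R := Normc.normc z ^+ 2.

Definition hardy_normsq (R : realType) (f : R[i] -> R[i]) : \bar R :=
  ereal_sup [set (((2 * pi)^-1)%R%:E *
      \int[@lebesgue_measure R]_(t in `[0%R, (2 * pi)%R])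
        (sqmod (f (r%:C * (cos t +i* sin t))))%:E)%E
    | r in [set r : R | 0 < r < 1]].

Definition dirichlet_integral (R : realType) (f : R[i] -> R[i]) : \bar R :=
  (\int[area R]_(p in plane_disk R) (sqmod (cderiv f (toC p)))%:E)%E.

Definition dirichlet_space (R : realType) : set (R[i] -> R[i]) :=
  [set f | holomorphic_on_disk f /\ (dirichlet_integral f < +oo)%E].

Definition dirichlet_normsq (R : realType) (f : R[i] -> R[i]) : \bar R :=
  (hardy_normsq f + (pi^-1)%R%:E * dirichlet_integral f)%E.

Definition dirichlet_norm (R : realType) (f : R[i] -> R[i]) : \bar R :=
  sqrte (dirichlet_normsq f).

(* A Borel measure on the disk is represented by a Borel measure on the plane,
   of which only the restriction to the disk is used. *)
Definition dirichlet_carleson (R : realType)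
    (mu : {measure set (measurableTypeR R * measurableTypeR R) -> \bar R}) :
    Prop :=
  exists2 c : R, 0 < c & forall f, dirichlet_space f ->
    (\int[mu]_(p in plane_disk R) (sqmod (f (toC p)))%:E
       <= c%:E * dirichlet_normsq f)%E.

(* [d mu = w dA] on the disk *)
Definition density_on_disk (R : realType)
    (mu : {measure set (measurableTypeR R * measurableTypeR R) -> \bar R})
    (w : R[i] -> R) : Prop :=
  forall A, measurable A -> A `<=` plane_disk R ->
    mu A = (\int[area R]_(p in A) (w (toC p))%:E)%E.

Definition wcomp (R : realType) (psi phi : R[i] -> R[i])
    (f : R[i] -> R[i]) : R[i] -> R[i] :=
  fun z => psi z * f (phi z).

(* Compactness of an operator on the Dirichlet space: it maps the space into
   itself and the image of every norm-bounded sequence has a subsequence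
   converging in norm to an element of the space. *)
Definition compact_on_dirichlet (R : realType)
    (T : (R[i] -> R[i]) -> (R[i] -> R[i])) : Prop :=
  (forall f, dirichlet_space f -> dirichlet_space (T f)) /\
  (forall u : nat -> R[i] -> R[i],
    (forall n, dirichlet_space (u n)) ->
    (exists M : R, forall n, (dirichlet_norm (u n) <= M%:E)%E) ->
    exists2 k : nat -> nat, {homo k : m n / (m < n)%N} &
    exists2 g, dirichlet_space g &
      dirichlet_norm (fun z => T (u (k n)) z - g z) @[n --> \oo] --> 0%E).

(* Main.v *)
Require Import Defs.
From mathcomp Require Import all_boot all_order all_algebra.
From mathcomp Require Import complex.
From mathcomp Require Import all_classical all_reals all_analysis.
From mathcomp Require Import measurable_realfun.
From mathcomp Require Import ring lra.
Import Order.TTheory GRing.Theory Num.Theory.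
Import numFieldNormedType.Exports.
Local Open Scope classical_set_scope.
Local Open Scope ring_scope.

(** Let r0 < 1 bound |phi|, and let v be holomorphic near the disk |w| <= r0 with |v| <= A
    and |v'| <= A there. Then |psi * (v o phi)| <= A |psi|, and the product rule gives
      |(psi * (v o phi))'|^2 <= 2 A^2 |psi'|^2 + 2 A^2 |psi|^2 |phi'|^2.
    The last term integrates to 2 A^2 times the integral of |psi|^2 against mu, which the
    Carleson inequality bounds because psi itself belongs to the space. Hence the norm of
    psi * (v o phi) is at most B * A with B independent of v ([wcomp_normsq_bound]):
    the operator only sees the size of v and v' on a compact subset of the disk.

    On such a subset a norm-bounded sequence is a normal family. Its Taylor coefficients
    a_j satisfy |a_j| s^j <= M for every s < 1, with M a bound of the norms
    ([hardy_coef_bound]); a diagonal extraction makes them converge for each j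
    ([bounded_subsequence]); the limit coefficients satisfy the same bounds, and after
    shrinking s the differences tend to 0 uniformly in j. Since |a_j| s^j <= K for all j
    bounds the power series and its derivative on |w| <= r0 by a constant multiple of K
    ([pser_uniform]), the images converge in norm ([wcomp_compact]).

    Two classical theorems enter.

    Taylor expansion. Holomorphy is mere complex differentiability at each point. In the
    coordinates w = exp (s + i t), the real and imaginary parts u and v of a differentiable
    function satisfy u_t + v_s = 0 pointwise, and Goursat's bisection argument shows that the
    corresponding flux through the boundary of every rectangle vanishes ([flux_eq0]). On a
    rectangle of height 2 pi this says that the mean of the function over |w| = rho does
    not depend on rho ([circle_const]). Applied to w (f w - f z) / (w - z), which is
    continuous at z and vanishes at 0, it gives Cauchy's formula ([ckavg_eq0]), and expanding
    the kernel in powers of z / w gives the Taylor series ([taylor_remainder], [taylor]).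

    Finiteness of the Hardy norm. Membership in the space only asks for a finite Dirichlet
    integral, whereas the Carleson inequality says nothing unless the full norm of psi is
    finite. To bound the mean of |f|^2 over |z| = r, the value of f at a point of the right
    quarter of the circle is compared with its value at horizontal distance 1/2 to the left,
    well inside the disk; by Cauchy-Schwarz the increment is controlled by the integral of
    |f'|^2 along the segment, and integrating over the height costs at most the Dirichlet
    integral ([arc_bound]). The other quarters follow because the Dirichlet integral is
    invariant under the rotation by i ([rot_dirichlet]), whence [hardy_normsq_fin]. *)

Set Implicit Arguments.
Unset Strict Implicit.
Unset Printing Implicit Defensive.
Local Open Scope complex_scope.

(** * Moduli, limits and derivatives of complex functions *)

(** The modulus as a real number: the norm of [R[i]] is [R[i]]-valued, so estimates and
    real limits are phrased with [nc]. *)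
Definition nc (R : realType) (z : R[i]) : R := Normc.normc z.
Arguments nc : simpl never.
Section toolkit.
Variable R : realType.
Implicit Types (z w h d : R[i]) (f g : R[i] -> R[i]) (e r : R).

Lemma norm_nc z : `|z| = (nc z)%:C.
Proof. by []. Qed.

Lemma nc_ge0 z : 0 <= nc z.
Proof. by rewrite /nc; case: z => a b /=; rewrite sqrtr_ge0. Qed.

Lemma nc0 : nc (0 : R[i]) = 0. Proof. exact: Normc.normc0. Qed.
Lemma nc1 : nc (1 : R[i]) = 1. Proof. exact: Normc.normc1. Qed.
Lemma ncM z w : nc (z * w) = nc z * nc w. Proof. exact: Normc.normcM. Qed.
Lemma ncV z : nc z^-1 = (nc z)^-1. Proof. exact: Normc.normcV. Qed.
Lemma ncD z w : nc (z + w) <= nc z + nc w. Proof. exact: le_normcD. Qed.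
Lemma ncN z : nc (- z) = nc z. Proof. exact: normcN. Qed.
Lemma ncB z w : nc (z - w) <= nc z + nc w.
Proof. by rewrite -[nc w]ncN ncD. Qed.
Lemma ncBC z w : nc (z - w) = nc (w - z).
Proof. by rewrite -ncN opprB. Qed.
Lemma ncX z n : nc (z ^+ n) = nc z ^+ n.
Proof. by elim: n => [|n IH]; rewrite ?expr0 ?nc1// !exprS ncM IH. Qed.
Lemma nc_real (x : R) : nc x%:C = `|x|.
Proof. by rewrite /nc /= expr0n addr0 sqrtr_sqr. Qed.
Lemma nc_eq0 z : (nc z == 0) = (z == 0).
Proof. by apply/eqP/eqP => [/Normc.eq0_normc|->]; rewrite ?nc0. Qed.
Lemma nc_gt0 z : (0 < nc z) = (z != 0).
Proof. by rewrite lt_neqAle nc_ge0 andbT eq_sym nc_eq0. Qed.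
Lemma nc_natr n : nc (n%:R : R[i]) = n%:R.
Proof.
have -> : (n%:R : R[i]) = (n%:R : R)%:C by rewrite rmorph_nat.
by rewrite nc_real normr_nat.
Qed.
Lemma nc_sum n (u : nat -> R[i]) : nc (\sum_(k < n) u k) <= \sum_(k < n) nc (u k).
Proof.
elim: n => [|n IH]; first by rewrite !big_ord0 nc0.
by rewrite !big_ord_recr/= (le_trans (ncD _ _))// lerD2r.
Qed.
Lemma sqmod_nc z : sqmod z = nc z ^+ 2. Proof. by []. Qed.
Lemma sqmodE z : sqmod z = complex.Re z ^+ 2 + complex.Im z ^+ 2.
Proof. by case: z => a b; rewrite /sqmod /= sqr_sqrtr// addr_ge0 ?sqr_ge0. Qed.
Lemma ler_Re z : `|complex.Re z| <= nc z.
Proof.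
rewrite -(@ler_pXn2r _ 2)// ?nnegrE ?nc_ge0//.
by rewrite real_normK ?num_real// -[leRHS]/(sqmod z) sqmodE lerDl sqr_ge0.
Qed.
Lemma ler_Im z : `|complex.Im z| <= nc z.
Proof.
rewrite -(@ler_pXn2r _ 2)// ?nnegrE ?nc_ge0//.
by rewrite real_normK ?num_real// -[leRHS]/(sqmod z) sqmodE lerDr sqr_ge0.
Qed.
Lemma nc_ReIm z : nc z <= `|complex.Re z| + `|complex.Im z|.
Proof.
rewrite -(@ler_pXn2r _ 2)// ?nnegrE ?nc_ge0 ?addr_ge0//.
rewrite -[leLHS]/(sqmod z) sqmodE sqrrD !real_normK ?num_real//.
by rewrite lerD2r lerDl mulrn_wge0// mulr_ge0.
Qed.

Lemma cReD z w : complex.Re (z + w) = complex.Re z + complex.Re w.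
Proof. by case: z w => ? ? []. Qed.
Lemma cImD z w : complex.Im (z + w) = complex.Im z + complex.Im w.
Proof. by case: z w => ? ? []. Qed.
Lemma cReN z : complex.Re (- z) = - complex.Re z. Proof. by case: z. Qed.
Lemma cImN z : complex.Im (- z) = - complex.Im z. Proof. by case: z. Qed.
Lemma cReB z w : complex.Re (z - w) = complex.Re z - complex.Re w.
Proof. by rewrite cReD cReN. Qed.
Lemma cImB z w : complex.Im (z - w) = complex.Im z - complex.Im w.
Proof. by rewrite cImD cImN. Qed.
Lemma cReM z w : complex.Re (z * w) =
  complex.Re z * complex.Re w - complex.Im z * complex.Im w.
Proof. by case: z w => ? ? []. Qed.
Lemma cImM z w : complex.Im (z * w) =
  complex.Re z * complex.Im w + complex.Im z * complex.Re w.
Proof. by case: z w => ? ? []. Qed.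

Lemma Re_real (a : R) : complex.Re a%:C = a. Proof. by []. Qed.
Lemma Im_real (a : R) : complex.Im a%:C = 0. Proof. by []. Qed.

Lemma disk_nc z : disk R z <-> nc z < 1.
Proof. by rewrite /disk /= norm_nc -[1]/(1%:C) ltcR. Qed.

(** Balls of [R[i]] have complex radii; this trades them for real ones. *)
Lemma nbhs_nc (z : R[i]^o) (A : set R[i]^o) :
  nbhs z A <-> exists2 e : R, 0 < e & forall w, nc (w - z) < e -> A w.
Proof.
split=> [/nbhs_ballP[e /= e0 zA]|[e e0 zA]].
  have e0' : 0 < complex.Re e by move: e0; rewrite ltcE => /andP[].
  exists (complex.Re e) => // w wz; apply: zA; rewrite /ball/= norm_nc ncBC.
  rewrite -(RRe_real (x := e)) ?ltcR//; exact: gtr0_real.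
apply/nbhs_ballP; exists e%:C => /=; first by rewrite ltcR.
by move=> w; rewrite /ball/= norm_nc ltcR ncBC; exact: zA.
Qed.

Lemma cvg_nc {T : Type} {F : set_system T} {FF : Filter F} (u : T -> R[i]^o)
    (l : R[i]^o) :
  u x @[x --> F] --> l <-> (forall e, 0 < e -> \forall x \near F, nc (u x - l) < e).
Proof.
split=> [ul e e0|ul A /nbhs_nc[e e0 eA]].
  by apply: (ul (fun w => nc (w - l) < e)); apply/nbhs_nc; exists e.
by near do apply: eA; exact: ul.
Unshelve. all: by end_near. Qed.

Lemma cvg_Re {T : Type} {F : set_system T} {FF : Filter F} (u : T -> R[i]^o)
    (l : R[i]^o) :
  u x @[x --> F] --> l -> complex.Re (u x) @[x --> F] --> complex.Re l.
Proof.
move=> /cvg_nc ul; apply/cvgrPdist_lt => e /ul; apply: filterS => x.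
by apply: le_lt_trans; rewrite ncBC -cReB ler_Re.
Qed.

Lemma cvg_Im {T : Type} {F : set_system T} {FF : Filter F} (u : T -> R[i]^o)
    (l : R[i]^o) :
  u x @[x --> F] --> l -> complex.Im (u x) @[x --> F] --> complex.Im l.
Proof.
move=> /cvg_nc ul; apply/cvgrPdist_lt => e /ul; apply: filterS => x.
by apply: le_lt_trans; rewrite ncBC -cImB ler_Im.
Qed.

Lemma cvg_complex {T : Type} {F : set_system T} {FF : Filter F} (u v : T -> R)
    (a b : R) :
  u x @[x --> F] --> a -> v x @[x --> F] --> b ->
  ((u x +i* v x : R[i]^o) @[x --> F] --> (a +i* b : R[i]^o)).
Proof.
move=> ua vb; apply/cvg_nc => e e0; near=> x.
apply: (le_lt_trans (nc_ReIm _)) => /=; rewrite (splitr e) ltrD//.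
  by rewrite distrC; near: x; move/cvgrPdist_lt : ua; apply; rewrite divr_gt0.
by rewrite distrC; near: x; move/cvgrPdist_lt : vb; apply; rewrite divr_gt0.
Unshelve. all: by end_near. Qed.

(** Reduces complex limits to pairs of real ones, so that their algebra is inherited from
    the real theory. *)
Lemma cvg_ReIm {T : Type} {F : set_system T} {FF : Filter F} (u : T -> R[i]^o)
    (l : R[i]^o) :
  u x @[x --> F] --> l <-> complex.Re (u x) @[x --> F] --> complex.Re l /\
     complex.Im (u x) @[x --> F] --> complex.Im l.
Proof.
split=> [ul|[ur ui]]; first by split; [exact: cvg_Re|exact: cvg_Im].
rewrite (_ : u = (fun x => complex.Re (u x) +i* complex.Im (u x))).
  by case: l ur ui => a b ur ui; apply: cvg_complex.
by apply/funext => x; case: (u x).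
Qed.

Lemma ccvgD {T : Type} {F : set_system T} {FF : Filter F} (u v : T -> R[i]^o)
    (a b : R[i]^o) : u x @[x --> F] --> a -> v x @[x --> F] --> b ->
  (u x + v x : R[i]^o) @[x --> F] --> (a + b : R[i]^o).
Proof.
move=> /cvg_ReIm[ua ua'] /cvg_ReIm[vb vb']; apply/cvg_ReIm.
under eq_fun do rewrite cReD; under [X in _ /\ (X @ _ --> _)]eq_fun do rewrite cImD.
by rewrite cReD cImD; split; apply: cvgD.
Qed.

Lemma ccvgM {T : Type} {F : set_system T} {FF : Filter F} (u v : T -> R[i]^o)
    (a b : R[i]^o) : u x @[x --> F] --> a -> v x @[x --> F] --> b ->
  (u x * v x : R[i]^o) @[x --> F] --> (a * b : R[i]^o).
Proof.
move=> /cvg_ReIm[ua ua'] /cvg_ReIm[vb vb']; apply/cvg_ReIm.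
under eq_fun do rewrite cReM; under [X in _ /\ (X @ _ --> _)]eq_fun do rewrite cImM.
by rewrite cReM cImM; split; [apply: cvgB|apply: cvgD]; apply: cvgM.
Qed.

Lemma ccvgB {T : Type} {F : set_system T} {FF : Filter F} (u v : T -> R[i]^o)
    (a b : R[i]^o) : u x @[x --> F] --> a -> v x @[x --> F] --> b ->
  (u x - v x : R[i]^o) @[x --> F] --> (a - b : R[i]^o).
Proof.
move=> /cvg_ReIm[ua ua'] /cvg_ReIm[vb vb']; apply/cvg_ReIm.
under eq_fun do rewrite cReB; under [X in _ /\ (X @ _ --> _)]eq_fun do rewrite cImB.
by rewrite cReB cImB; split; apply: cvgB.
Qed.

Lemma cvg_ncf {T : Type} {F : set_system T} {FF : Filter F} (u : T -> R[i]^o)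
    (l : R[i]^o) :
  u x @[x --> F] --> l -> nc (u x) @[x --> F] --> nc l.
Proof.
move=> /cvg_nc ul; apply/cvgrPdist_lt => e /ul; apply: filterS => x.
apply: le_lt_trans; rewrite ler_norml.
have := ncD (u x - l) l; rewrite subrK => H1.
have := ncD (l - u x) (u x); rewrite subrK ncBC => H2.
by apply/andP; split; lra.
Qed.

Lemma continuous_ncP f z : {for z, continuous (f : R[i]^o -> R[i]^o)} <->
  forall e : R, 0 < e -> exists2 r : R, 0 < r &
    forall w, nc (w - z) < r -> nc (f w - f z) < e.
Proof.
have FF : Filter (nbhs (z : R[i]^o)) by exact: nbhs_filter.
split=> [/(@cvg_nc _ _ FF f (f z)) fz e /fz/nbhs_nc[r r0 rP]|fz]; first by exists r.
by apply/(@cvg_nc _ _ FF f (f z)) => e /fz[r r0 rP]; apply/nbhs_nc; exists r.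
Qed.

(** Complex differentiability as a first-order expansion with remainder at most e |h|.
    Being free of quotients (h = 0 is allowed), it composes without case distinctions. *)
Definition has_deriv f z d := forall e : R, 0 < e -> exists2 r : R, 0 < r &
  forall h, nc h < r -> nc (f (z + h) - f z - d * h) <= e * nc h.

Lemma has_derivP f z d : has_deriv f z d <->
  ((fun h : R[i]^o => h^-1 *: (f (h + z) - f z) : R[i]^o) x @[x --> (0:R[i]^o)^']
    --> (d : R[i]^o)).
Proof.
rewrite cvg_nc; split=> [fd e e0|fd e e0].
  have e2 : 0 < e / 2 by rewrite divr_gt0.
  have [r r0 rP] := fd _ e2.
  rewrite !nearE /dnbhs /within /=; apply/(@nbhs_nc 0); exists r => // h; rewrite subr0 => hr h0.
  rewrite -(@ltr_pM2r _ (nc h)) ?nc_gt0// -ncM mulrBl /GRing.scale/=.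
  rewrite mulrAC mulVf// mul1r [h + z]addrC.
  apply: (le_lt_trans (rP _ hr)); rewrite ltr_pM2r ?nc_gt0//.
  by rewrite ltr_pdivrMr// ltr_pMr// ltr1n.
have := fd _ e0; rewrite !nearE /dnbhs /within/= => /(@nbhs_nc 0) -[r r0 rP]; exists r => // h hr.
have [->|h0] := eqVneq h 0; first by rewrite addr0 mulr0 !subrr nc0 mulr0.
have := rP h; rewrite subr0 => /(_ hr h0)/ltW.
rewrite -(@ler_pM2r _ (nc h)) ?nc_gt0// -ncM mulrBl /GRing.scale/=.
by rewrite mulrAC mulVf// mul1r [h + z]addrC.
Qed.

Lemma derivable_has_deriv f z : derivable (f : R[i]^o -> R[i]^o) z 1 ->
  has_deriv f z (cderiv f z).
Proof.
move=> fz; apply/has_derivP; rewrite /cderiv /derive1.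
move: fz; rewrite /derivable /=.
by under eq_fun do rewrite [_ *: (1 : R[i]^o)]mulr1.
Qed.

Lemma has_deriv_derivable f z d : has_deriv f z d ->
  derivable (f : R[i]^o -> R[i]^o) z 1 /\ cderiv f z = d.
Proof.
move/has_derivP => fz; split.
  rewrite /derivable; apply/cvg_ex; exists d.
  by under eq_fun do rewrite [_ *: (1 : R[i]^o)]mulr1.
by rewrite /cderiv /derive1; apply: (@cvg_lim R[i]^o) => //; exact: norm_hausdorff.
Qed.

Lemma has_deriv_continuous f z d : has_deriv f z d ->
  {for z, continuous (f : R[i]^o -> R[i]^o)}.
Proof.
move=> fz; have [fz' _] := has_deriv_derivable fz.
by apply: differentiable_continuous; apply/derivable1_diffP.
Qed.

Lemma has_deriv_lip f z d : has_deriv f z d -> exists2 r : R, 0 < r &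
  forall h, nc h < r -> nc (f (z + h) - f z) <= (nc d + 1) * nc h.
Proof.
move=> /(_ 1 ltac:(by []))[r r0 rP]; exists r => // h hr.
have -> : f (z + h) - f z = (f (z + h) - f z - d * h) + d * h by rewrite subrK.
by apply: (le_trans (ncD _ _)); rewrite ncM mulrDl addrC lerD2l; exact: rP.
Qed.

(** The remainder is the sum of the two linear remainders and of the product of the
    increments, which is quadratic in h; each gets a third of e. *)
Lemma has_derivM f g z d d' : has_deriv f z d -> has_deriv g z d' ->
  has_deriv (fun w => f w * g w) z (d * g z + f z * d').
Proof.
move=> fd gd e e0.
have [r1 r10 r1P] := has_deriv_lip fd.
have [r2 r20 r2P] := has_deriv_lip gd.
have A0 : 0 < nc (g z) + 1 by rewrite ltr_wpDl ?nc_ge0.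
have B0 : 0 < nc (f z) + 1 by rewrite ltr_wpDl ?nc_ge0.
have C0 : 0 < nc d + 1 by rewrite ltr_wpDl ?nc_ge0.
have D0 : 0 < nc d' + 1 by rewrite ltr_wpDl ?nc_ge0.
have e3 : 0 < e / 3 by rewrite divr_gt0.
have [r3 r30 r3P] := fd (e / 3 / (nc (g z) + 1)) ltac:(by rewrite !divr_gt0).
have [r4 r40 r4P] := gd (e / 3 / (nc (f z) + 1)) ltac:(by rewrite !divr_gt0).
exists (Num.min (Num.min r1 r2) (Num.min (Num.min r3 r4)
   (e / 3 / (nc d + 1) / (nc d' + 1)))).
  by rewrite !lt_min r10 r20 r30 r40 !divr_gt0.
move=> h; rewrite !lt_min => /and3P[/andP[h1 h2] /andP[h3 h4] h5].
have -> : f (z + h) * g (z + h) - f z * g z - (d * g z + f z * d') * h =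
  (f (z + h) - f z - d * h) * g z + f z * (g (z + h) - g z - d' * h) +
  (f (z + h) - f z) * (g (z + h) - g z) by ring.
have -> : e * nc h = e / 3 * nc h + e / 3 * nc h + e / 3 * nc h by field.
apply: (le_trans (ncD _ _)); rewrite lerD//.
  apply: (le_trans (ncD _ _)); rewrite !ncM lerD//.
    apply: (le_trans (ler_pM (nc_ge0 _) (nc_ge0 _) (r3P _ h3) (lexx _))).
    rewrite mulrAC ler_wpM2r ?nc_ge0// mulrAC ler_pdivrMr// ler_wpM2l ?lerDl//.
    exact: ltW.
  apply: (le_trans (ler_pM (nc_ge0 _) (nc_ge0 _) (lexx _) (r4P _ h4))).
  rewrite mulrA ler_wpM2r ?nc_ge0// mulrC mulrAC ler_pdivrMr// ler_wpM2l ?lerDl//.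
  exact: ltW.
rewrite ncM; apply: (le_trans (ler_pM (nc_ge0 _) (nc_ge0 _) (r1P _ h1) (r2P _ h2))).
rewrite mulrA ler_wpM2r ?nc_ge0//.
rewrite -ler_pdivlMr// mulrC -ler_pdivlMr//.
by rewrite [leRHS]mulrAC ltW.
Qed.

Lemma has_deriv_cst c z : has_deriv (fun=> c) z 0.
Proof.
move=> e e0; exists 1 => // h _; rewrite mul0r !subrr nc0.
by rewrite mulr_ge0 ?nc_ge0// ltW.
Qed.

Lemma has_deriv_id z : has_deriv id z 1.
Proof.
move=> e e0; exists 1 => // h _.
by rewrite mul1r [z + h]addrC addrK subrr nc0 mulr_ge0 ?nc_ge0// ltW.
Qed.

Lemma has_derivD f g z d d' : has_deriv f z d -> has_deriv g z d' ->
  has_deriv (fun x => f x + g x) z (d + d').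
Proof.
move=> fd gd e e0.
have [r1 r10 r1P] := fd (e / 2) ltac:(by rewrite divr_gt0).
have [r2 r20 r2P] := gd (e / 2) ltac:(by rewrite divr_gt0).
exists (Num.min r1 r2); first by rewrite lt_min r10.
move=> h; rewrite !lt_min => /andP[/r1P h1 /r2P h2].
have -> : f (z + h) + g (z + h) - (f z + g z) - (d + d') * h =
  (f (z + h) - f z - d * h) + (g (z + h) - g z - d' * h) by ring.
by rewrite [e]splitr mulrDl (le_trans (ncD _ _))// lerD.
Qed.

Lemma has_derivB f g z d d' : has_deriv f z d -> has_deriv g z d' ->
  has_deriv (fun x => f x - g x) z (d - d').
Proof.
move=> fd gd; have := has_derivD fd (has_derivM (has_deriv_cst (-1) z) gd).
rewrite mul0r add0r mulN1r; congr (has_deriv _ _ _).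
by apply/funext => x; rewrite mulN1r.
Qed.

Lemma has_deriv_near f g z d : (exists2 r, 0 < r & forall w, nc (w - z) < r -> f w = g w) ->
  has_deriv f z d -> has_deriv g z d.
Proof.
move=> [r r0 fg] fd e /fd[r' r'0 fP]; exists (Num.min r r').
  by rewrite lt_min r0.
move=> h; rewrite lt_min => /andP[hr hr'].
rewrite -!fg ?subrr ?nc0//; last by rewrite addrAC subrr add0r.
exact: fP.
Qed.

(** The remainder of 1/w is h^2 / (z^2 (z + h)), and |z + h| >= |z| / 2 for small h. *)
Lemma has_derivV z : z != 0 -> has_deriv (fun w => w^-1) z (- z ^- 2).
Proof.
move=> z0 e e0.
have nz : 0 < nc z by rewrite nc_gt0.
exists (Num.min (nc z / 2) (e * nc z ^+ 3 / 2)).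
  by rewrite lt_min !(divr_gt0,mulr_gt0,exprn_gt0).
move=> h; rewrite lt_min => /andP[h1 h2].
have zh : nc z / 2 <= nc (z + h).
  have := ncD (z + h) (- h); rewrite addrK ncN => H; lra.
have zh0 : z + h != 0 by rewrite -nc_gt0 (lt_le_trans _ zh)// divr_gt0.
have -> : (z + h)^-1 - z^-1 - - z ^- 2 * h = h * (h * (z ^- 2 * (z + h)^-1)).
  by field; rewrite ?zh0 ?z0.
rewrite !ncM mulrC ler_wpM2r ?nc_ge0// !ncV ncX.
rewrite mulrA ler_pdivrMr//; last by rewrite (lt_le_trans _ zh)// divr_gt0.
rewrite ler_pdivrMr ?exprn_gt0//.
apply: (le_trans (ltW h2)).
rewrite [leLHS](_ : _ = e * (nc z / 2) * nc z ^+ 2); last by field.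
by rewrite ler_wpM2r ?exprn_ge0 ?nc_ge0// ler_wpM2l// ltW.
Qed.

Lemma has_deriv_comp f g z d d' : has_deriv g z d -> has_deriv f (g z) d' ->
  has_deriv (f \o g) z (d' * d).
Proof.
move=> gd fd e e0.
set K := nc d + 1; have K0 : 0 < K by rewrite ltr_wpDl ?nc_ge0.
have D0 : 0 < nc d' + 1 by rewrite ltr_wpDl ?nc_ge0.
have [r r0 rP] := fd (e / 2 / K) ltac:(by rewrite !divr_gt0).
have [r1 r10 r1P] := gd 1 ltac:(by []).
have [r2 r20 r2P] := gd (e / 2 / (nc d' + 1)) ltac:(by rewrite !divr_gt0).
exists (Num.min (r / K) (Num.min r1 r2)); first by rewrite !lt_min r10 r20 divr_gt0.
move=> h; rewrite !lt_min => /and3P[hr hr1 hr2].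
set k := g (z + h) - g z.
have kK : nc k <= K * nc h.
  have -> : k = (k - d * h) + d * h by rewrite subrK.
  apply: (le_trans (ncD _ _)); rewrite ncM mulrDl addrC lerD2l.
  exact: r1P.
have kr : nc k < r.
  by apply: (le_lt_trans kK); rewrite mulrC -ltr_pdivlMr.
have -> : (f \o g) (z + h) - (f \o g) z - d' * d * h =
    (f (g z + k) - f (g z) - d' * k) + d' * (k - d * h).
  by rewrite /= [g z + k]addrC subrK; ring.
apply: (le_trans (ncD _ _)); rewrite [e]splitr mulrDl lerD//.
  apply: (le_trans (rP _ kr)).
  by rewrite -mulrA ler_wpM2l ?divr_ge0 ?(ltW e0)// ler_pdivrMl.
rewrite ncM; apply: (@le_trans _ _ ((nc d' + 1) * (e / 2 / (nc d' + 1) * nc h))).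
  apply: ler_pM; rewrite ?nc_ge0 ?lerDl//.
  exact: r2P.
by rewrite mulrA [_ * (e / 2 / _)]mulrC divfK// gt_eqF.
Qed.

End toolkit.

(** * Integrals of continuous functions on segments *)

Section interval_integral.
Variable R : realType.
Implicit Types (a b c x e k : R) (f g : R -> R).

Definition ctson a b f := forall x, a <= x <= b -> {for x, continuous f}.

Definition itg a b f : R := \int[@lebesgue_measure R]_(x in `[a, b]) f x.

Lemma ctson_within a b f : ctson a b f -> {within `[a, b], continuous f}.
Proof.
move=> cf; apply: continuous_in_subspaceT => x /set_mem /=.
by rewrite in_itv/=; exact: cf.
Qed.

Lemma ctson_integrable a b f : ctson a b f ->
  (@lebesgue_measure R).-integrable `[a, b] (EFin \o f).
Proof.
move=> cf; apply: continuous_compact_integrable; first exact: segment_compact.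
exact: ctson_within.
Qed.

Lemma itgD a b f g : ctson a b f -> ctson a b g ->
  itg a b (fun x => f x + g x) = itg a b f + itg a b g.
Proof. by move=> cf cg; apply: RintegralD => //; exact: ctson_integrable. Qed.

Lemma itgB a b f g : ctson a b f -> ctson a b g ->
  itg a b (fun x => f x - g x) = itg a b f - itg a b g.
Proof. by move=> cf cg; apply: RintegralB => //; exact: ctson_integrable. Qed.

Lemma itgZ a b k f : ctson a b f -> itg a b (fun x => k * f x) = k * itg a b f.
Proof. by move=> cf; apply: RintegralZl => //; exact: ctson_integrable. Qed.

Lemma itg_cst a b k : a <= b -> itg a b (fun=> k) = k * (b - a).
Proof.
move=> ab; rewrite /itg Rintegral_cst//= lebesgue_measure_itv/= lte_fin.
by move: ab; rewrite le_eqVlt => /predU1P[->|->//]; rewrite ltxx subrr.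
Qed.

Lemma le_itg a b f g : ctson a b f -> ctson a b g ->
  (forall x, a <= x <= b -> f x <= g x) -> itg a b f <= itg a b g.
Proof.
move=> cf cg fg; apply: le_Rintegral => //; try exact: ctson_integrable.
Qed.

Lemma itg_split b a c f : a <= b <= c -> ctson a c f ->
  itg a b f + itg b c f = itg a c f.
Proof.
move=> /andP[ab bc] cf.
have icf := ctson_integrable cf.
have := @Rintegral_itvB _ f (BLeft a) (BRight c) b icf.
rewrite !bnd_simp => /(_ ab bc); rewrite Rintegral_itv_obnd_cbnd.
  by rewrite -/(itg _ _ _) -/(itg _ _ _) -/(itg _ _ _) => <-; rewrite addrCA subrr addr0.
apply: integrableS icf => //.
by apply: subset_itvr; rewrite bnd_simp.
Qed.

Lemma ctson_cst a b k : ctson a b (fun=> k).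
Proof. by move=> x _; exact: cvg_cst. Qed.

(** The form in which integrals are estimated in Goursat's argument: a function within e of
    its value predicted by the linear part. *)
Lemma itg_near_cst a b f k e : a <= b -> ctson a b f ->
  (forall x, a <= x <= b -> `|f x - k| <= e) -> `|itg a b f - k * (b - a)| <= e * (b - a).
Proof.
move=> ab cf fk; have cc := @ctson_cst a b.
have : itg a b f <= itg a b (fun=> k + e).
  apply: le_itg => // x /fk; rewrite ler_norml => /andP[_]; lra.
have : itg a b (fun=> k - e) <= itg a b f.
  apply: le_itg => // x /fk; rewrite ler_norml => /andP[+ _]; lra.
rewrite !itg_cst// => h1 h2; rewrite ler_norml; apply/andP; split; nra.
Qed.

Lemma itg_norm_le a b f e : a <= b -> ctson a b f ->
  (forall x, a <= x <= b -> `|f x| <= e) -> `|itg a b f| <= e * (b - a).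
Proof.
move=> ab cf fe; have := @itg_near_cst a b f 0 e ab cf.
by rewrite mul0r subr0; apply => x /fe; rewrite subr0.
Qed.

End interval_integral.

(** * Goursat's theorem for divergence-free pairs *)

Section goursat.
Variable R : realType.
Variables (u v : R -> R -> R) (al be : R).

(** Real differentiability of u and v at a point, with partial derivatives u_s = [A.1.1],
    v_t = [A.2] and u_t = - v_s = [A.1.2]: the vector field (v, u) has zero divergence there. *)
Definition divfree_at (s0 t0 : R) := exists A : R * R * R,
  forall e, 0 < e -> exists2 r, 0 < r & forall s t, `|s - s0| < r -> `|t - t0| < r ->
    `|u s t - u s0 t0 - A.1.1 * (s - s0) - A.1.2 * (t - t0)|
       <= e * (`|s - s0| + `|t - t0|) /\
    `|v s t - v s0 t0 + A.1.2 * (s - s0) - A.2 * (t - t0)|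
       <= e * (`|s - s0| + `|t - t0|).

Hypothesis uvP : forall s0 t0, al < s0 < be -> divfree_at s0 t0.

Lemma lip_cont (f : R -> R) (x0 K : R) :
  (exists2 r, 0 < r & forall x, `|x - x0| < r -> `|f x - f x0| <= K * `|x - x0|) ->
  {for x0, continuous f}.
Proof.
move=> [r r0 fK]; apply/cvgrPdist_le => e e0.
have K1 : 0 < `|K| + 1 by rewrite ltr_wpDl.
near=> x.
rewrite distrC; apply: (@le_trans _ _ (K * `|x - x0|)).
  by apply: fK; rewrite distrC; near: x; exact: (@cvgr_dist_lt _ _ _ _ _ id x0 cvg_id).
apply: (@le_trans _ _ ((`|K| + 1) * `|x - x0|)).
  by rewrite ler_wpM2r// (le_trans (ler_norm _))// lerDl.
rewrite -ler_pdivlMl// ltW// distrC; near: x.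
by apply: (@cvgr_dist_lt _ _ _ _ _ id x0 cvg_id); rewrite mulr_gt0// invr_gt0.
Unshelve. all: by end_near. Qed.

Lemma divfree_cts (s0 t0 : R) : al < s0 < be ->
  [/\ {for s0, continuous (u ^~ t0)} & {for t0, continuous (v s0)}].
Proof.
move=> /(uvP t0)[A /(_ 1 ltac:(by []))[r r0 rP]]; split.
  apply: (@lip_cont _ _ (1 + `|A.1.1|)); exists r => // s hs.
  have := (rP s t0 hs); rewrite subrr normr0 => /(_ r0)[+ _].
  rewrite mulr0 subr0 addr0 mul1r mulrDl mul1r -normrM => H.
  apply: le_trans (lerD H (lexx _)).
  by apply: le_trans (ler_normD _ _); rewrite subrK.
apply: (@lip_cont _ _ (1 + `|A.2|)); exists r => // t ht.
have := (rP s0 t); rewrite subrr normr0 => /(_ r0 ht)[_].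
rewrite mulr0 addr0 add0r mul1r mulrDl mul1r -normrM => H.
apply: le_trans (lerD H (lexx _)).
by apply: le_trans (ler_normD _ _); rewrite subrK.
Qed.

(** The boundary integral of u ds - v dt over [a, b] x [c, d]; by Green's formula it would be
    minus the integral of u_t + v_s. *)
Definition flux a b c d : R :=
  itg a b (fun s => u s c - u s d) - itg c d (fun t => v b t - v a t).

Lemma flux_ctsu a b c : al < a -> b < be -> ctson a b (u ^~ c).
Proof.
move=> aa bb s /andP[as_ sb].
by have [] := @divfree_cts s c; rewrite ?(lt_le_trans aa)//= (le_lt_trans sb).
Qed.

Lemma flux_ctsv s c d : al < s < be -> ctson c d (v s).
Proof. by move=> hs t _; have [] := @divfree_cts s t. Qed.

Lemma ctsonB a b (f g : R -> R) : ctson a b f -> ctson a b g ->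
  ctson a b (fun x => f x - g x).
Proof. by move=> cf cg x hx; apply: cvgB; [exact: cf|exact: cg]. Qed.

Lemma flux_splits m a b c d : al < a -> b < be -> a <= m <= b ->
  flux a m c d + flux m b c d = flux a b c d.
Proof.
move=> aa bb /andP[am mb].
have am' : al < m by apply: lt_le_trans am.
have mb' : m < be by apply: le_lt_trans mb _.
rewrite /flux -(@itg_split _ m a b) ?am//; last first.
  by apply: ctsonB; exact: flux_ctsu.
have hb : al < b < be by rewrite bb (lt_le_trans am').
have ha : al < a < be by rewrite aa (le_lt_trans am).
rewrite !itgB; try exact: flux_ctsu; try (apply: flux_ctsv => //; exact/andP).
by ring.
Qed.

Lemma flux_splitt m a b c d : al < a -> a <= b -> b < be -> c <= m <= d ->
  flux a b c m + flux a b m d = flux a b c d.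
Proof.
move=> aa ab bb cmd.
have hb : al < b < be by rewrite bb (lt_le_trans aa).
have ha : al < a < be by rewrite aa (le_lt_trans ab).
rewrite /flux -(@itg_split _ m c d)//; last first.
  by apply: ctsonB; exact: flux_ctsv.
rewrite !itgB; try exact: flux_ctsu; try (apply: flux_ctsv => //; exact/andP).
by ring.
Qed.

(** The linear parts of u and v contribute opposite amounts because u_t = - v_s. Only the
    remainders are left, each at most e times the half-perimeter L, on edges of total length
    2 L. *)
Lemma flux_small a b c d s0 t0 (A : R * R * R) e : al < a -> b < be ->
  a <= s0 <= b -> c <= t0 <= d -> 0 <= e ->
  (forall s t, a <= s <= b -> c <= t <= d ->
    `|u s t - u s0 t0 - A.1.1 * (s - s0) - A.1.2 * (t - t0)|
       <= e * (`|s - s0| + `|t - t0|) /\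
    `|v s t - v s0 t0 + A.1.2 * (s - s0) - A.2 * (t - t0)|
       <= e * (`|s - s0| + `|t - t0|)) ->
  `|flux a b c d| <= 2 * e * ((b - a) + (d - c)) ^+ 2.
Proof.
move=> aa bb /andP[as0 s0b] /andP[ct0 t0d] e0 H.
have ab := le_trans as0 s0b; have cd := le_trans ct0 t0d.
have hb : al < b < be by rewrite bb (lt_le_trans aa).
have ha : al < a < be by rewrite aa (le_lt_trans ab).
set L := (b - a) + (d - c).
have dist s t : a <= s <= b -> c <= t <= d -> e * (`|s - s0| + `|t - t0|) <= e * L.
  move=> /andP[as_ sb] /andP[ct td]; rewrite ler_wpM2l// /L.
  by apply: lerD; rewrite ler_norml; apply/andP; split; lra.
have I1 : `|itg a b (fun s => u s c - u s d) - A.1.2 * (c - d) * (b - a)|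
    <= 2 * e * L * (b - a).
  apply: itg_near_cst => // [|s hs]; first by apply: ctsonB; exact: flux_ctsu.
  have hc : c <= c <= d by rewrite lexx.
  have hd : c <= d <= d by rewrite lexx andbT.
  have [h1 _] := H s c hs hc; have [h2 _] := H s d hs hd.
  have k := lerD (le_trans h1 (dist _ _ hs hc)) (le_trans h2 (dist _ _ hs hd)).
  rewrite [leRHS](_ : _ = e * L + e * L); last by ring.
  by apply: le_trans k; apply: le_trans (ler_normB _ _); rewrite le_eqVlt; apply/orP; left;
    apply/eqP; congr (`|_|); ring.
have I2 : `|itg c d (fun t => v b t - v a t) - - A.1.2 * (b - a) * (d - c)|
    <= 2 * e * L * (d - c).
  apply: itg_near_cst => // [|t ht]; first by apply: ctsonB; exact: flux_ctsv.
  have hc : a <= a <= b by rewrite lexx.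
  have hd : a <= b <= b by rewrite lexx andbT.
  have [_ h1] := H a t hc ht; have [_ h2] := H b t hd ht.
  have k := lerD (le_trans h2 (dist _ _ hd ht)) (le_trans h1 (dist _ _ hc ht)).
  rewrite [leRHS](_ : _ = e * L + e * L); last by ring.
  by apply: le_trans k; apply: le_trans (ler_normB _ _); rewrite le_eqVlt; apply/orP; left;
    apply/eqP; congr (`|_|); ring.
rewrite /flux; set X := itg a b _ in I1 *; set Y := itg c d _ in I2 *.
have -> : X - Y = (X - A.1.2 * (c - d) * (b - a)) -
    (Y - - A.1.2 * (b - a) * (d - c)) by ring.
apply: (le_trans (ler_normB _ _)); apply: (le_trans (lerD I1 I2)).
by rewrite -mulrDr -/L expr2 mulrA.
Qed.

Section bisection.
Variable eps : R.

Record rect := Rect {lo1 : R; hi1 : R; lo2 : R; hi2 : R}.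

Definition inside q q' := [/\ lo1 q <= lo1 q', hi1 q' <= hi1 q,
  lo2 q <= lo2 q' & hi2 q' <= hi2 q].

(** The property that bisection preserves: the flux exceeds [eps] times the area. *)
Definition bad q := [/\ al < lo1 q, lo1 q <= hi1 q, hi1 q < be, lo2 q <= hi2 q &
  eps * (hi1 q - lo1 q) * (hi2 q - lo2 q) < `|flux (lo1 q) (hi1 q) (lo2 q) (hi2 q)|].

(** Flux and area are both additive, so if neither half were bad the whole would not be. *)
Lemma bad_halves1 q : bad q -> exists2 q', bad q' &
  [/\ inside q q', hi1 q' - lo1 q' = (hi1 q - lo1 q) / 2 & hi2 q' - lo2 q' = hi2 q - lo2 q].
Proof.
case: q => a b c d [/= aa ab bb cd B].
set m := (a + b) / 2.
have am : a <= m by rewrite /m; lra.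
have mb : m <= b by rewrite /m; lra.
have amb : a <= m <= b by rewrite am.
have E := @flux_splits m a b c d aa bb amb.
have [B1|B1] := ltP (eps * (m - a) * (d - c)) `|flux a m c d|.
  exists (Rect a m c d); split => //=; first exact: le_lt_trans bb.
  by rewrite /m; field.
have [B2|B2] := ltP (eps * (b - m) * (d - c)) `|flux m b c d|.
  exists (Rect m b c d); split => //=; first exact: lt_le_trans am.
  by rewrite /m; field.
exfalso; move: B; rewrite ltNge => /negP; apply.
rewrite -E (le_trans (ler_normD _ _))// (le_trans (lerD B1 B2))//.
by rewrite le_eqVlt; apply/orP; left; apply/eqP; ring.
Qed.

Lemma bad_halves2 q : bad q -> exists2 q', bad q' &
  [/\ inside q q', hi1 q' - lo1 q' = hi1 q - lo1 q & hi2 q' - lo2 q' = (hi2 q - lo2 q) / 2].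
Proof.
case: q => a b c d [/= aa ab bb cd B].
set m := (c + d) / 2.
have am : c <= m by rewrite /m; lra.
have mb : m <= d by rewrite /m; lra.
have amb : c <= m <= d by rewrite am.
have E := @flux_splitt m a b c d aa ab bb amb.
have [B1|B1] := ltP (eps * (b - a) * (m - c)) `|flux a b c m|.
  by exists (Rect a b c m); split => //=; rewrite /m; field.
have [B2|B2] := ltP (eps * (b - a) * (d - m)) `|flux a b m d|.
  by exists (Rect a b m d); split => //=; rewrite /m; field.
exfalso; move: B; rewrite ltNge => /negP; apply.
rewrite -E (le_trans (ler_normD _ _))// (le_trans (lerD B1 B2))//.
by rewrite le_eqVlt; apply/orP; left; apply/eqP; ring.
Qed.

Lemma inside_trans q q' q'' : inside q q' -> inside q' q'' -> inside q q''.
Proof.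
move=> [a b c d] [a' b' c' d']; split; first exact: le_trans a'.
- exact: le_trans b' b.
- exact: le_trans c'.
- exact: le_trans d' d.
Qed.

(** Halving both sides keeps the shape of the rectangle, so that its area stays comparable
    with the square of its perimeter. The conditional form yields a total function to iterate. *)
Lemma bad_quarter q : exists q', bad q -> bad q' /\
  [/\ inside q q', hi1 q' - lo1 q' = (hi1 q - lo1 q) / 2 &
      hi2 q' - lo2 q' = (hi2 q - lo2 q) / 2].
Proof.
have [Bq|?] := pselect (bad q); last by exists q.
have [q1 Bq1 [i1 w1 h1]] := bad_halves1 Bq.
have [q2 Bq2 [i2 w2 h2]] := bad_halves2 Bq1.
exists q2 => _; split => //; split; first exact: inside_trans i2.
  by rewrite w2 w1.
by rewrite h2 h1.
Qed.

Lemma bad_seq q : bad q -> exists Q : nat -> rect, [/\ Q 0%N = q,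
  forall n, bad (Q n), forall n, inside (Q n) (Q n.+1) &
  forall n, hi1 (Q n) - lo1 (Q n) = (hi1 q - lo1 q) / 2 ^+ n /\
            hi2 (Q n) - lo2 (Q n) = (hi2 q - lo2 q) / 2 ^+ n].
Proof.
move=> Bq; have [F FP] := choice bad_quarter.
exists (fun n => iter n F q).
have Bn n : bad (iter n F q).
  by elim: n => // n IH; have [] := FP _ IH.
split => // n; first by have [_ []] := FP _ (Bn n).
elim: n => [|n [IH1 IH2]]; first by rewrite !expr0 !divr1.
have [_ [_ -> ->]] := FP _ (Bn n); rewrite IH1 IH2 exprS.
by split; field; rewrite expf_neq0.
Qed.

End bisection.

Lemma nested_point (a b : nat -> R) : (forall n, a n <= a n.+1) ->
  (forall n, b n.+1 <= b n) -> (forall n, a n <= b n) ->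
  exists p, forall n, a n <= p <= b n.
Proof.
move=> aS bS ab.
have /nondecreasing_seqP an := aS; have /nonincreasing_seqP bn := bS.
have abn m n : a m <= b n.
  apply: (le_trans (an _ (maxn m n) (leq_maxl _ _))) => /=.
  by apply: (le_trans (ab _)); apply: bn; exact: leq_maxr.
exists (sup (range a)) => n; apply/andP; split.
  by apply: ub_le_sup; [exists (b 0%N) => _ [m _ <-]|exists n].
by apply: ge_sup; [exists (a 0%N), 0%N|move=> _ [m _ <-]].
Qed.

Lemma itg0 (a b : R) : a <= b -> itg a b (fun=> 0) = 0.
Proof. by move=> ab; rewrite itg_cst// mul0r. Qed.

Lemma itg_pt (a : R) f : itg a a f = 0.
Proof. by rewrite /itg set_itv1 Rintegral_set1. Qed.

Lemma geometric_small (L r : R) : 0 < r -> exists n, L / 2 ^+ n < r.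
Proof.
move=> r0; exists (Num.bound (`|L| / r)).
rewrite ltr_pdivrMr ?exprn_gt0// mulrC -ltr_pdivrMr//.
apply: (@le_lt_trans _ _ (`|L| / r)); first by rewrite ler_pM2r ?invr_gt0// ler_norm.
apply: (@lt_le_trans _ _ (Num.bound (`|L| / r))%:R).
  by apply: archi_boundP; rewrite divr_ge0// ltW.
by rewrite -natrX ler_nat ltnW// ltn_expl.
Qed.

(** Otherwise some rectangle is bad, and bisection produces nested bad rectangles shrinking
    to a point; near this point [flux_small] bounds the flux by an arbitrarily small multiple
    of the area. *)
Theorem flux_eq0 a b c d : al < a -> a <= b -> b < be -> c <= d -> flux a b c d = 0.
Proof.
move=> aa ab bb cd; have [ba|W1] := leP b a.
  have -> : b = a by apply/eqP; rewrite eq_le ba ab.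
  by rewrite /flux itg_pt; under [in X in _ - X]eq_fun do rewrite subrr; rewrite itg0// subrr.
have [dc|H1] := leP d c.
  have -> : d = c by apply/eqP; rewrite eq_le dc cd.
  by rewrite /flux itg_pt; under eq_fun do rewrite subrr; rewrite itg0// subrr.
rewrite -subr_gt0 in W1; rewrite -subr_gt0 in H1.
apply/eqP; rewrite -normr_le0.
have [//|B0] := leP `|flux a b c d| 0; exfalso.
pose W := b - a; pose H := d - c.
have W0 : 0 <= W by rewrite subr_ge0.
have H0 : 0 <= H by rewrite subr_ge0.
pose eps := `|flux a b c d| / (2 * (W * H + 1)).
have WH0 : 0 < W * H + 1 by rewrite ltr_wpDl ?mulr_ge0.
have eps0 : 0 < eps by rewrite divr_gt0// mulr_gt0.
have Bq : bad eps (Rect a b c d).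
  split => //=; rewrite -mulrA -/W -/H /eps.
  rewrite -mulrA gtr_pMr// mulrC ltr_pdivrMr ?mulr_gt0// mul1r.
  have := mulr_ge0 W0 H0; lra.
have [Q [Q0 QB Qi Qw]] := bad_seq Bq.
have [s0 s0P] := @nested_point (lo1 \o Q) (hi1 \o Q) (fun n => let: And4 h _ _ _ := Qi n in h)
  (fun n => let: And4 _ h _ _ := Qi n in h) (fun n => let: And5 _ h _ _ _ := QB n in h).
have [t0 t0P] := @nested_point (lo2 \o Q) (hi2 \o Q) (fun n => let: And4 _ _ h _ := Qi n in h)
  (fun n => let: And4 _ _ _ h := Qi n in h) (fun n => let: And5 _ _ _ h _ := QB n in h).
have hs0 : al < s0 < be.
  move: (s0P 0%N); rewrite /= Q0 /= => /andP[h1 h2].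
  by rewrite (lt_le_trans aa)// (le_lt_trans h2).
have [A AP] := uvP t0 hs0.
pose L := W + H.
have L0 : 0 < L by rewrite addr_gt0.
(* half of what badness requires: with this e, [flux_small] gives eps * (area) / 2 *)
pose e := eps * W * H / (4 * L ^+ 2).
have e0 : 0 < e.
  apply: divr_gt0; first by apply: mulr_gt0 => //; apply: mulr_gt0.
  by apply: mulr_gt0 => //; apply: exprn_gt0.
have [r r0 rP] := AP e e0.
have [n nr] := geometric_small L r0.
have [q1 q2 q3 q4 q5] := QB n.
have [Qw1 Qh1] := Qw n.
have p2 : 0 < 2 ^+ n :> R by rewrite exprn_gt0.
have := @flux_small _ _ _ _ s0 t0 A e q1 q3 (s0P n) (t0P n) (ltW e0).
rewrite Qw1 Qh1 /= -/W -/H => B.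
suff : eps * (hi1 (Q n) - lo1 (Q n)) * (hi2 (Q n) - lo2 (Q n)) <
   2 * e * (W / 2 ^+ n + H / 2 ^+ n) ^+ 2.
  rewrite Qw1 Qh1 /= -/W -/H /e -mulrDl -/L.
  rewrite [ltRHS](_ : _ = (eps * (W / 2 ^+ n) * (H / 2 ^+ n)) / 2); last first.
    by field; rewrite ?(gt_eqF L0) ?(gt_eqF p2).
  apply/negP; rewrite -leNgt ler_pdivrMr// ler_peMr ?ler1n//.
  by rewrite ltW//; apply: mulr_gt0; [apply: mulr_gt0 => //|]; exact: divr_gt0.
apply: (lt_le_trans q5); apply: B => s t hs ht; apply: rP.
  apply: le_lt_trans nr; move: (s0P n) hs Qw1 => /= /andP[? ?] /andP[? ?] Qw1.
  have : W / 2 ^+ n <= L / 2 ^+ n by rewrite ler_pM2r ?invr_gt0// lerDl.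
  by rewrite -/W in Qw1; rewrite -Qw1; apply: le_trans; rewrite ler_norml; apply/andP; split; lra.
apply: le_lt_trans nr; move: (t0P n) ht Qh1 => /= /andP[? ?] /andP[? ?] Qh1.
have : H / 2 ^+ n <= L / 2 ^+ n by rewrite ler_pM2r ?invr_gt0// lerDr.
by rewrite -/H in Qh1; rewrite -Qh1; apply: le_trans; rewrite ler_norml; apply/andP; split; lra.
Qed.

End goursat.

(** * Means over circles *)

Section circles.
Variable R : realType.
Implicit Types (t s r rho e : R) (z w d : R[i]).

Definition circ rho t : R[i] := rho%:C * (cos t +i* sin t).

Lemma circE rho t : circ rho t = (rho * cos t) +i* (rho * sin t).
Proof. by rewrite /circ; simpc. Qed.

Lemma nc_cis t : nc (cos t +i* sin t : R[i]) = 1.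
Proof. by rewrite /nc /= cos2Dsin2 sqrtr1. Qed.

Lemma nc_circ rho t : nc (circ rho t) = `|rho|.
Proof. by rewrite ncM nc_real nc_cis mulr1. Qed.

Lemma circD rho rho' t t' : circ rho t * circ rho' t' = circ (rho * rho') (t + t').
Proof.
rewrite /circ [in RHS]rmorphM cosD sinD mulrACA; congr (_ * _).
by simpc; congr (_ +i* _); rewrite addrC.
Qed.

Lemma derive_approx (f : R -> R) (x d : R) : is_derive x 1 f d ->
  forall e, 0 < e -> exists2 r, 0 < r &
    forall h, `|h| < r -> `|f (x + h) - f x - d * h| <= e * `|h|.
Proof.
move=> [fx fd] e e0; move: fx; rewrite /derivable.
move=> /cvg_ex[l fl].
have ld : l = d by rewrite -fd; apply/esym; exact: (@cvg_lim R^o).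
rewrite {}ld in fl; move/cvgrPdist_le : fl => /(_ e e0).
rewrite !nearE /dnbhs /within /= => /nbhs_ballP[r /= r0 rP]; exists r => // h hr.
have [->|h0] := eqVneq h 0; first by rewrite addr0 mulr0 !subrr normr0 mulr0.
have := rP h; rewrite /ball/= sub0r normrN => /(_ hr h0).
rewrite -(@ler_pM2r _ `|h|) ?normr_gt0// -normrM mulrBl /GRing.scale/=.
rewrite mulr1 mulrAC mulVf// mul1r [h + x]addrC distrC.
by [].
Qed.

Lemma cexp_approx e : 0 < e -> exists2 r, 0 < r & forall s t, `|s| < r -> `|t| < r ->
  nc (circ (expR s) t - 1 - (s +i* t)) <= e * (`|s| + `|t|).
Proof.
move=> e0.
have e90 : 0 < Num.min 1 (e / 9) by rewrite lt_min ltr01/= divr_gt0.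
set e9 := Num.min 1 (e / 9) in e90.
have [r1 r10 H1] := derive_approx (is_derive_expR 0) e90.
have [r2 r20 H2] := derive_approx (is_derive_cos 0) e90.
have [r3 r30 H3] := derive_approx (is_derive_sin 0) e90.
exists (Num.min (Num.min r1 r2) (Num.min r3 e9)).
  by rewrite lt_min lt_min r10 r20 lt_min r30.
move=> s t; rewrite !(lt_min _ (Num.min _ _)) !(lt_min _ r1) !(lt_min _ r3).
move=> /andP[/andP[s1 s2] /andP[s3 s4]] /andP[/andP[t1 t2] /andP[t3 t4]].
have := H1 s s1; have := H2 t t2; have := H3 t t3.
rewrite !add0r sin0 cos0 expR0 oppr0 !mul1r mul0r !subr0 ?addr0 => {}H3 {}H2 {}H1.
have e91 : e9 <= 1 by rewrite ge_min lexx.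
have e9e : e9 <= e / 9 by rewrite ge_min lexx orbT.
apply: (le_trans (nc_ReIm _)); rewrite circE !cReB !cImB /= subr0.
set a := `|s| in s4 H1 *; set b := `|t| in t4 H2 H3 *.
have a0 : 0 <= a := normr_ge0 _.
have b0 : 0 <= b := normr_ge0 _.
have E1 : `|expR s - 1| <= 2 * a.
  have -> : expR s - 1 = (expR s - 1 - s) + s by ring.
  apply: (le_trans (ler_normD _ _)); rewrite -/a; nra.
have E3 : `|expR s| <= 3.
  have -> : expR s = (expR s - 1) + 1 by ring.
  apply: (le_trans (ler_normD _ _)); rewrite normr1; lra.
have S2 : `|sin t| <= 2 * b.
  have -> : sin t = (sin t - t) + t by ring.
  apply: (le_trans (ler_normD _ _)); rewrite -/b; nra.
have X : `|expR s * cos t - 1 - s| <= e9 * a + 3 * (e9 * b).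
  have -> : expR s * cos t - 1 - s = (expR s - 1 - s) + expR s * (cos t - 1) by ring.
  apply: (le_trans (ler_normD _ _)); rewrite lerD// normrM.
  by apply: ler_pM.
have Y : `|expR s * sin t - t| <= 2 * a * (2 * b) + e9 * b.
  have -> : expR s * sin t - t = (expR s - 1) * sin t + (sin t - t) by ring.
  apply: (le_trans (ler_normD _ _)); rewrite lerD// normrM.
  by apply: ler_pM.
apply: (le_trans (lerD X Y)).
apply: (@le_trans _ _ (9 * e9 * (a + b))); last first.
  by rewrite ler_wpM2r ?addr_ge0//; lra.
nra.
Qed.

(** Chain rule for F (exp (s + i t)): with a the product of F' and exp (s + i t), the
    partial derivatives are u_s = v_t = Re a and u_t = - v_s = - Im a. *)
Lemma polar_divfree (F : R[i] -> R[i]) s0 t0 d : has_deriv F (circ (expR s0) t0) d ->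
  divfree_at (fun s t => complex.Re (F (circ (expR s) t)))
             (fun s t => complex.Im (F (circ (expR s) t))) s0 t0.
Proof.
move=> Fd; set z0 := circ _ _ in Fd; set a := d * z0.
exists (complex.Re a, - complex.Im a, complex.Re a) => e e0.
have K0 : 0 < 3 * nc z0 + nc a + 1 by rewrite ltr_wpDl// addr_ge0 ?mulr_ge0 ?nc_ge0.
set K := 3 * nc z0 + nc a + 1 in K0.
have e'0 : 0 < Num.min 1 (e / K) by rewrite lt_min ltr01/= divr_gt0.
set e' := Num.min 1 (e / K) in e'0.
have e'1 : e' <= 1 by rewrite ge_min lexx.
have e'e : e' <= e / K by rewrite ge_min lexx orbT.
have [r1 r10 H1] := Fd e' e'0.
have [r2 r20 H2] := cexp_approx e'0.
have z1 : 0 < nc z0 + 1 by rewrite ltr_wpDl ?nc_ge0.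
(* r1 / 6: the argument of F moves by at most 3 |z0| (|x| + |y|) *)
exists (Num.min r2 (r1 / 6 / (nc z0 + 1))); first by rewrite lt_min r20 !divr_gt0.
move=> s t; rewrite !lt_min => /andP[s1 s2] /andP[t1 t2].
set x := s - s0 in s1 s2 *; set y := t - t0 in t1 t2 *.
have := H2 x y s1 t1; set X := circ _ _ => {}H2.
have zE : circ (expR s) t = z0 + z0 * (X - 1).
  rewrite mulrBr mulr1 addrC subrK /X /z0 circD -expRD.
  by rewrite /x /y ![_ + (_ - _)]addrC !subrK.
have L0 : 0 <= `|x| + `|y| by rewrite addr_ge0.
set L := `|x| + `|y| in H2 L0 *.
have X1 : nc (X - 1) <= 3 * L.
  have -> : X - 1 = (X - 1 - (x +i* y)) + (x +i* y) by rewrite subrK.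
  apply: (le_trans (ncD _ _)).
  have := nc_ReIm (x +i* y); rewrite /= -/L => h.
  have := ler_wpM2r L0 e'1; lra.
have k1 : nc (z0 * (X - 1)) <= 3 * nc z0 * L.
  rewrite ncM -mulrA mulrCA ler_wpM2l ?nc_ge0//.
have kr : nc (z0 * (X - 1)) < r1.
  apply: (le_lt_trans k1).
  have : L < 2 * (r1 / 6 / (nc z0 + 1)) by rewrite /L; lra.
  rewrite [ltRHS](_ : _ = r1 / 3 / (nc z0 + 1)); last by field; rewrite gt_eqF.
  rewrite ltr_pdivlMr// => LL.
  have := nc_ge0 z0; nra.
have M : nc (F (circ (expR s) t) - F z0 - a * (x +i* y)) <= e * L.
  have -> : F (circ (expR s) t) - F z0 - a * (x +i* y) =
    (F (z0 + z0 * (X - 1)) - F z0 - d * (z0 * (X - 1))) + a * (X - 1 - (x +i* y)).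
    by rewrite zE /a; ring.
  apply: (le_trans (ncD _ _)).
  apply: (@le_trans _ _ (e' * K * L)); last first.
    by rewrite ler_wpM2r// -ler_pdivlMr.
  have := H1 _ kr; have := ler_wpM2l (ltW e'0) k1.
  have : nc (a * (X - 1 - (x +i* y))) <= nc a * (e' * L).
    by rewrite ncM ler_wpM2l ?nc_ge0.
  have : 0 <= e' * L by rewrite mulr_ge0// ltW.
  rewrite /K; nra.
split; rewrite /=.
  apply: le_trans M; apply: le_trans (ler_Re _).
  by rewrite !cReB [complex.Re (a * _)]cReM /= -/z0 mulNr opprK opprB addrA addrAC.
apply: le_trans M; apply: le_trans (ler_Im _).
by rewrite !cImB [complex.Im (a * _)]cImM /= -/z0 mulNr opprD addrA addrAC.
Qed.

Lemma circ_period rho t : circ rho (t + 2 * pi) = circ rho t.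
Proof. by rewrite /circ mulr_natl cosD2pi sinD2pi. Qed.

(** The flux through the rectangle [ln r1, ln r2] x [0, 2 pi] vanishes, and so do its
    horizontal terms by periodicity; the two vertical ones are the integrals of Im F over
    the two circles. The slightly larger annulus gives room for differentiability on the
    closed rectangle. *)
Lemma Im_circle_const (F : R[i] -> R[i]) a b r1 r2 : 0 <= a ->
  (forall z, a < nc z < b -> exists d, has_deriv F z d) -> a < r1 -> r1 <= r2 -> r2 < b ->
  itg 0 (2 * pi) (fun t => complex.Im (F (circ r1 t))) =
  itg 0 (2 * pi) (fun t => complex.Im (F (circ r2 t))).
Proof.
move=> a0 Fd ar1 r12 r2b.
pose a' := (a + r1) / 2; pose b' := (r2 + b) / 2.
have a'0 : 0 < a' by rewrite /a' divr_gt0//; lra.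
have b'0 : 0 < b' by rewrite /b' divr_gt0//; lra.
have aa' : a < a' by rewrite /a'; lra.
have b'b : b' < b by rewrite /b'; lra.
have a'r1 : a' < r1 by rewrite /a'; lra.
have r2b' : r2 < b' by rewrite /b'; lra.
have r10 : 0 < r1 by apply: lt_trans a'r1.
have r20 : 0 < r2 by apply: lt_le_trans r12.
have D s t : ln a' < s < ln b' ->
   divfree_at (fun s t => complex.Re (F (circ (expR s) t)))
             (fun s t => complex.Im (F (circ (expR s) t))) s t.
  move=> /andP[s1 s2].
  have [d dP] : exists d, has_deriv F (circ (expR s) t) d.
    apply: Fd; rewrite nc_circ ger0_norm ?expR_ge0//; apply/andP; split.
      by apply: (lt_trans aa'); rewrite -(lnK a'0) ltr_expR.
    by apply: lt_trans b'b; rewrite -(lnK b'0) ltr_expR.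
  exact: polar_divfree dP.
have l1 : ln a' < ln r1 by rewrite ltr_ln ?posrE.
have l2 : ln r2 < ln b' by rewrite ltr_ln ?posrE.
have l12 : ln r1 <= ln r2 by rewrite ler_ln ?posrE.
have pi0 : (0 : R) <= 2 * pi by rewrite mulr_ge0 ?pi_ge0.
have := flux_eq0 D l1 l12 l2 pi0; rewrite /flux.
under [in X in X - _]eq_fun do rewrite -[2 * pi]add0r circ_period subrr.
rewrite itg0// sub0r => /eqP; rewrite oppr_eq0.
have h2 : ln a' < ln r2 < ln b' by rewrite l2 (lt_le_trans l1).
have h1 : ln a' < ln r1 < ln b' by rewrite l1 (le_lt_trans l12).
rewrite itgB; try exact: (@flux_ctsv _ _ _ _ _ D).
by rewrite !lnK ?posrE// subr_eq0 => /eqP.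
Qed.

Definition cavg (g : R -> R[i]) : R[i] :=
  ((2 * pi)^-1)%:C * (itg 0 (2 * pi) (fun t => complex.Re (g t)) +i*
                      itg 0 (2 * pi) (fun t => complex.Im (g t))).

(** For the real part, apply the statement about imaginary parts to i F. *)
Lemma circle_const (F : R[i] -> R[i]) a b r1 r2 : 0 <= a ->
  (forall z, a < nc z < b -> exists d, has_deriv F z d) -> a < r1 < b -> a < r2 < b ->
  cavg (fun t => F (circ r1 t)) = cavg (fun t => F (circ r2 t)).
Proof.
move=> a0 Fd; wlog r12 : r1 r2 / r1 <= r2 => [H h1 h2|].
  have [|/ltW] := leP r1 r2; first by move=> /H; apply.
  by move=> /H H'; apply/esym/H'.
move=> /andP[ar1 _] /andP[_ r2b]; rewrite /cavg; congr (_ * (_ +i* _)); last first.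
  exact: Im_circle_const Fd _ _ _.
have := @Im_circle_const (fun z => 'i%C * F z) a b r1 r2 a0 _ ar1 r12 r2b.
have E r : (fun t => complex.Im ('i%C * F (circ r t))) = (fun t => complex.Re (F (circ r t))).
  by apply/funext => t; rewrite cImM /= mul0r mul1r add0r.
rewrite !E; apply=> z /Fd[d dP]; exists (0 * F z + 'i%C * d).
exact: (has_derivM (has_deriv_cst _ _) dP).
Qed.

End circles.

(** * Calculus of circle means *)

Section circle_average.
Variable R : realType.
Implicit Types (t rho e : R) (z w d : R[i]) (g h : R -> R[i]).

Definition ccts g := forall t, {for t, continuous (g : R -> R[i]^o)}.

Lemma ccts_Re g a b : ccts g -> ctson a b (fun t => complex.Re (g t)).
Proof. by move=> cg t _; exact: (cvg_Re (cg t)). Qed.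

Lemma ccts_Im g a b : ccts g -> ctson a b (fun t => complex.Im (g t)).
Proof. by move=> cg t _; exact: (cvg_Im (cg t)). Qed.

Lemma cctsD g h : ccts g -> ccts h -> ccts (fun t => g t + h t).
Proof. by move=> cg ch t; exact: (ccvgD (cg t) (ch t)). Qed.

Lemma cctsM g h : ccts g -> ccts h -> ccts (fun t => g t * h t).
Proof. by move=> cg ch t; exact: (ccvgM (cg t) (ch t)). Qed.

Lemma ccts_cst z : ccts (fun=> z).
Proof. by move=> t; exact: cvg_cst. Qed.

Lemma cctsB g h : ccts g -> ccts h -> ccts (fun t => g t - h t).
Proof. by move=> cg ch t; exact: (ccvgB (cg t) (ch t)). Qed.

Lemma ccts_comp (f : R[i] -> R[i]) g :
  (forall t, {for g t, continuous (f : R[i]^o -> R[i]^o)}) -> ccts g -> ccts (f \o g).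
Proof. by move=> cf cg t; exact: (@continuous_comp R R[i]^o R[i]^o g f t (cg t) (cf t)). Qed.

Lemma ccts_sum (n : nat) (u : nat -> R -> R[i]) : (forall k, ccts (u k)) ->
  ccts (fun t => \sum_(k < n) u k t).
Proof.
move=> cu; elim: n => [|n IH].
  rewrite (_ : (fun _ => _) = (fun=> 0)); first exact: ccts_cst.
  by apply/funext => t; rewrite big_ord0.
rewrite (_ : (fun _ => _) = (fun t => \sum_(k < n) u k t + u n t)); first exact: (cctsD IH (cu n)).
by apply/funext => t; rewrite big_ord_recr.
Qed.

Lemma ccts_exp g n : ccts g -> ccts (fun t => g t ^+ n).
Proof.
move=> cg; elim: n => [|n IH]; first exact: ccts_cst.
rewrite (_ : (fun t => _) = (fun t => g t * g t ^+ n)); first exact: (cctsM cg IH).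
by apply/funext => t; rewrite exprS.
Qed.

Lemma ccts_inv g : (forall t, g t != 0) -> ccts g -> ccts (fun t => (g t)^-1).
Proof.
by move=> g0; apply: ccts_comp => t; exact: has_deriv_continuous (has_derivV (g0 t)).
Qed.

Lemma continuous_sqmod g t : {for t, continuous (g : R -> R[i]^o)} ->
  {for t, continuous (fun t => sqmod (g t))}.
Proof.
move=> cg; rewrite (_ : (fun _ => _) = (fun t => complex.Re (g t) * complex.Re (g t)
    + complex.Im (g t) * complex.Im (g t))); last first.
  by apply/funext => x; rewrite sqmodE !expr2.
by apply: cvgD; apply: cvgM; first [exact: (cvg_Re cg)|exact: (cvg_Im cg)].
Qed.

Let pi20 : (0 : R) < 2 * pi. Proof. by rewrite mulr_gt0// pi_gt0. Qed.

Lemma cavgD g h : ccts g -> ccts h ->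
  cavg (fun t => g t + h t) = cavg g + cavg h.
Proof.
move=> cg ch; rewrite /cavg -mulrDr; congr (_ * _).
under eq_fun do rewrite cReD; under [X in _ +i* itg _ _ X]eq_fun do rewrite cImD.
rewrite !itgD//; [exact: ccts_Im|exact: ccts_Im|exact: ccts_Re|exact: ccts_Re].
Qed.

Lemma cavgZ z g : ccts g -> cavg (fun t => z * g t) = z * cavg g.
Proof.
move=> cg; rewrite /cavg mulrCA; congr (_ * _).
under eq_fun do rewrite cReM; under [X in _ +i* itg _ _ X]eq_fun do rewrite cImM.
have cgr := @ccts_Re g 0 (2 * pi) cg; have cgi := @ccts_Im g 0 (2 * pi) cg.
have cZ k (f : R -> R) : ctson 0 (2 * pi) f -> ctson 0 (2 * pi) (fun t => k * f t).
  by move=> cf x hx; apply: cvgM; [exact: cvg_cst|exact: cf].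
rewrite itgB ?itgD ?itgZ//; try exact: cZ.
by case: z => a b; simpc.
Qed.

Lemma cavg_cst z : cavg (fun=> z) = z.
Proof.
rewrite /cavg !itg_cst ?(ltW pi20)// subr0; case: z => a b /=; simpc.
by rewrite ![_^-1 * (_ * _)]mulrC !mulfK// gt_eqF.
Qed.

Lemma cavg_sum n (u : nat -> R -> R[i]) : (forall k, ccts (u k)) ->
  cavg (fun t => \sum_(k < n) u k t) = \sum_(k < n) cavg (u k).
Proof.
move=> cu; elim: n => [|n IH].
  rewrite big_ord0 -[RHS](cavg_cst 0); congr cavg.
  by apply/funext => t; rewrite big_ord0.
rewrite big_ord_recr/= -IH -cavgD//; last exact: ccts_sum.
by congr cavg; apply/funext => t; rewrite big_ord_recr.
Qed.

Lemma ctsonX2 a b (f : R -> R) : ctson a b f -> ctson a b (fun t => f t ^+ 2).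
Proof.
move=> cf; rewrite (_ : (fun t => _) = (fun t => f t * f t)).
  by move=> x hx; apply: cvgM; exact: cf.
by apply/funext => t; rewrite expr2.
Qed.

(** The integral of (f - m)^2 is nonnegative for m the mean of f. *)
Lemma sqr_itg_le (f : R -> R) a b : a < b -> ctson a b f ->
  ((b - a)^-1 * itg a b f) ^+ 2 <= (b - a)^-1 * itg a b (fun t => f t ^+ 2).
Proof.
move=> ab cf; set m := _ * itg a b f.
have ba0 : 0 < b - a by rewrite subr_gt0.
have cf2 : ctson a b (fun t => f t ^+ 2).
  exact: ctsonX2.
have c2 : ctson a b (fun t => 2 * m * f t).
  by move=> x hx; apply: cvgM; [exact: cvg_cst|exact: cf].
have : 0 <= itg a b (fun t => f t ^+ 2 - 2 * m * f t + m ^+ 2).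
  apply: Rintegral_ge0 => x _.
  have -> : f x ^+ 2 - 2 * m * f x + m ^+ 2 = (f x - m) ^+ 2 by ring.
  exact: sqr_ge0.
rewrite itgD; [|exact: ctsonB|exact: ctson_cst].
rewrite itgB// itgZ// itg_cst ?(ltW ab)//.
have -> : itg a b f = m * (b - a) by rewrite /m mulrAC mulVf ?mul1r// gt_eqF.
move=> H; rewrite mulrC ler_pdivlMr//; nra.
Qed.

Lemma sqmod_cavg g : ccts g ->
  sqmod (cavg g) <= (2 * pi)^-1 * itg 0 (2 * pi) (fun t => sqmod (g t)).
Proof.
move=> cg.
have cgr := @ccts_Re g 0 (2 * pi) cg; have cgi := @ccts_Im g 0 (2 * pi) cg.
have c2 (f : R -> R) : ctson 0 (2 * pi) f -> ctson 0 (2 * pi) (fun t => f t ^+ 2).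
  exact: ctsonX2.
under eq_fun do rewrite sqmodE.
rewrite itgD; [|exact: c2|exact: c2].
rewrite /cavg sqmodE cReM cImM Re_real Im_real !mul0r subr0 addr0 [leRHS]mulrDr.
have := sqr_itg_le pi20 cgr; have := sqr_itg_le pi20 cgi; rewrite !subr0.
by move=> h1 h2; exact: lerD.
Qed.

Lemma nc_cavg_le g e : ccts g -> (forall t, 0 <= t <= 2 * pi -> nc (g t) <= e) ->
  nc (cavg g) <= e.
Proof.
move=> cg ge.
have e0 : 0 <= e by apply: le_trans (nc_ge0 _) (ge 0 _); rewrite lexx ltW.
rewrite -(@ler_pXn2r _ 2)// ?nnegrE ?nc_ge0//.
apply: (le_trans (sqmod_cavg cg)).
rewrite ler_pdivrMl// [leRHS]mulrC.
rewrite (_ : e ^+ 2 * (2 * pi) = e ^+ 2 * (2 * pi - 0)); last by rewrite subr0.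
rewrite -itg_cst ?(ltW pi20)//; apply: le_itg.
- by move=> t _; exact: continuous_sqmod.
- exact: ctson_cst.
- by move=> t /ge; rewrite /sqmod -/(nc _) => H; rewrite lerXn2r ?nnegrE ?nc_ge0.
Qed.

End circle_average.

Section parametric.
Variable R : realType.

(** By compactness of [a, b], G x is uniformly close to G x0 on it for x near x0. *)
Lemma itg_continuous (G : R -> R -> R) (x0 a b : R) : a <= b ->
  (forall t, a <= t <= b -> {for (x0, t), continuous (fun p : R * R => G p.1 p.2)}) ->
  (\forall x \near x0, ctson a b (G x)) ->
  {for x0, continuous (fun x => itg a b (G x))}.
Proof.
move=> ab cG cx; apply/cvgrPdist_le => e e0.
pose e' := e / (b - a + 1).
have ba1 : 0 < b - a + 1 by rewrite ltr_wpDl// subr_ge0.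
have e'0 : 0 < e' by rewrite divr_gt0.
have K : \forall x \near x0, forall t, `[a, b]%classic t -> `|G x0 t - G x t| <= e'.
  have := @segment_compact R a b => /compact_near_coveringP cpt.
  apply: (cpt R (nbhs x0) (fun x t => `|G x0 t - G x t| <= e') (nbhs_filter x0)) => t.
  rewrite /= in_itv/= => /cG ct.
  have e2 : 0 < e' / 2 by rewrite divr_gt0.
  move/cvgrPdist_le : ct => /(_ _ e2); rewrite !nearE /= => -[[A B] [/= nA nB] AB].
  exists (B, A) => // -[t' x] [/= Bt' Ax].
  have h1 := AB (x, t') ltac:(by []).
  have h2 := AB (x0, t') ltac:(by split => //; exact: nbhs_singleton).
  rewrite /= in h1 h2.
  have -> : G x0 t' - G x t' = (G x0 t - G x t') - (G x0 t - G x0 t') by ring.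
  by apply: (le_trans (ler_normB _ _)); rewrite [e']splitr lerD.
have cx0 := nbhs_singleton cx.
near=> x.
have cxx : ctson a b (G x) by near: x.
rewrite -itgB//; apply: (@le_trans _ _ (e' * (b - a))).
  apply: itg_norm_le => //; first exact: ctsonB.
  by move=> t tab; apply: (near K x) => //=; rewrite in_itv.
rewrite /e' mulrAC ler_pdivrMr// ler_wpM2l ?(ltW e0)//.
by rewrite lerDl.
Unshelve. all: by end_near. Qed.

Lemma cavg_continuous (G : R -> R -> R[i]) (x0 : R) :
  (forall t, {for (x0, t), continuous (fun p : R * R => G p.1 p.2 : R[i]^o)}) ->
  (\forall x \near x0, ccts (G x)) ->
  {for x0, continuous (fun x => cavg (G x) : R[i]^o)}.
Proof.
move=> cG cx; rewrite /cavg /continuous_at.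
have pi20 : (0 : R) <= 2 * pi by rewrite mulr_ge0// pi_ge0.
apply: ccvgM; first exact: cvg_cst.
apply: cvg_complex; apply: itg_continuous => //.
- by move=> t _; exact: (cvg_Re (cG t)).
- by near=> x; apply: ccts_Re; near: x.
- by move=> t _; exact: (cvg_Im (cG t)).
- by near=> x; apply: ccts_Im; near: x.
Unshelve. all: by end_near. Qed.

Lemma circ_continuous (p : R * R) :
  {for p, continuous (fun p : R * R => circ p.1 p.2 : R[i]^o)}.
Proof.
have -> : (fun p : R * R => circ p.1 p.2 : R[i]^o) =
   (fun p => (p.1 * cos p.2) +i* (p.1 * sin p.2)).
  by apply/funext => q; rewrite circE.
have c1 : (fun q : R * R => q.1) q @[q --> p] --> p.1 by exact: cvg_fst.
have c2 : (fun q : R * R => q.2) q @[q --> p] --> p.2 by exact: cvg_snd.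
apply: cvg_complex; apply: cvgM => //; apply: continuous_comp => //.
  exact: continuous_cos.
exact: continuous_sin.
Qed.

Lemma circ_ccts (rho : R) : ccts (circ rho).
Proof.
have -> : circ rho = (fun t => (rho * cos t) +i* (rho * sin t)).
  by apply/funext => t; rewrite circE.
move=> t.
apply: cvg_complex; apply: cvgM; try exact: cvg_cst.
  exact: continuous_cos.
exact: continuous_sin.
Qed.

End parametric.

(** * Cauchy's formula and the Taylor expansion *)

Section cauchy.
Variable R : realType.
Variables (f f' : R[i] -> R[i]).
Hypothesis fd : forall z, nc z < 1 -> has_deriv f z (f' z).
Implicit Types (t rho : R) (z w : R[i]).

(** Difference quotient of f at z, extended by its limit so that it is continuous. *)
Definition difquo z w := if w == z then f' z else (f w - f z) / (w - z).

Lemma difquo_cts z w : nc z < 1 -> nc w < 1 ->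
  {for w, continuous (difquo z : R[i]^o -> R[i]^o)}.
Proof.
move=> z1 w1; have [->|wz] := eqVneq w z.
  have zz : difquo z z = f' z by rewrite /difquo eqxx.
  apply/continuous_ncP => e e0; rewrite zz.
  have e2 : 0 < e / 2 by rewrite divr_gt0.
  have [r r0 rP] := fd z1 e2.
  exists r => // x xr.
  rewrite /difquo; have [_|xz] := eqVneq x z; first by rewrite subrr nc0.
  have xz0 : 0 < nc (x - z) by rewrite nc_gt0 subr_eq0.
  rewrite -(ltr_pM2r xz0) -ncM mulrBl divfK ?subr_eq0//.
  have := rP _ xr; rewrite addrCA subrr addr0 => /le_lt_trans; apply.
  by rewrite ltr_pM2r// ltr_pdivrMr// ltr_pMr// ltr1n.
pose q x := (f x - f z) * (x - z)^-1.
have qw : {for w, continuous (q : R[i]^o -> R[i]^o)}.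
  have wz0 : w - z != 0 by rewrite subr_eq0.
  have h := has_derivM (has_derivB (fd w1) (has_deriv_cst (f z) w))
    (has_deriv_comp (has_derivB (has_deriv_id w) (has_deriv_cst z w)) (has_derivV wz0)).
  exact: has_deriv_continuous h.
have qE x : x != z -> difquo z x = q x by move=> xz; rewrite /difquo (negbTE xz).
apply/continuous_ncP => e e0; rewrite (qE _ wz).
have /continuous_ncP/(_ e e0)[r r0 rP] := qw; exists (Num.min r (nc (w - z))).
  by rewrite lt_min r0 nc_gt0 subr_eq0.
move=> x; rewrite lt_min => /andP[xr xw]; rewrite qE; first exact: rP.
by apply: contraTneq xw => ->; rewrite ncBC ltxx.
Qed.

(** The mean of this function over |w| = rho is the integral of (f w - f z) / (w - z) dw
    divided by 2 pi i: its vanishing is Cauchy's formula at z. *)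
Definition cker z w := w * difquo z w.

Lemma cker_has_deriv z w : nc z < 1 -> nc w < 1 -> w != z -> exists d, has_deriv (cker z) w d.
Proof.
move=> z1 w1 wz.
have wz0 : w - z != 0 by rewrite subr_eq0.
have h := has_derivM (has_deriv_id w) (has_derivM (has_derivB (fd w1) (has_deriv_cst (f z) w))
    (has_deriv_comp (has_derivB (has_deriv_id w) (has_deriv_cst z w)) (has_derivV wz0))).
eexists; apply: has_deriv_near h; exists (nc (w - z)); first by rewrite nc_gt0.
move=> x xw; rewrite /cker /difquo; case: eqVneq => // xz.
by move: xw; rewrite xz ncBC ltxx.
Qed.

Lemma cker_cts z w : nc z < 1 -> nc w < 1 ->
  {for w, continuous (cker z : R[i]^o -> R[i]^o)}.
Proof. by move=> z1 w1; exact: (ccvgM (@cvg_id _ (nbhs (w : R[i]^o))) (difquo_cts z1 w1)). Qed.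

Lemma circ_lt1 rho t : `|rho| < 1 -> nc (circ rho t) < 1.
Proof. by rewrite nc_circ. Qed.

Lemma cker_ccts z rho : nc z < 1 -> `|rho| < 1 -> ccts (fun t => cker z (circ rho t)).
Proof.
by move=> z1 r1; apply: (ccts_comp _ (@circ_ccts _ rho)) => t;
  apply: cker_cts => //; exact: circ_lt1.
Qed.

Lemma f_ccts rho : `|rho| < 1 -> ccts (fun t => f (circ rho t)).
Proof.
move=> r1; apply: (ccts_comp _ (@circ_ccts _ rho)) => t.
exact: has_deriv_continuous (fd (circ_lt1 t r1)).
Qed.

Definition ckavg z rho := cavg (fun t => cker z (circ rho t)).

Lemma ckavg_cts z rho : nc z < 1 -> `|rho| < 1 ->
  {for rho, continuous (ckavg z : R -> R[i]^o)}.
Proof.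
move=> z1 r1; apply: cavg_continuous => [t|].
  apply: (@continuous_comp _ _ _ (fun p : R * R => circ p.1 p.2 : R[i]^o) (cker z : R[i]^o -> R[i]^o)).
    exact: (@circ_continuous _ (rho, t)).
  by apply: cker_cts => //; exact: circ_lt1.
near=> x; apply: cker_ccts => //; near: x.
have : (fun x : R => `|x|) x @[x --> rho] --> `|rho| by apply: cvg_norm; exact: cvg_id.
by move/cvgr_lt; apply.
Unshelve. all: by end_near. Qed.

Lemma closed_const (M : R -> R[i]) (c : R) (k : R[i]) (A : set R) :
  {for c, continuous (M : R -> R[i]^o)} ->
  (forall e, 0 < e -> exists2 x, `|x - c| < e & A x) -> (forall x, A x -> M x = k) -> M c = k.
Proof.
move=> /cvg_nc Mc Ac AM; apply/eqP; rewrite -subr_eq0 -nc_eq0 eq_le nc_ge0 andbT.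
apply/ler_addgt0Pr => e e0; rewrite add0r.
have := Mc e e0 => /nbhs_ballP[r /= r0 rP].
have [x xc Ax] := Ac r r0.
have := rP x; rewrite /ball/= distrC => /(_ xc).
by rewrite (AM _ Ax) ncBC => /ltW.
Qed.

(** Differentiability may fail at w = z only, so the mean is constant for rho < |z| and for
    rho > |z| separately; continuity at rho = |z| joins the two, and continuity at 0, where
    the kernel vanishes, gives the value. *)
Lemma ckavg_eq0 z rho : nc z < 1 -> 0 < rho < 1 -> ckavg z rho = 0.
Proof.
move=> z1.
have M0 : ckavg z 0 = 0.
  rewrite /ckavg -[RHS](cavg_cst (0 : R[i])); congr cavg; apply/funext => t.
  by rewrite /cker /circ rmorph0 mul0r mul0r.
have inner rho1 : 0 < rho1 < nc z -> ckavg z rho1 = 0.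
  move=> /andP[r0 rz]; rewrite -M0; apply/esym.
  apply: (@closed_const _ _ _ [set x | 0 < x < nc z]).
  - by apply: ckavg_cts => //; rewrite normr0.
  - move=> e e0; pose d := Num.min (e / 2) (nc z / 2).
    have zp : 0 < nc z := lt_trans r0 rz.
    have d0 : 0 < d by rewrite lt_min !divr_gt0.
    have de : d <= e / 2 by rewrite ge_min lexx.
    have dz : d <= nc z / 2 by rewrite ge_min lexx orbT.
    exists d; last by apply/andP; split; lra.
    by rewrite subr0 gtr0_norm//; lra.
  - move=> x /= xz; apply: (@circle_const _ _ 0 (nc z)) => //; last by rewrite r0.
    move=> w /andP[w0 wz]; apply: cker_has_deriv => //; first exact: lt_trans z1.
    by apply: contraTneq wz => ->; rewrite ltxx.
have atz : ckavg z (nc z) = 0.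
  have [z0|z0] := eqVneq (nc z) 0; first by rewrite z0.
  have zp : 0 < nc z by rewrite lt_neqAle eq_sym z0 nc_ge0.
  apply: (@closed_const _ _ _ [set x | 0 < x < nc z]) => //.
    by apply: ckavg_cts => //; rewrite ger0_norm ?nc_ge0.
  move=> e e0; pose d := Num.min (e / 2) (nc z / 2).
  have d0 : 0 < d by rewrite lt_min !divr_gt0.
  have de : d <= e / 2 by rewrite ge_min lexx.
  have dz : d <= nc z / 2 by rewrite ge_min lexx orbT.
  exists (nc z - d); last by apply/andP; split; lra.
  by rewrite addrAC subrr add0r normrN gtr0_norm//; lra.
move=> /andP[r0 r1]; have [rz|zr|->] := ltgtP rho (nc z); last exact: atz.
  by apply: inner; rewrite r0.
rewrite -atz; apply/esym.
apply: (@closed_const _ _ _ [set x | nc z < x < 1]).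
- by apply: ckavg_cts => //; rewrite ger0_norm ?nc_ge0.
- move=> e e0; pose d := Num.min (e / 2) ((1 - nc z) / 2).
  have d0 : 0 < d by rewrite lt_min !divr_gt0// subr_gt0.
  have de : d <= e / 2 by rewrite ge_min lexx.
  have dz : d <= (1 - nc z) / 2 by rewrite ge_min lexx orbT.
  exists (nc z + d); last by apply/andP; split; lra.
  by rewrite addrAC subrr add0r gtr0_norm//; lra.
- move=> x /= xz; apply: (@circle_const _ _ (nc z) 1) => //; rewrite ?nc_ge0 ?zr//.
  move=> w /andP[w0 wz]; apply: cker_has_deriv => //.
  by apply: contraTneq w0 => ->; rewrite ltxx.
Qed.

(** Cauchy's integral for the n-th Taylor coefficient. *)
Definition tcoef rho n := cavg (fun t => f (circ rho t) * (circ rho t)^-1 ^+ n).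

Lemma has_deriv_VX n w : w != 0 -> exists d, has_deriv (fun w => w^-1 ^+ n) w d.
Proof.
move=> w0; elim: n => [|n [d IH]]; first by exists 0; exact: has_deriv_cst.
eexists; apply: has_deriv_near (has_derivM (has_derivV w0) IH).
by exists 1 => // x _; rewrite exprS.
Qed.

Lemma circ_neq0 rho t : 0 < rho -> circ rho t != 0.
Proof. by move=> r0; rewrite -nc_gt0 nc_circ normr_gt0 gt_eqF. Qed.

Lemma circV_ccts rho n : 0 < rho -> ccts (fun t => (circ rho t)^-1 ^+ n).
Proof.
by move=> r0; apply/ccts_exp/ccts_inv; [move=> t; exact: circ_neq0|exact: circ_ccts].
Qed.

(** By homogeneity the mean of w^-n over |w| = rho is rho^-n times that over |w| = 1, while
    the two are equal; as rho^-n is not 1, both vanish. *)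
Lemma cavg_circV rho n : 0 < rho < 1 -> (0 < n)%N ->
  cavg (fun t => (circ rho t)^-1 ^+ n) = 0.
Proof.
move=> /andP[r0 r1] n0.
pose c := cavg (fun t => (circ 1 t)^-1 ^+ n).
have E r : 0 < r -> cavg (fun t => (circ r t)^-1 ^+ n) = (r%:C)^-1 ^+ n * c.
  move=> rr0; rewrite /c -cavgZ; last exact: circV_ccts.
  congr cavg; apply/funext => t; rewrite -exprMn -invfM.
  by rewrite /circ [1%:C * _]mul1r.
have D w : 0 < nc w < 2 -> exists d, has_deriv (fun w => w^-1 ^+ n) w d.
  move=> /andP[w0 _]; have wV : w != 0 by rewrite -nc_gt0.
  exact: has_deriv_VX.
have h1 : 0 < rho < 2 by apply/andP; split; lra.
have h2 : is_true ((0 < (1 : R)) && ((1 : R) < 2)).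
  by rewrite ltr01 ltr1n.
have := @circle_const _ _ 0 2 rho 1 (lexx _) D h1 h2.
rewrite -/c E// => H.
have : (rho%:C^-1 ^+ n - 1) * c = 0 by rewrite mulrBl mul1r H subrr.
move/eqP; rewrite mulf_eq0 => /orP[|/eqP -> //]; last by rewrite mulr0.
rewrite subr_eq0 => /eqP X.
have : nc (rho%:C^-1 ^+ n) = 1 by rewrite X nc1.
rewrite ncX ncV nc_real gtr0_norm// => /eqP.
have rn1 : rho ^+ n < 1 by rewrite exprn_ilt1 ?(ltW r0)// -lt0n.
by rewrite [rho^-1 ^+ n]exprVn invr_eq1 (lt_eqF rn1).
Qed.

Lemma tcoef_indep r1 r2 n : 0 < r1 < 1 -> 0 < r2 < 1 -> tcoef r1 n = tcoef r2 n.
Proof.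
move=> h1 h2; apply: (@circle_const _ (fun w => f w * w^-1 ^+ n) 0 1) => //.
move=> w /andP[w0 w1]; have wV : w != 0 by rewrite -nc_gt0.
have [d dP] := has_deriv_VX n wV.
by eexists; exact: (has_derivM (fd w1) dP).
Qed.

Lemma bounded_circle (g : R -> R[i]) : ccts g ->
  exists K, forall t, 0 <= t <= 2 * pi -> nc (g t) <= K.
Proof.
move=> cg.
have pi20 : (0 : R) <= 2 * pi by rewrite mulr_ge0// pi_ge0.
have cn : {within `[0, 2 * pi], continuous (fun t => nc (g t))}.
  by apply: ctson_within => t _; exact: (cvg_ncf (cg t)).
have [c _ cP] := EVT_max pi20 cn.
by exists (nc (g c)) => t ht; apply: cP; rewrite in_itv.
Qed.

(** Split the kernel w (f w - f z) / (w - z) into N terms of the geometric series in z / w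
    and a remainder, (z / w)^N times the kernel itself. Its mean is zero, the terms have
    means [tcoef] z^n (up to f z for n = 0), and the remainder is bounded by
    (|z| / rho)^N. *)
Lemma taylor_remainder z rho : nc z < rho -> 0 < rho < 1 -> exists K, forall N, (0 < N)%N ->
  nc (f z - \sum_(n < N) tcoef rho n * z ^+ n) <= K * (nc z / rho) ^+ N.
Proof.
move=> zr /andP[r0 r1].
have z1 : nc z < 1 := lt_trans zr r1.
have ar1 : `|rho| < 1 by rewrite gtr0_norm.
have kc := cker_ccts z1 ar1.
have [K KP] := bounded_circle kc.
exists K => N N0.
pose u n t := z ^+ n * ((f (circ rho t) - f z) * (circ rho t)^-1 ^+ n).
pose v t := z ^+ N * (cker z (circ rho t) * (circ rho t)^-1 ^+ N).
have cf0 : ccts (fun t => f (circ rho t) - f z) := cctsB (f_ccts ar1) (@ccts_cst _ (f z)).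
have cu n : ccts (fun t => (f (circ rho t) - f z) * (circ rho t)^-1 ^+ n).
  exact: (cctsM cf0 (@circV_ccts _ n r0)).
have cv : ccts (fun t => cker z (circ rho t) * (circ rho t)^-1 ^+ N).
  exact: (cctsM kc (@circV_ccts _ N r0)).
have cu' n : ccts (u n) by exact: (cctsM (@ccts_cst _ (z ^+ n)) (cu n)).
have cv' : ccts v by exact: (cctsM (@ccts_cst _ (z ^+ N)) cv).
have E : (fun t => cker z (circ rho t)) = (fun t => \sum_(n < N) u n t + v t).
  apply/funext => t; set w := circ rho t.
  have w0 : w != 0 by exact: circ_neq0.
  have wz : w != z.
    by apply: contraTneq zr => <-; rewrite /w nc_circ gtr0_norm// ltxx.
  have kE : cker z w = w * ((f w - f z) / (w - z)) by rewrite /cker /difquo (negbTE wz).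
  rewrite /u /v -/w kE.
  have -> : \sum_(n < N) z ^+ n * ((f w - f z) * w^-1 ^+ n) =
     (f w - f z) * \sum_(n < N) (z / w) ^+ n.
    by rewrite big_distrr/=; apply: eq_bigr => n _; rewrite exprMn; ring.
  have G : (1 - z / w) * (\sum_(n < N) (z / w) ^+ n) = 1 - (z / w) ^+ N.
    by rewrite -opprB mulNr -subrX1 opprB.
  have zw1 : 1 - z / w = (w - z) / w by field.
  have wz0 : w - z != 0 by rewrite subr_eq0.
  have -> : \sum_(n < N) (z / w) ^+ n = w / (w - z) * (1 - (z / w) ^+ N).
    by rewrite -G zw1; field; rewrite w0 wz0.
  by rewrite exprMn; ring.
have := @ckavg_eq0 z rho z1; rewrite r0 r1 => /(_ isT).
rewrite /ckavg E cavgD; [|exact: (@ccts_sum _ N u cu')|exact: cv'].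
rewrite (cavg_sum _ cu') => /eqP; rewrite addr_eq0 => /eqP H.
have S : \sum_(n < N) cavg (u n) = \sum_(n < N) tcoef rho n * z ^+ n - f z.
  have uE n : cavg (u n) = tcoef rho n * z ^+ n - (if n == 0%N then f z else 0).
    rewrite /u cavgZ; last exact: cu.
    have -> : (fun t => (f (circ rho t) - f z) * (circ rho t)^-1 ^+ n) =
       (fun t => f (circ rho t) * (circ rho t)^-1 ^+ n - f z * (circ rho t)^-1 ^+ n).
      by apply/funext => t; rewrite mulrBl.
    have c1 := cctsM (f_ccts ar1) (@circV_ccts _ n r0).
    have c2 := cctsM (@ccts_cst _ (- f z)) (@circV_ccts _ n r0).
    have -> : (fun t => f (circ rho t) * (circ rho t)^-1 ^+ n - f z * (circ rho t)^-1 ^+ n) =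
       (fun t => f (circ rho t) * (circ rho t)^-1 ^+ n + - f z * (circ rho t)^-1 ^+ n).
      by apply/funext => t; rewrite mulNr.
    rewrite cavgD; [|exact: c1|exact: c2].
    rewrite cavgZ; last exact: circV_ccts.
    rewrite -/(tcoef rho n) mulrDr mulrC; congr (_ + _).
    case: n {c1 c2} => [|n] /=.
      rewrite expr0 mul1r; under eq_fun do rewrite expr0.
      by rewrite cavg_cst mulr1.
    by rewrite cavg_circV ?r0// !mulr0 oppr0.
  under eq_bigr do rewrite uE.
  rewrite sumrB; congr (_ - _); case: N N0 {v cv cv' E H} => // N _.
  by rewrite big_ord_recl /= big1 ?addr0.
rewrite S in H; rewrite -opprB H opprK /v cavgZ; last exact: cv.
rewrite ncM ncX.
rewrite [(_ / _) ^+ N]exprMn mulrCA ler_wpM2l ?exprn_ge0 ?nc_ge0//.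
apply: (nc_cavg_le cv) => t ht.
rewrite ncM ncX ncV nc_circ gtr0_norm// ler_wpM2r ?KP//.
by rewrite exprn_ge0// invr_ge0 ltW.
Qed.

(** Cauchy-Schwarz for the mean that defines the coefficient: one term of Parseval's identity. *)
Lemma tcoef_bound rho n : 0 < rho < 1 -> sqmod (tcoef rho n) * rho ^+ n.*2 <=
  (2 * pi)^-1 * itg 0 (2 * pi) (fun t => sqmod (f (circ rho t))).
Proof.
move=> /andP[r0 r1].
have ar1 : `|rho| < 1 by rewrite gtr0_norm.
have cc := cctsM (f_ccts ar1) (@circV_ccts _ n r0).
have rn0 : 0 < rho ^+ n.*2 by rewrite exprn_gt0.
rewrite -ler_pdivlMr//; apply: (le_trans (sqmod_cavg cc)).
rewrite le_eqVlt; apply/orP; left; apply/eqP; rewrite -mulrA; congr (_ * _).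
rewrite [RHS]mulrC -itgZ; last first.
  by move=> t _; apply: continuous_sqmod; exact: f_ccts.
congr itg; apply/funext => t; rewrite /sqmod -!/(nc _) ncM ncX ncV nc_circ gtr0_norm//.
by rewrite exprMn mulrC -exprM muln2 exprVn.
Qed.

End cauchy.

(** * Power series *)

Section csum.
Variable R : realType.
Implicit Types (u v : nat -> R[i]) (K q : R).

(** The sum is taken separately on real and imaginary parts, where the theory of real series
    applies. *)
Definition csum u : R[i] :=
  limn (fun N => \sum_(n < N) complex.Re (u n)) +i*
  limn (fun N => \sum_(n < N) complex.Im (u n)).

Lemma Re_sum u N : complex.Re (\sum_(n < N) u n) = \sum_(n < N) complex.Re (u n).
Proof. by elim: N => [|N IH]; rewrite ?big_ord0// !big_ord_recr/= cReD IH. Qed.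

Lemma Im_sum u N : complex.Im (\sum_(n < N) u n) = \sum_(n < N) complex.Im (u n).
Proof. by elim: N => [|N IH]; rewrite ?big_ord0// !big_ord_recr/= cImD IH. Qed.

Definition csum_to u (l : R[i]) := (\sum_(n < N) u n : R[i]^o) @[N --> \oo] --> (l : R[i]^o).

Lemma csum_to_eq u l : csum_to u l -> csum u = l.
Proof.
move=> /cvg_ReIm[]; under eq_fun do rewrite Re_sum; move=> h1.
under eq_fun do rewrite Im_sum; move=> h2.
rewrite /csum; case: l h1 h2 => a b /= h1 h2.
by congr (_ +i* _); exact/cvg_lim.
Qed.

Lemma real_geo_cvg (x : nat -> R) K q : 0 <= q < 1 -> (forall n, `|x n| <= K * q ^+ n) ->
  cvg ((\sum_(n < N) x n) @[N --> \oo]).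
Proof.
move=> /andP[q0 q1] xK.
rewrite (_ : (fun N => _) = series x); last first.
  by apply/funext => N; rewrite /series/= big_mkord.
apply: normed_cvg; apply: (@series_le_cvg _ _ (geometric K q)).
- by move=> n /=.
- by move=> n; rewrite /geometric/=; apply: le_trans (xK n).
- by move=> n; exact: xK.
- by apply: is_cvg_geometric_series; rewrite ger0_norm.
Qed.

Definition geo_dom u K q := forall n, nc (u n) <= K * q ^+ n.

Lemma csum_cvg u K q : 0 <= q < 1 -> geo_dom u K q -> csum_to u (csum u).
Proof.
move=> q01 uK; apply/cvg_ReIm; split => /=.
  under eq_fun do rewrite Re_sum.
  apply: (@real_geo_cvg (fun n => complex.Re (u n)) K q q01) => n.
  exact: le_trans (ler_Re _) (uK n).
under eq_fun do rewrite Im_sum.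
apply: (@real_geo_cvg (fun n => complex.Im (u n)) K q q01) => n.
exact: le_trans (ler_Im _) (uK n).
Qed.

Lemma geo_sum_le K q N : 0 <= K -> 0 <= q < 1 ->
  \sum_(n < N) K * q ^+ n <= K / (1 - q).
Proof.
move=> K0 /andP[q0 q1]; rewrite -big_distrr/= ler_wpM2l//.
have q10 : 0 < 1 - q by rewrite subr_gt0.
rewrite -[leRHS]mul1r ler_pdivlMr// mulrC -opprB mulNr -subrX1 opprB.
by rewrite gerBl exprn_ge0.
Qed.

Lemma csum_to_norm u l B : csum_to u l -> (forall N, nc (\sum_(n < N) u n) <= B) -> nc l <= B.
Proof.
move=> /cvg_ncf ul uB.
rewrite -(cvg_lim _ ul)//; apply: limr_le; first by apply/cvg_ex; exists (nc l).
by near=> N; exact: uB.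
Unshelve. all: by end_near. Qed.

Lemma csum_norm u K q : 0 <= q < 1 -> geo_dom u K q -> nc (csum u) <= K / (1 - q).
Proof.
move=> q01 uK; apply: (csum_to_norm (csum_cvg q01 uK)) => N.
apply: (le_trans (nc_sum _ _)); apply: (@le_trans _ _ (\sum_(n < N) K * q ^+ n)).
  by apply: ler_sum => n _; exact: uK.
apply: geo_sum_le => //.
by have := uK 0%N; rewrite expr0 mulr1; apply: le_trans; exact: nc_ge0.
Qed.

Lemma csum_toZ u l z : csum_to u l -> csum_to (fun n => u n * z) (l * z).
Proof.
move=> ul; rewrite /csum_to; under eq_fun do rewrite -big_distrl/=.
by apply: (ccvgM ul); exact: cvg_cst.
Qed.

Lemma csum_toB u v l m : csum_to u l -> csum_to v m -> csum_to (fun n => u n - v n) (l - m).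
Proof.
move=> ul vm; rewrite /csum_to; under eq_fun do rewrite sumrB/=.
exact: (ccvgB ul vm).
Qed.

End csum.

Section power_series.
Variable R : realType.
Implicit Types (a b : nat -> R[i]) (K q r s : R) (z w h : R[i]).

Definition pser a z := csum (fun n => a n * z ^+ n).

Definition dcoef a n := n.+1%:R * a n.+1.

(** Cauchy estimates at radius r. For fixed r the least K is a norm on coefficient sequences
    which controls the series on every smaller disk. *)
Definition coef_bound a r K := forall n, nc (a n) * r ^+ n <= K.

Lemma coef_bound_ge0 a r K : coef_bound a r K -> 0 <= K.
Proof. by move=> /(_ 0%N); rewrite expr0 mulr1; apply: le_trans; exact: nc_ge0. Qed.

Lemma coef_geo_dom a r K s z : 0 < r -> nc z <= s -> coef_bound a r K ->
  geo_dom (fun n => a n * z ^+ n) K (s / r).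
Proof.
move=> r0 zs aK n; rewrite ncM ncX exprMn exprVn.
rewrite mulrA ler_pdivlMr ?exprn_gt0// mulrAC.
apply: ler_pM => //; rewrite ?mulr_ge0 ?nc_ge0 ?exprn_ge0 ?nc_ge0 ?(ltW r0)//.
by rewrite lerXn2r ?nnegrE ?nc_ge0// (le_trans (nc_ge0 z)).
Qed.

Lemma ratio01 s r : 0 <= s -> s < r -> 0 <= s / r < 1.
Proof.
move=> s0 sr; have r0 := le_lt_trans s0 sr.
by rewrite divr_ge0 ?(ltW r0)//= ltr_pdivrMr// mul1r.
Qed.

Lemma pser_cvg a r K z : nc z < r -> coef_bound a r K ->
  csum_to (fun n => a n * z ^+ n) (pser a z).
Proof.
move=> zr aK; have r0 : 0 < r := le_lt_trans (nc_ge0 z) zr.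
exact: csum_cvg (ratio01 (nc_ge0 z) zr) (coef_geo_dom r0 (lexx _) aK).
Qed.

Lemma pser_norm a r K s z : s < r -> nc z <= s -> coef_bound a r K ->
  nc (pser a z) <= K / (1 - s / r).
Proof.
move=> sr zs aK; have s0 : 0 <= s := le_trans (nc_ge0 z) zs.
have r0 : 0 < r := le_lt_trans s0 sr.
exact: csum_norm (ratio01 s0 sr) (coef_geo_dom r0 zs aK).
Qed.

(** By induction, s^n (s + n (r - s)) <= s r^n, a form of Bernoulli's inequality for r / s.
    It absorbs a factor n at the price of a slightly smaller radius. *)
Lemma natr_exprn_le s r n : 0 < s -> s < r -> n%:R * s ^+ n <= s / (r - s) * r ^+ n.
Proof.
move=> s0 sr; have rs0 : 0 < r - s by rewrite subr_gt0.
have B : s ^+ n * (s + n%:R * (r - s)) <= s * r ^+ n.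
  elim: n => [|n IH]; first by rewrite !expr0 mul0r addr0 mul1r mulr1.
  have := ler_wpM2l (ltW (lt_trans s0 sr)) IH.
  rewrite !exprS -natr1 => h.
  have -> : s * (r * r ^+ n) = r * (s * r ^+ n) by ring.
  apply: le_trans h; rewrite -subr_ge0.
  have -> : r * (s ^+ n * (s + n%:R * (r - s))) - s * s ^+ n * (s + (n%:R + 1) * (r - s)) =
    s ^+ n * (n%:R * (r - s) ^+ 2) by ring.
  by rewrite !mulr_ge0 ?exprn_ge0 ?sqr_ge0// ltW.
rewrite mulrAC ler_pdivlMr//; apply: le_trans B.
rewrite -subr_ge0 [X in 0 <= X](_ : _ = s ^+ n * s); last by ring.
by rewrite mulr_ge0 ?exprn_ge0 ?ltW.
Qed.

Lemma coef_bound_natr a r K s : 0 < s -> s < r -> coef_bound a r K ->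
  coef_bound (fun n => n%:R * a n) s (s / (r - s) * K).
Proof.
move=> s0 sr aK n; rewrite ncM nc_natr mulrAC mulrC.
apply: (@le_trans _ _ (nc (a n) * (s / (r - s) * r ^+ n))).
  by rewrite ler_wpM2l ?nc_ge0// natr_exprn_le.
rewrite mulrCA; apply: ler_wpM2l; last exact: aK.
by rewrite divr_ge0 ?subr_ge0 ?ltW.
Qed.

Lemma coef_bound_dcoef a r K s : 0 < s -> s < r -> coef_bound a r K ->
  coef_bound (dcoef a) s ((r - s)^-1 * K).
Proof.
move=> s0 sr aK n; have := coef_bound_natr s0 sr aK n.+1.
rewrite exprS mulrCA -mulrA ler_pM2l ?mulrA//.
Qed.

(** Induction on n: passing to n + 1 multiplies the remainder by z + h and adds n z^(n-1) h^2.
    The factor s^2 on the left stands for division by s^2, since s may be 0. *)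
Lemma pow_taylor z h s n : nc z <= s -> nc (z + h) <= s ->
  nc ((z + h) ^+ n - z ^+ n - n%:R * z ^+ n.-1 * h) * s ^+ 2 <=
  n%:R ^+ 2 * s ^+ n * nc h ^+ 2.
Proof.
move=> zs zhs; have s0 : 0 <= s := le_trans (nc_ge0 z) zs.
elim: n => [|n IH].
  by rewrite !expr0 subrr mul0r mul0r subr0 nc0 mul0r expr2 !mul0r.
have -> : (z + h) ^+ n.+1 - z ^+ n.+1 - n.+1%:R * z ^+ n.+1.-1 * h =
    (z + h) * ((z + h) ^+ n - z ^+ n - n%:R * z ^+ n.-1 * h) + n%:R * z ^+ n.-1 * h ^+ 2.
  rewrite -natr1; case: n {IH} => [|n]; first by rewrite !expr0 !expr1; ring.
  by rewrite /= !exprS -natr1; ring.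
set D := _ - _ - _ in IH *.
apply: (@le_trans _ _ ((s * nc D + n%:R * s ^+ n.-1 * nc h ^+ 2) * s ^+ 2)).
  rewrite ler_wpM2r ?sqr_ge0//; apply: (le_trans (ncD _ _));
  rewrite [nc (n%:R * _ * _)]ncM [nc (n%:R * _)]ncM nc_natr !ncX [nc ((z + h) * _)]ncM.
  apply: lerD; first by rewrite ler_wpM2r ?nc_ge0.
  rewrite ler_wpM2r ?exprn_ge0 ?nc_ge0// ler_wpM2l//.
  by rewrite lerXn2r ?nnegrE ?nc_ge0.
have E : n%:R * s ^+ n.-1 * s ^+ 2 = n%:R * s ^+ n.+1.
  by case: n {IH D} => [|n]; rewrite ?mul0r// -mulrA -exprD addn2.
have := ler_wpM2l s0 IH.
have -> : (s * nc D + n%:R * s ^+ n.-1 * nc h ^+ 2) * s ^+ 2 =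
  s * (nc D * s ^+ 2) + n%:R * s ^+ n.-1 * s ^+ 2 * nc h ^+ 2 by ring.
rewrite E (exprS s n) => H.
have p0 : 0 <= s * s ^+ n * nc h ^+ 2 by rewrite !mulr_ge0 ?exprn_ge0 ?nc_ge0.
apply: (le_trans (lerD H (lexx _))); rewrite -natr1 -subr_ge0.
rewrite [X in 0 <= X](_ : _ = (n%:R + 1) * (s * s ^+ n * nc h ^+ 2)); last by ring.
by rewrite mulr_ge0// addr_ge0.
Qed.

(** Termwise, the remainder has size n^2 |a_n| s0^n |h|^2 / s0^2. Each factor n costs a
    slightly smaller radius (r to s2, then s2 to s1), all of them larger than |z|, and what is
    left is a geometric series of ratio s0 / s1 times |h|^2. *)
Lemma pser_has_deriv a r K z : nc z < r -> coef_bound a r K ->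
  has_deriv (pser a) z (pser (dcoef a) z).
Proof.
move=> zr aK e e0.
have K0 := coef_bound_ge0 aK.
have r0 : 0 < r := le_lt_trans (nc_ge0 z) zr.
pose s1 := (2 * nc z + r) / 3; pose s2 := (nc z + 2 * r) / 3.
pose s0 := (5 * nc z + r) / 6.
have nz := nc_ge0 z.
have s00 : 0 < s0 by rewrite /s0; lra.
have zs0 : nc z < s0 by rewrite /s0; lra.
have s01 : s0 < s1 by rewrite /s0 /s1; lra.
have s12 : s1 < s2 by rewrite /s1 /s2; lra.
have s2r : s2 < r by rewrite /s2; lra.
clearbody s0 s1 s2.
have s1p : 0 < s1 := lt_trans s00 s01.
have s2p : 0 < s2 := lt_trans s1p s12.
have b1 := coef_bound_natr s2p s2r aK.
have b2 := coef_bound_natr s1p s12 b1.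
set K2 := s1 / _ * _ in b2.
have K20 := coef_bound_ge0 b2.
pose Q := 1 - s0 / s1.
have Q0 : 0 < Q by rewrite subr_gt0 ltr_pdivrMr// mul1r.
pose C := K2 / s0 ^+ 2 / Q + 1.
have C0 : 0 < C by rewrite ltr_wpDl// !divr_ge0 ?exprn_ge0 ?(ltW s00) ?(ltW Q0).
exists (Num.min (s0 - nc z) (e / C)); first by rewrite lt_min subr_gt0 zs0 divr_gt0.
move=> h; rewrite lt_min => /andP[h1 h2].
have zhs : nc (z + h) <= s0 by have := ncD z h; lra.
have zhr : nc (z + h) < r by lra.
have c1 := pser_cvg zhr aK; have c2 := pser_cvg zr aK.
have b3 := coef_bound_dcoef s2p s2r aK.
have c3 : csum_to (fun n => n%:R * a n * z ^+ n.-1) (pser (dcoef a) z).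
  have cd := pser_cvg (ltac:(lra) : nc z < s2) b3.
  rewrite /csum_to -(cvg_shiftS (fun N => \sum_(n < N) (n%:R * a n * z ^+ n.-1) : R[i]^o)).
  under eq_fun do rewrite big_ord_recl mul0r mul0r add0r.
  exact: cd.
have := csum_toB (csum_toB c1 c2) (csum_toZ (z:=h) c3).
set u := (fun n => _) => cu.
have uD : geo_dom u (K2 / s0 ^+ 2 * nc h ^+ 2) (s0 / s1).
  move=> n; rewrite /u.
  have -> : a n * (z + h) ^+ n - a n * z ^+ n - n%:R * a n * z ^+ n.-1 * h =
     a n * ((z + h) ^+ n - z ^+ n - n%:R * z ^+ n.-1 * h) by ring.
  have T := pow_taylor n (ltW zs0) zhs.
  have B := b2 n; rewrite !ncM !nc_natr in B.
  have s02 : 0 < s0 ^+ 2 by rewrite exprn_gt0.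
  have s1n : 0 < s1 ^+ n by rewrite exprn_gt0.
  rewrite ncM [(s0 / s1) ^+ n]exprMn exprVn.
  rewrite [leRHS](_ : _ = K2 * nc h ^+ 2 * s0 ^+ n / s1 ^+ n / s0 ^+ 2); last first.
    by field; rewrite ?gt_eqF.
  rewrite ler_pdivlMr// ler_pdivlMr//.
  have := ler_wpM2l (nc_ge0 (a n)) T.
  move/(ler_wpM2r (ltW s1n)) => {}T.
  have := ler_wpM2r (ltac:(by rewrite mulr_ge0 ?exprn_ge0 ?nc_ge0 ?(ltW s00)) : 0 <= s0 ^+ n * nc h ^+ 2) B.
  move: T; set Y := nc (a n); set X := nc (_ - _ - _); set Z := nc h ^+ 2.
  set W := s1 ^+ n; set V := s0 ^+ n; set U := s0 ^+ 2; set N : R := n%:R.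
  move=> T B'.
  have -> : Y * X * U * W = Y * (X * U) * W by ring.
  apply: (le_trans T).
  have -> : Y * (N ^+ 2 * V * Z) * W = N * (N * Y) * W * (V * Z) by ring.
  apply: (le_trans B').
  by rewrite le_eqVlt; apply/orP; left; apply/eqP; ring.
have := csum_norm (ratio01 (ltW s00) s01) uD; rewrite (csum_to_eq cu) => H.
apply: (le_trans H); rewrite -/Q.
have -> : K2 / s0 ^+ 2 * nc h ^+ 2 / Q = (K2 / s0 ^+ 2 / Q) * nc h * nc h by ring.
rewrite ler_wpM2r ?nc_ge0//.
have := h2; rewrite ltr_pdivlMr// /C => hC.
have := nc_ge0 h; lra.
Qed.

End power_series.

(** * Taylor series of holomorphic functions *)

Section taylor.
Variable R : realType.
Variable f : R[i] -> R[i].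
Hypothesis fh : holomorphic_on_disk f.

Lemma hol_has_deriv z : nc z < 1 -> has_deriv f z (cderiv f z).
Proof. by move=> /disk_nc/fh/derivable_has_deriv. Qed.

(** The radius 1/2 is an arbitrary choice in ]0, 1[, see [tay_tcoef]. *)
Definition tay := tcoef f 2^-1.

Let half01 : 0 < (2^-1 : R) < 1.
Proof. by rewrite invr_gt0 ltr0n/= invf_lt1 ?ltr1n. Qed.

Lemma tay_tcoef r n : 0 < r < 1 -> tcoef f r n = tay n.
Proof. by move=> r01; exact: (tcoef_indep hol_has_deriv n r01 half01). Qed.

Lemma tay_sqmod r n : 0 < r < 1 -> sqmod (tay n) * r ^+ n.*2 <=
  (2 * pi)^-1 * itg 0 (2 * pi) (fun t => sqmod (f (circ r t))).
Proof. by move=> r01; rewrite -(tay_tcoef n r01); exact: (tcoef_bound hol_has_deriv). Qed.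

Lemma tay_coef_bound r : 0 < r < 1 -> exists K, coef_bound tay r K.
Proof.
move=> r01; set B := (2 * pi)^-1 * itg 0 (2 * pi) (fun t => sqmod (f (circ r t))).
(* B bounds the square of the quantity, which is at most its square once above 1 *)
exists (Num.max 1 B) => n; have := tay_sqmod n r01; rewrite -/B.
rewrite /sqmod -/(nc _) -muln2 exprM -exprMn le_max.
have [h _|h] := leP (nc (tay n) * r ^+ n) 1; first by apply/orP; left.
move=> H; apply/orP; right; apply: le_trans H; rewrite expr2.
by apply: ler_peMr; [exact: ltW (lt_trans ltr01 h)|exact: ltW].
Qed.

Lemma taylor z : nc z < 1 -> f z = pser tay z.
Proof.
move=> z1; pose rho := (nc z + 1) / 2.
have nz := nc_ge0 z.
have zr : nc z < rho by rewrite /rho; lra.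
have r01 : 0 < rho < 1 by apply/andP; rewrite /rho; split; lra.
have [K KP] := taylor_remainder hol_has_deriv zr r01.
apply/esym/csum_to_eq/cvg_nc => e e0.
have q01 := ratio01 nz zr.
have : (fun N => K * (nc z / rho) ^+ N) N @[N --> \oo] --> 0.
  by apply: cvg_geometric; case/andP: q01 => q0 q1; rewrite ger0_norm.
move/cvgrPdist_lt => /(_ e e0) H; near=> N.
rewrite ncBC; apply: (@le_lt_trans _ _ (K * (nc z / rho) ^+ N)).
  have -> : \sum_(n < N) tay n * z ^+ n = \sum_(n < N) tcoef f rho n * z ^+ n.
    by apply: eq_bigr => n _; rewrite (tay_tcoef n r01).
  by apply: KP; near: N; exact: nbhs_infty_gt.
apply: (le_lt_trans (ler_norm _)); rewrite -normrN -sub0r.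
by near: N.
Unshelve. all: by end_near. Qed.

Lemma taylor_deriv z : nc z < 1 -> cderiv f z = pser (dcoef tay) z.
Proof.
move=> z1; pose r := (nc z + 1) / 2.
have nz := nc_ge0 z.
have zr : nc z < r by rewrite /r; lra.
have r01 : 0 < r < 1 by apply/andP; rewrite /r; split; lra.
have [K KP] := tay_coef_bound r01.
have h : has_deriv f z (pser (dcoef tay) z).
  apply: has_deriv_near (pser_has_deriv zr KP); exists (1 - nc z); first by rewrite subr_gt0.
  move=> w wz; rewrite -taylor//.
  by have := ncD (w - z) z; rewrite subrK; lra.
by have [] := has_deriv_derivable h.
Qed.

(** A derivative is again a power series, hence itself differentiable. *)
Lemma deriv_has_deriv z : nc z < 1 -> exists d, has_deriv (cderiv f) z d.
Proof.
move=> z1; pose r := (nc z + 1) / 2; pose s := (nc z + r) / 2.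
have nz := nc_ge0 z.
have zr : nc z < r by rewrite /r; lra.
have r01 : 0 < r < 1 by apply/andP; rewrite /r; split; lra.
have s0 : 0 < s by rewrite /s; lra.
have sr : s < r by rewrite /s; lra.
have zs : nc z < s by rewrite /s; lra.
have [K KP] := tay_coef_bound r01.
have := pser_has_deriv zs (coef_bound_dcoef s0 sr KP) => h; eexists.
apply: has_deriv_near h; exists (1 - nc z); first by rewrite subr_gt0.
move=> w wz; rewrite taylor_deriv//.
by have := ncD (w - z) z; rewrite subrK; lra.
Qed.

End taylor.

(** * Measures with density and measurability on the disk *)

Section density.
Context d (T : measurableType d) (R : realType).
Variables (mu nu : {measure set T -> \bar R}) (D : set T) (w : T -> R).
Hypotheses (mD : measurable D) (mw : measurable_fun D (EFin \o w)).
Hypothesis w0 : forall x, D x -> 0 <= w x.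
Hypothesis nuE : forall A, measurable A -> A `<=` D ->
  nu A = (\int[mu]_(x in A) (w x)%:E)%E.

Import HBNNSimple.

Let integral_density_simple (h : {nnsfun T >-> R}) :
  (\int[nu]_(x in D) (h x)%:E = \int[mu]_(x in D) ((h x)%:E * (w x)%:E))%E.
Proof.
have m1 r : measurable (h @^-1` [set r]) by exact: measurable_sfunP.
have ind r : (\int[nu]_(x in D) (\1_(h @^-1` [set r]) x)%:E =
    \int[mu]_(x in D) ((\1_(h @^-1` [set r]) x)%:E * (w x)%:E))%E.
  rewrite integral_indic// nuE//; [|exact: measurableI].
  rewrite setIC integral_mkcondr; apply: eq_integral => x _.
  by rewrite epatch_indic muleC.
transitivity (\sum_(r \in range h) (\int[nu]_(x in D) (r * \1_(h @^-1` [set r]) x)%:E))%E.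
  under eq_integral do rewrite fimfunE -fsumEFin//.
  rewrite ge0_integral_fsum//.
    by move=> r; exact/measurable_EFinP/measurable_funM.
  by move=> r x _; rewrite nnfun_muleindic_ge0.
transitivity (\sum_(r \in range h)
    (\int[mu]_(x in D) ((r * \1_(h @^-1` [set r]) x)%:E * (w x)%:E)))%E; last first.
  rewrite -ge0_integral_fsum//.
  - apply: eq_integral => x xD; rewrite -ge0_mule_fsuml => [|r].
      by rewrite fsumEFin// -fimfunE.
    exact: nnfun_muleindic_ge0.
  - move=> r; apply: emeasurable_funM => //.
    by apply/measurable_EFinP; exact: measurable_funM.
  - by move=> r x Dx; rewrite mule_ge0 ?nnfun_muleindic_ge0// lee_fin w0.
apply: eq_fsbigr => r /set_mem [x _ <-].
rewrite integralZl_indic_nnsfun// ind -ge0_integralZl//.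
- by apply: eq_integral => y _; rewrite EFinM muleA.
- by apply: emeasurable_funM => //; apply/measurable_EFinP.
- by move=> y Dy; rewrite mule_ge0 ?lee_fin ?w0.
- by rewrite lee_fin; exact: fun_ge0.
Qed.

(** The hypothesis is the case of indicators of measurable subsets of D; simple functions
    follow by linearity and the rest by monotone convergence. *)
Lemma ge0_integral_density (f : T -> \bar R) : measurable_fun D f ->
  (forall x, D x -> (0 <= f x)%E) ->
  (\int[nu]_(x in D) f x = \int[mu]_(x in D) (f x * (w x)%:E))%E.
Proof.
move=> mf f0; pose f_ := nnsfun_approx mD mf.
have fcvg x : D x -> (f_ n x)%:E @[n --> \oo] --> f x.
  by move=> Dx; exact: cvg_nnsfun_approx.
transitivity (limn (fun n => \int[nu]_(x in D) (f_ n x)%:E))%E.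
  rewrite -monotone_convergence//.
  - by apply: eq_integral => x /[!inE] xD; apply/esym/cvg_lim => //; exact: fcvg.
  - by move=> n; exact/measurable_EFinP/measurable_funP.
  - by move=> n x _; rewrite lee_fin.
  - by move=> x _ m n mn; rewrite lee_fin; exact/lefP/nd_nnsfun_approx.
under eq_fun do rewrite integral_density_simple.
rewrite -monotone_convergence//.
- apply: eq_integral => x /[!inE] xD; apply/cvg_lim => //.
  by apply: cvgeZr => //; exact: fcvg.
- by move=> n; apply: emeasurable_funM => //; exact/measurable_EFinP/measurable_funP.
- by move=> n x Dx; rewrite mule_ge0 ?lee_fin ?w0.
- move=> x Dx m n mn; rewrite lee_wpmul2r ?lee_fin ?w0//; exact/lefP/nd_nnsfun_approx.
Qed.

End density.

Section plane_measurability.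
Variable R : realType.
Notation plane := (measurableTypeR R * measurableTypeR R)%type.
Implicit Types (D : set plane) (g h : plane -> R[i]).

Definition cmeas D g := measurable_fun D (fun p => complex.Re (g p)) /\
                        measurable_fun D (fun p => complex.Im (g p)).

Lemma cmeas_toC D : cmeas D (@toC R).
Proof.
split; rewrite /toC /=.
  exact: (measurable_funTS (@measurable_fst _ _ (measurableTypeR R) (measurableTypeR R))).
exact: (measurable_funTS (@measurable_snd _ _ (measurableTypeR R) (measurableTypeR R))).
Qed.

Lemma cmeas_cst D z : cmeas D (fun=> z).
Proof. by split; exact: measurable_cst. Qed.

Lemma cmeasD D g h : cmeas D g -> cmeas D h -> cmeas D (fun p => g p + h p).
Proof.
move=> [g1 g2] [h1 h2]; split.
  by under eq_fun do rewrite cReD; exact: measurable_funD.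
by under eq_fun do rewrite cImD; exact: measurable_funD.
Qed.

Lemma cmeasM D g h : cmeas D g -> cmeas D h -> cmeas D (fun p => g p * h p).
Proof.
move=> [g1 g2] [h1 h2]; split.
  by under eq_fun do rewrite cReM; apply: measurable_funB; exact: measurable_funM.
by under eq_fun do rewrite cImM; apply: measurable_funD; exact: measurable_funM.
Qed.

Lemma cmeasX D g n : cmeas D g -> cmeas D (fun p => g p ^+ n).
Proof.
move=> mg; elim: n => [|n IH]; first exact: cmeas_cst.
by under eq_fun do rewrite exprS; exact: cmeasM.
Qed.

Lemma cmeas_sum D n (u : nat -> plane -> R[i]) : (forall k, cmeas D (u k)) ->
  cmeas D (fun p => \sum_(k < n) u k p).
Proof.
move=> mu; elim: n => [|n IH].
  by under eq_fun do rewrite big_ord0; exact: cmeas_cst.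
by under eq_fun do rewrite big_ord_recr/=; exact: cmeasD.
Qed.

Lemma cmeas_csum D (u : nat -> plane -> R[i]) g : (forall k, cmeas D (u k)) ->
  (forall p, D p -> csum_to (u ^~ p) (g p)) -> cmeas D g.
Proof.
move=> mu ug; have ms n := @cmeas_sum D n u mu; split.
  apply: (@measurable_fun_cvg _ _ _ D (fun n p => complex.Re (\sum_(k < n) u k p))).
    by move=> n; have [] := ms n.
  by move=> p /ug/cvg_Re.
apply: (@measurable_fun_cvg _ _ _ D (fun n p => complex.Im (\sum_(k < n) u k p))).
  by move=> n; have [] := ms n.
by move=> p /ug/cvg_Im.
Qed.

Lemma cmeas_sqmod D g : cmeas D g -> measurable_fun D (fun p => sqmod (g p)).
Proof.
move=> [g1 g2]; under eq_fun do rewrite sqmodE.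
by apply: measurable_funD; apply: measurable_funX.
Qed.

Lemma plane_diskE (p : plane) : plane_disk R p <-> nc (toC p) < 1.
Proof. exact: disk_nc. Qed.

Lemma measurable_plane_disk : measurable (plane_disk R).
Proof.
have m := cmeas_sqmod (cmeas_toC setT).
rewrite (_ : plane_disk R = setT `&` (fun p => sqmod (toC p)) @^-1` `]-oo, 1[%classic).
  by apply: m => //; exact: measurable_itv.
apply/seteqP; split => p /=.
  move=> /plane_diskE h; split=> //; rewrite in_itv/= /sqmod -/(nc _).
  by rewrite exprn_ilt1 ?nc_ge0.
move=> [_]; rewrite in_itv/= /sqmod -/(nc _) => h; apply/plane_diskE.
by rewrite -(@ltr_pXn2r _ 2) ?expr1n// nnegrE ?nc_ge0.
Qed.

(** A pointwise limit of polynomials. *)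
Lemma pser_cmeas (a : nat -> R[i]) : (forall r, 0 < r < 1 -> exists K, coef_bound a r K) ->
  cmeas (plane_disk R) (fun p => pser a (toC p)).
Proof.
move=> aK; apply: (@cmeas_csum _ (fun n p => a n * toC p ^+ n)).
  by move=> k; apply: cmeasM; [exact: cmeas_cst|apply: cmeasX; exact: cmeas_toC].
move=> p /plane_diskE p1; pose r := (nc (toC p) + 1) / 2.
have pr : nc (toC p) < r by rewrite /r; lra.
have [|K KP] := aK r.
  by have := nc_ge0 (toC p) => h; apply/andP; rewrite /r; split; lra.
exact: pser_cvg KP.
Qed.

Lemma cmeas_eq D g h : (forall p, D p -> g p = h p) -> cmeas D g -> cmeas D h.
Proof.
move=> gh [g1 g2]; split.
  by apply: eq_measurable_fun g1 => p /[!inE] Dp; rewrite gh.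
by apply: eq_measurable_fun g2 => p /[!inE] Dp; rewrite gh.
Qed.

Lemma hol_cmeas (f : R[i] -> R[i]) : holomorphic_on_disk f ->
  cmeas (plane_disk R) (fun p => f (toC p)).
Proof.
move=> fh; apply: cmeas_eq (pser_cmeas (tay_coef_bound fh)).
by move=> p /plane_diskE p1; rewrite -(taylor fh p1).
Qed.

Lemma hol_deriv_cmeas (f : R[i] -> R[i]) : holomorphic_on_disk f ->
  cmeas (plane_disk R) (fun p => cderiv f (toC p)).
Proof.
move=> fh; apply: (@cmeas_eq _ (fun p => pser (dcoef (tay f)) (toC p))).
  by move=> p /plane_diskE p1; rewrite (taylor_deriv fh p1).
apply: pser_cmeas => r r01; pose s := (r + 1) / 2.
have rs : r < s by rewrite /s; lra.
have [|K KP] := tay_coef_bound fh (r := s).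
  by apply/andP; rewrite /s; split; lra.
by eexists; apply: coef_bound_dcoef rs KP; case/andP: r01.
Qed.

End plane_measurability.

(** * Extraction of subsequences *)

Section extraction.
Variable R : realType.

(** A diagonal argument: along an ultrafilter finer than the filter of infinity every
    bounded sequence converges, so all the limits b_j exist simultaneously; k (n + 1) is then
    any index beyond k n at which the first n + 2 terms are close enough to their limits. *)
Lemma bounded_subsequence (a : nat -> nat -> R[i]) (C : nat -> R) :
  (forall k j, nc (a k j) <= C j) ->
  exists2 k : nat -> nat, {homo k : m n / (m < n)%N} &
  exists b : nat -> R[i], forall n j, (j <= n)%N -> nc (a (k n) j - b j) < n.+1%:R^-1.
Proof.
move=> aC.
have [F [FU FF]] := @ultraFilterLemma _ (\oo : set_system nat) _.
have lim (x : nat -> R) B : (forall k, `|x k| <= B) -> exists l : R, x @ F --> l.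
  move=> xB; have xF : (x @ F) `[- B, B]%classic.
    by apply: (@filterE _ F) => k; rewrite /= in_itv/= -ler_norml; exact: xB.
  have [l [_ cl]] := @segment_compact R (- B) B (x @ F) _ xF.
  exists l => V nV; have [//|FC] := in_ultra_setVsetC (x @^-1` V) FU.
  by have [y [/= ]] := cl (~` V) V FC nV.
have /choice[b bP] : forall j, exists b : R[i],
    (fun k => a k j : R[i]^o) @ F --> (b : R[i]^o).
  move=> j.
  have [l1 h1] := lim (fun k => complex.Re (a k j)) (C j)
    (fun k => le_trans (ler_Re _) (aC k j)).
  have [l2 h2] := lim (fun k => complex.Im (a k j)) (C j)
    (fun k => le_trans (ler_Im _) (aC k j)).
  by exists (l1 +i* l2); apply/cvg_ReIm.
have step n m : exists k, (m < k)%N /\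
    forall j, (j <= n)%N -> nc (a k j - b j) < n.+1%:R^-1.
  have H : F [set k | forall j, (j < n.+1)%N -> nc (a k j - b j) < n.+1%:R^-1].
    have : (0 : R) < n.+1%:R^-1 by rewrite invr_gt0.
    move: (n.+1%:R^-1 : R) => e e0; elim: n.+1 => [|N IH]; first by apply: filterE.
    have FI : Filter F by exact: _.
    have h2 := (@cvg_nc _ _ F FI _ _).1 (bP N) e e0.
    apply: filterS (filterI IH h2) => k [k1 k2] j.
    by rewrite ltnS leq_eqVlt => /predU1P[->|]; [exact: k2|exact: k1].
  have G : F [set k | (m < k)%N] by apply: FF; exact: nbhs_infty_gt.
  by have [k [k1 k2]] := filter_ex (filterI H G); exists k.
have /choice[S SP] : forall nm : nat * nat, exists k, (nm.2 < k)%N /\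
    forall j, (j <= nm.1)%N -> nc (a k j - b j) < nm.1.+1%:R^-1.
  by move=> [n m]; exact: step.
pose k := fix k n := if n is n'.+1 then S (n, k n') else S (0%N, 0%N).
exists k.
  by apply: homo_ltn; [exact: ltn_trans|move=> n; exact: (SP (n.+1, k n)).1].
exists b => -[|n] j jn; first exact: (SP (0%N, 0%N)).2.
exact: (SP (n.+1, k n)).2.
Qed.

(** If |phi| came arbitrarily close to 1 on the disk, a convergent sequence of values would
    have its limit in the closure of the image and on the unit circle. *)
Lemma compact_image_radius (phi : R[i] -> R[i]) :
  phi @` disk R `<=` disk R ->
  closure (phi @` disk R : set R[i]^o) `<=` disk R ->
  exists2 r : R, 0 < r < 1 & forall z, nc z < 1 -> nc (phi z) <= r.
Proof.
move=> phi_self phi_cl; apply: contrapT => H.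
have /choice[z zP] : forall n : nat, exists z, nc z < 1 /\ 1 - n.+2%:R^-1 < nc (phi z).
  move=> n; apply: contrapT => nz; apply: H.
  have n2 : (0 : R) < n.+2%:R^-1 by rewrite invr_gt0.
  have n21 : (n.+2%:R^-1 : R) < 1 by rewrite invf_lt1 ?ltr1n.
  exists (1 - n.+2%:R^-1); first by rewrite subr_gt0 n21 ltrBlDr ltrDl.
  by move=> z z1; have [//|h] := leP (nc (phi z)) (1 - n.+2%:R^-1); case: nz; exists z.
have phi1 n : nc (phi (z n)) <= 1.
  apply/ltW/disk_nc/phi_self; exists (z n) => //; apply/disk_nc.
  by have [] := zP n.
have [k kS [b bP]] := @bounded_subsequence (fun k _ => phi (z k)) (fun=> 1) (fun k _ => phi1 k).
have kn n : (n <= k n)%N.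
  by elim: n => // n IH; apply: leq_ltn_trans IH (kS _ _ (ltnSn n)).
have bd : disk R (b 0%N).
  apply: phi_cl => A /nbhs_nc[e e0 eA].
  have [n ne] : exists n : nat, (n.+1%:R^-1 : R) < e.
    exists (Num.bound e^-1); rewrite invf_plt ?posrE//.
    by rewrite (lt_trans (archi_boundP _))// ?ltr_nat// invr_ge0 ltW.
  exists (phi (z (k n))); split; last first.
    by apply: eA; apply: lt_trans ne; exact: bP.
  by exists (z (k n)) => //; apply/disk_nc; have [] := zP (k n).
move/disk_nc : bd; apply/negP; rewrite -leNgt.
apply/ler_addgt0Pl => e e0.
have [n ne] : exists n : nat, (n.+1%:R^-1 : R) < e / 2.
  exists (Num.bound (e / 2)^-1); rewrite invf_plt ?posrE ?divr_gt0//.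
  by rewrite (lt_trans (archi_boundP _))// ?ltr_nat// invr_ge0 ltW ?divr_gt0.
have [_ h1] := zP (k n); have h2 := bP n 0%N isT.
have h3 : ((k n).+2%:R^-1 : R) <= n.+1%:R^-1.
  by rewrite lef_pV2 ?posrE// ler_nat; apply: leq_trans (kn n) _.
have := ncD (phi (z (k n)) - b 0%N) (b 0%N); rewrite subrK => h4.
move: (_.+2%:R^-1 : R) h1 h3 => p h1 h3.
move: (n.+1%:R^-1 : R) h2 h3 ne => q h2 h3 ne.
lra.
Qed.

End extraction.

(** * Calculus for continuous integrands *)

Section real_calculus.
Variable R : realType.
Implicit Types (a b x e : R) (F G : R -> R).

Lemma approx_is_derive F x (d : R) :
  (forall e, 0 < e -> exists2 r, 0 < r &
    forall h, `|h| < r -> `|F (x + h) - F x - d * h| <= e * `|h|) -> is_derive x 1 F d.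
Proof.
move=> H.
have C : (fun h : R => h^-1 *: ((F \o shift x) (h *: 1) - F x)) h @[h --> (0:R)^'] --> d.
  apply/cvgrPdist_le => e e0; have [r r0 rP] := H e e0.
  rewrite !nearE /dnbhs /within /=; apply/nbhs_ballP; exists r => // h.
  rewrite /ball/= sub0r normrN => hr h0.
  rewrite -(@ler_pM2r _ `|h|) ?normr_gt0// -normrM mulrBl /GRing.scale/=.
  by rewrite mulr1 mulrAC mulVf// mul1r [h + x]addrC distrC; exact: rP.
split; first by apply/cvg_ex; exists d.
exact: (@cvg_lim R^o).
Qed.

Lemma itg_FTC F F' a b : a < b -> (forall x, a <= x <= b -> is_derive x 1 F (F' x)) ->
  ctson a b F' -> itg a b F' = F b - F a.
Proof.
move=> ab dF cF'.
have cF x : a <= x <= b -> {for x, continuous F}.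
  by move=> /dF[dx _]; apply: differentiable_continuous; exact/derivable1_diffP.
rewrite /itg /Rintegral (@continuous_FTC2 _ F' F)//; first exact: ctson_within.
  split.
  - by move=> x; rewrite in_itv/= => /andP[ax xb]; have [] := dF x; rewrite ?ltW.
  - by apply: cvg_at_right_filter; apply: cF; rewrite lexx ltW.
  - by apply: cvg_at_left_filter; apply: cF; rewrite lexx ltW.
move=> x; rewrite in_itv/= => /andP[ax xb].
have hx : a <= x <= b by rewrite !ltW.
by have [_ <-] := dF x hx; rewrite derive1E.
Qed.

Lemma itg_subst F F' G a b : a < b -> (forall x, is_derive x 1 F (F' x)) ->
  continuous F' -> {in `[a, b] &, {homo F : x y / x < y}} -> ctson (F a) (F b) G ->
  itg (F a) (F b) G = itg a b (fun t => G (F t) * F' t).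
Proof.
move=> ab dF cF' Fi cG.
have F'E : derive1 F = F'.
  by apply/funext => x; have [_ <-] := dF x; rewrite derive1E.
have cF x : {for x, continuous F}.
  by have [dx _] := dF x; apply: differentiable_continuous; exact/derivable1_diffP.
rewrite /itg /Rintegral (integration_by_substitution_increasing (ltW ab) Fi) ?F'E//.
- by apply/cvg_ex; exists (F' a); apply: cvg_at_right_filter; exact: cF'.
- by apply/cvg_ex; exists (F' b); apply: cvg_at_left_filter; exact: cF'.
- split.
  + by move=> x _; have [] := dF x.
  + by apply: cvg_at_right_filter; exact: cF.
  + by apply: cvg_at_left_filter; exact: cF.
- exact: ctson_within.
Qed.

Lemma itg_ereal a b F : ctson a b F ->
  (\int[@lebesgue_measure R]_(x in `[a, b]) (F x)%:E = (itg a b F)%:E)%E.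
Proof.
move=> cF; rewrite /itg /Rintegral fineK//.
by apply: (integrable_fin_num _ (ctson_integrable cF)).
Qed.

Lemma itg_ge0 a b F : (forall x, a <= x <= b -> 0 <= F x) -> 0 <= itg a b F.
Proof. by move=> F0; apply: Rintegral_ge0 => x /=; rewrite in_itv; exact: F0. Qed.

Lemma lebesgue_reflect (h : R -> \bar R) : measurable_fun setT h ->
  (forall x, (0 <= h x)%E) ->
  (\int[@lebesgue_measure R]_x h (- (x : R))%R = \int[@lebesgue_measure R]_x h x)%E.
Proof.
move=> mh h0.
have mN : measurable_fun setT (-%R : measurableTypeR R -> measurableTypeR R).
  exact: oppr_measurable.
transitivity (\int[pushforward (@lebesgue_measure R) (-%R : _ -> measurableTypeR R)]_(x in setT) h x)%E.
  by rewrite (ge0_integral_pushforward mN)//= preimage_setT.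
by apply: eq_measure_integral => A mA _; exact: lebesgue_measureN.
Qed.

End real_calculus.

(** * Rotation invariance of the Dirichlet integral *)

Section rotation.
Variable R : realType.
Implicit Types (f : R[i] -> R[i]).
Notation plane := (measurableTypeR R * measurableTypeR R)%type.

(** Rotation by a quarter turn. In real coordinates it is (x, y) to (- y, x), a reflection
    followed by an exchange of coordinates, so its invariance needs no general change of
    variables. *)
Definition rot f : R[i] -> R[i] := fun z => f ('i%C * z).

Lemma nc_i : nc ('i%C : R[i]) = 1.
Proof. by rewrite /nc /= expr0n/= expr1n add0r sqrtr1. Qed.

Lemma rot_has_deriv f z d : has_deriv f ('i%C * z) d -> has_deriv (rot f) z (d * 'i%C).
Proof.
move=> fd; have h := has_derivM (has_deriv_cst ('i%C) z) (has_deriv_id z).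
by rewrite mul0r add0r mulr1 in h; exact: (has_deriv_comp h fd).
Qed.

Lemma rot_hol f : holomorphic_on_disk f -> holomorphic_on_disk (rot f).
Proof.
move=> fh z /disk_nc z1.
have iz1 : nc ('i%C * z) < 1 by rewrite ncM nc_i mul1r.
by have [] := has_deriv_derivable (rot_has_deriv (hol_has_deriv fh iz1)).
Qed.

Lemma rot_deriv f z : holomorphic_on_disk f -> nc z < 1 ->
  sqmod (cderiv (rot f) z) = sqmod (cderiv f ('i%C * z)).
Proof.
move=> fh z1; have iz1 : nc ('i%C * z) < 1 by rewrite ncM nc_i mul1r.
have [_ ->] := has_deriv_derivable (rot_has_deriv (hol_has_deriv fh iz1)).
by rewrite /sqmod -!/(nc _) ncM nc_i mulr1.
Qed.

(** The integrand of the Dirichlet integral extended by 0, in order to use Tonelli's theorem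
    on the whole plane. *)
Definition energy f (p : plane) : \bar R :=
  ((fun p => (sqmod (cderiv f (toC p)))%:E) \_ (plane_disk R)) p.

Lemma in_plane_disk (p : plane) : (p \in plane_disk R) = (nc (toC p) < 1).
Proof.
by apply/idP/idP => [/set_mem/plane_diskE|h] //; apply/mem_set/plane_diskE.
Qed.

Lemma energyE f p : energy f p =
  if nc (toC p) < 1 then (sqmod (cderiv f (toC p)))%:E else 0%E.
Proof. by rewrite /energy patchE in_plane_disk. Qed.

Lemma energy_ge0 f p : (0 <= energy f p)%E.
Proof.
by rewrite energyE; case: ifP => // _; rewrite lee_fin /sqmod sqr_ge0.
Qed.

Lemma energy_measurable f : holomorphic_on_disk f -> measurable_fun setT (energy f).
Proof.
move=> fh; apply/(measurable_restrictT _ (@measurable_plane_disk R)).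
by apply/measurable_EFinP; exact: cmeas_sqmod (hol_deriv_cmeas fh).
Qed.

Lemma dirichlet_integralE f : dirichlet_integral f = (\int[area R]_p energy f p)%E.
Proof. by rewrite /dirichlet_integral integral_mkcond. Qed.

Lemma rot_energy f (x y : R) : holomorphic_on_disk f ->
  energy (rot f) (x, y) = energy f (- y, x).
Proof.
move=> fh; rewrite !energyE.
have e : toC (- y, x) = 'i%C * toC (x, y) :> R[i].
  by rewrite /toC /=; simpc.
have m : nc (toC (- y, x) : R[i]) = nc (toC (x, y) : R[i]) by rewrite e ncM nc_i mul1r.
have := @rot_deriv f (toC (x, y)) fh.
move: (toC (x, y)) (toC (- y, x)) e m => p q e m; rewrite m -e.
have if_eq (b : bool) (u v : R) : (b -> u = v) ->
  (if b then u%:E else 0%E) = (if b then v%:E else 0%E).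
  by case: b => // ->.
exact: if_eq.
Qed.

(** Integrate the two sides in opposite orders and reflect the inner variable. *)
Lemma rot_dirichlet f : holomorphic_on_disk f ->
  dirichlet_integral (rot f) = dirichlet_integral f.
Proof.
move=> fh; rewrite !dirichlet_integralE.
have m1 := energy_measurable (rot_hol fh); have m2 := energy_measurable fh.
have g1 := energy_ge0 (rot f); have g2 := energy_ge0 f.
have E1 := @fubini_tonelli1 _ _ _ _ R (@lebesgue_measure R) (@lebesgue_measure R) _ m1 g1.
have E2 := @fubini_tonelli2 _ _ _ _ R (@lebesgue_measure R) (@lebesgue_measure R) _ m2 g2.
apply: (eq_trans E1); apply: (eq_trans _ (esym E2)).
apply: eq_integral => x _; rewrite /fubini_F /fubini_G.
transitivity (\int[@lebesgue_measure R]_y energy f (- (y : R), x)%R)%E.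
  by apply: eq_integral => y _; exact: rot_energy.
apply: (@lebesgue_reflect _ (fun y => energy f (y, x))) => [|y]; last exact: energy_ge0.
apply: (measurableT_comp (energy_measurable fh)).
by apply: measurable_fun_pair => //; exact: measurable_cst.
Qed.

Definition rotn k f := iter k (@rot) f.

Lemma rotnS k f : rotn k.+1 f = rot (rotn k f).
Proof. by []. Qed.

Lemma rotnE k f z : rotn k f z = f ('i%C ^+ k * z).
Proof.
elim: k f z => [|k IH] f z; first by rewrite expr0 mul1r.
by rewrite /rotn iterSr -/(rotn k (rot f)) IH /rot mulrA -exprS.
Qed.

Lemma rotn_hol k f : holomorphic_on_disk f -> holomorphic_on_disk (rotn k f).
Proof. by move=> fh; elim: k => [|k IH]; [exact: fh|exact: rot_hol IH]. Qed.

Lemma rotn_dirichlet k f : holomorphic_on_disk f ->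
  dirichlet_integral (rotn k f) = dirichlet_integral f.
Proof.
move=> fh; elim: k => [|k IH]; first by [].
by rewrite rotnS -IH; exact: rot_dirichlet (rotn_hol (k := k) fh).
Qed.

Lemma circ_rotn k f r t : f (circ r t) = rotn k f (circ r (t - k%:R * (pi / 2))).
Proof.
rewrite rotnE; congr f; elim: k => [|k IH]; first by rewrite mul0r subr0 expr0 mul1r.
rewrite IH exprSr -mulrA; congr (_ * _).
have -> : 'i%C = circ 1 (pi / 2) :> R[i].
  by rewrite circE cos_pihalf sin_pihalf mulr0 mulr1.
by rewrite circD mul1r; congr circ; rewrite -natr1; ring.
Qed.

End rotation.

(** * Finite Dirichlet integral implies finite Hardy norm *)

Section hardy_bound.
Variable R : realType.

Section arc.
Variable f : R[i] -> R[i].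
Hypothesis fh : holomorphic_on_disk f.
Hypothesis fD : (dirichlet_integral f < +oo)%E.
Let D := fine (dirichlet_integral f).

Let g (x y : R) := sqmod (cderiv f (x +i* y)).

Let g0 x y : 0 <= g x y. Proof. by rewrite /g /sqmod sqr_ge0. Qed.

Lemma D_ge0 : 0 <= D.
Proof. by apply: fine_ge0; apply: integral_ge0 => p _; rewrite lee_fin sqr_ge0. Qed.

Lemma dirichlet_fin : dirichlet_integral f = D%:E.
Proof.
rewrite fineK// ge0_fin_numE//.
by apply: integral_ge0 => p _; rewrite lee_fin sqr_ge0.
Qed.

Lemma xy_lt1 (x y : R) : x ^+ 2 + y ^+ 2 < 1 -> nc (x +i* y) < 1.
Proof.
move=> h; rewrite -(@ltr_pXn2r _ 2) ?nnegrE ?nc_ge0// expr1n.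
by rewrite -[_ ^+ 2]/(sqmod _) sqmodE.
Qed.

Lemma g_cts (x y : R) : x ^+ 2 + y ^+ 2 < 1 ->
  {for (x, y), continuous (fun p : R * R => g p.1 p.2)}.
Proof.
move=> /xy_lt1 h; have [d dP] := deriv_has_deriv fh h.
have c1 : (fun q : R * R => q.1) q @[q --> (x, y)] --> x by exact: cvg_fst.
have c2 : (fun q : R * R => q.2) q @[q --> (x, y)] --> y by exact: cvg_snd.
have c : {for (x, y), continuous (fun p : R * R => cderiv f (p.1 +i* p.2) : R[i]^o)}.
  apply: (@continuous_comp _ _ _ (fun p : R * R => p.1 +i* p.2 : R[i]^o) (cderiv f : R[i]^o -> R[i]^o)).
    exact: cvg_complex c1 c2.
  exact: has_deriv_continuous dP.
rewrite (_ : (fun p : R * R => g p.1 p.2) = (fun p =>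
   complex.Re (cderiv f (p.1 +i* p.2)) * complex.Re (cderiv f (p.1 +i* p.2)) +
   complex.Im (cderiv f (p.1 +i* p.2)) * complex.Im (cderiv f (p.1 +i* p.2)))); last first.
  by apply/funext => p; rewrite /g sqmodE !expr2.
by apply: cvgD; apply: cvgM; first [exact: (cvg_Re c)|exact: (cvg_Im c)].
Qed.

(** |p + q|^2 <= 2 |p|^2 + 2 |q|^2 for the increment q of f along a horizontal segment of
    length 1/2, and |q|^2 is at most 1/2 times the integral of |f'|^2 by Cauchy-Schwarz. *)
Lemma segment_bound (x y : R) : (forall s, 0 <= s <= 2^-1 -> (x + s) ^+ 2 + y ^+ 2 < 1) ->
  sqmod (f ((x + 2^-1) +i* y)) <=
  2 * sqmod (f (x +i* y)) + itg 0 2^-1 (fun s => g (x + s) y).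
Proof.
move=> seg.
have h0 : (0 : R) < 2^-1 by rewrite invr_gt0.
pose z s : R[i] := (x + s) +i* y.
have zd s : 0 <= s <= 2^-1 -> has_deriv f (z s) (cderiv f (z s)).
  by move=> /seg/xy_lt1 h; exact: hol_has_deriv.
have zh s h : z (s + h) = z s + h%:C.
  by rewrite /z; simpc; rewrite addrA.
have cz s : {for s, continuous (z : R -> R[i]^o)}.
  apply: cvg_complex; last exact: cvg_cst.
  by apply: cvgD; [exact: cvg_cst|exact: cvg_id].
have cd s : 0 <= s <= 2^-1 -> {for s, continuous (fun s => cderiv f (z s) : R[i]^o)}.
  move=> /seg/xy_lt1 h; have [d dP] := deriv_has_deriv fh h.
  apply: (@continuous_comp _ _ _ (z : R -> R[i]^o) (cderiv f : R[i]^o -> R[i]^o)) => //.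
  exact: has_deriv_continuous dP.
have cR : ctson 0 2^-1 (fun s => complex.Re (cderiv f (z s))).
  by move=> s hs; exact: (cvg_Re (cd s hs)).
have cI : ctson 0 2^-1 (fun s => complex.Im (cderiv f (z s))).
  by move=> s hs; exact: (cvg_Im (cd s hs)).
have dR : itg 0 2^-1 (fun s => complex.Re (cderiv f (z s))) =
    complex.Re (f (z 2^-1)) - complex.Re (f (z 0)).
  apply: (itg_FTC h0 _ cR (F := fun s => complex.Re (f (z s)))) => s /zd fd.
  apply: approx_is_derive => e /fd[r r0 rP]; exists r => // h hr.
  have := rP h%:C; rewrite nc_real => /(_ hr); apply: le_trans; apply: le_trans (ler_Re _).
  by rewrite !cReB cReM Re_real Im_real mulr0 subr0 zh.
have dI : itg 0 2^-1 (fun s => complex.Im (cderiv f (z s))) =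
    complex.Im (f (z 2^-1)) - complex.Im (f (z 0)).
  apply: (itg_FTC h0 _ cI (F := fun s => complex.Im (f (z s)))) => s /zd fd.
  apply: approx_is_derive => e /fd[r r0 rP]; exists r => // h hr.
  have := rP h%:C; rewrite nc_real => /(_ hr); apply: le_trans; apply: le_trans (ler_Im _).
  by rewrite !cImB cImM Re_real Im_real mulr0 add0r zh.
have := sqr_itg_le h0 cR; have := sqr_itg_le h0 cI.
rewrite subr0 invrK dR dI.
have z0 : z 0 = x +i* y by rewrite /z addr0.
have -> : (x + 2^-1) +i* y = z 2^-1 by [].
rewrite z0 (_ : (fun s => g (x + s) y) = (fun s => complex.Re (cderiv f (z s)) ^+ 2 +
   complex.Im (cderiv f (z s)) ^+ 2)); last by apply/funext => s; rewrite /g sqmodE.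
rewrite itgD; [|exact: ctsonX2|exact: ctsonX2].
rewrite !sqmodE; move: (complex.Re (f _)) (complex.Im (f _)) => a b.
move: (complex.Re _) (complex.Im _) (itg _ _ _) (itg _ _ _) => c d I J.
have := sqr_ge0 (a - 2 * c); have := sqr_ge0 (b - 2 * d); nra.
Qed.

Lemma row_cts y a b : (forall x, a <= x <= b -> x ^+ 2 + y ^+ 2 < 1) ->
  ctson a b (fun x => g x y).
Proof.
move=> seg x /seg h.
apply: (@continuous_comp _ _ _ (fun x : R => (x, y)) (fun p : R * R => g p.1 p.2)).
  have c1 : (fun x : R => x) z @[z --> x] --> x by exact: cvg_id.
  have c2 : (fun=> y) z @[z --> x] --> y by exact: cvg_cst.
  exact: (cvg_pair c1 c2).
exact: g_cts.
Qed.

Lemma itg_g_le_row (a b y : R) : a <= b ->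
  (forall x, a <= x <= b -> x ^+ 2 + y ^+ 2 < 1) ->
  ((itg a b (fun x => g x y))%:E <= \int[@lebesgue_measure R]_x energy f (x, y))%E.
Proof.
move=> ab seg.
have cg : ctson a b (fun x => g x y) := row_cts seg.
rewrite -itg_ereal//.
have mE : measurable_fun setT (fun x => energy f (x, y)).
  apply: (measurableT_comp (energy_measurable fh)).
  by apply: measurable_fun_pair => //; exact: measurable_cst.
have E0 : forall x, (0 <= energy f (x, y))%E by move=> x; exact: energy_ge0.
apply: (@le_trans _ _ (\int[@lebesgue_measure R]_(x in `[a, b]) energy f (x, y))%E).
  apply: ge0_le_integral => //.
  - by move=> x _; rewrite lee_fin.
  - by apply/measurable_EFinP; have := ctson_integrable cg => /measurable_int/measurable_EFinP.
  - exact: measurable_funTS.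
  - move=> x /=; rewrite in_itv/= => /seg/xy_lt1 h.
    by rewrite energyE /toC /= h.
by apply: ge0_subset_integral.
Qed.

Variable r : R.
Hypothesis r01 : 7 / 8 < r < 1.

(** Abscissa of the right-hand point of height y on |z| = r, and energy of the segment of
    length 1/2 which ends there. *)
Let X (y : R) := Num.sqrt (r ^+ 2 - y ^+ 2).
Let E (y : R) := itg 0 2^-1 (fun s => g (X y - 2^-1 + s) y).

Lemma X_sqr y : `|y| <= 4 / 5 -> X y ^+ 2 = r ^+ 2 - y ^+ 2.
Proof.
move=> hy; rewrite sqr_sqrtr// subr_ge0.
have y2 : y ^+ 2 <= (4 / 5) ^+ 2.
  by rewrite -[y ^+ 2]real_normK ?num_real// lerXn2r ?nnegrE// divr_ge0.
case/andP: r01 => r1 r2; nra.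
Qed.

Lemma X_ge0 y : 0 <= X y. Proof. exact: sqrtr_ge0. Qed.

Lemma X_segment y s : `|y| <= 4 / 5 -> 0 <= s <= 2^-1 ->
  (X y - 2^-1 + s) ^+ 2 + y ^+ 2 < 1.
Proof.
move=> hy /andP[s0 s1]; have := X_sqr hy; have := X_ge0 y.
have y2 : y ^+ 2 <= (4 / 5) ^+ 2.
  by rewrite -[y ^+ 2]real_normK ?num_real// lerXn2r ?nnegrE// divr_ge0.
move: (X y) => x x0 xE; case/andP: r01 => r1 r2.
have r21 : r ^+ 2 < 1 by nra.
have [h|h] := leP 0 (x - 2^-1 + s).
  have : (x - 2^-1 + s) ^+ 2 <= x ^+ 2 by rewrite lerXn2r ?nnegrE//; lra.
  lra.
have : (x - 2^-1 + s) ^+ 2 <= (2^-1) ^+ 2.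
  by rewrite -sqrrN lerXn2r ?nnegrE//; lra.
lra.
Qed.

Lemma X_continuous y : {for y, continuous X}.
Proof.
apply: (@continuous_comp _ _ _ (fun y : R => r ^+ 2 - y ^+ 2) Num.sqrt).
  by apply: cvgB; [exact: cvg_cst|apply: cvgM; exact: cvg_id].
exact: sqrt_continuous.
Qed.

Lemma E_ge0 y : 0 <= E y.
Proof. by apply: itg_ge0 => s _; exact: g0. Qed.

Lemma E_continuous y : `|y| < 4 / 5 -> {for y, continuous E}.
Proof.
move=> hy; apply: itg_continuous => [|s hs|]; first by rewrite invr_ge0.
  have c1 : (fun q : R * R => q.1) q @[q --> (y, s)] --> y by exact: cvg_fst.
  have c2 : (fun q : R * R => q.2) q @[q --> (y, s)] --> s by exact: cvg_snd.
  have cX : (fun q : R * R => X q.1) q @[q --> (y, s)] --> X y.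
    by apply: (continuous_comp c1); exact: X_continuous.
  apply: (@continuous_comp _ _ _ (fun p : R * R => (X p.1 - 2^-1 + p.2, p.1))
    (fun p : R * R => g p.1 p.2)).
    have c3 : (fun p : R * R => X p.1 - 2^-1 + p.2) q @[q --> (y, s)] --> X y - 2^-1 + s.
      by apply: cvgD => //; apply: cvgB => //; exact: cvg_cst.
    exact: (cvg_pair c3 c1).
  by apply: g_cts; apply: X_segment => //; exact: ltW.
near=> z; have hz : `|z| <= 4 / 5.
  apply: ltW; near: z.
  have : (fun x : R => `|x|) x @[x --> y] --> `|y| by apply: cvg_norm; exact: cvg_id.
  by move/cvgr_lt; apply.
move=> s hs; apply: (@continuous_comp _ _ _ (fun s : R => X z - 2^-1 + s) (fun x => g x z)).
  by apply: cvgD; [exact: cvg_cst|exact: cvg_id].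
have := @row_cts z (X z - 2^-1 + s) (X z - 2^-1 + s); apply.
  by move=> x; rewrite -eq_le => /eqP <-; exact: X_segment.
by rewrite lexx.
Unshelve. all: by end_near. Qed.

Lemma E_le_row y : `|y| <= 4 / 5 ->
  ((E y)%:E <= \int[@lebesgue_measure R]_x energy f (x, y))%E.
Proof.
move=> hy; pose F s := X y - 2^-1 + s.
have F0 : F 0 = X y - 2^-1 by rewrite /F addr0.
have Fh : F 2^-1 = X y by rewrite /F subrK.
have seg x : X y - 2^-1 <= x <= X y -> x ^+ 2 + y ^+ 2 < 1.
  move=> /andP[h1 h2]; have := @X_segment y (x - (X y - 2^-1)) hy.
  rewrite (_ : X y - 2^-1 + (x - (X y - 2^-1)) = x); last by ring.
  by apply; apply/andP; split; lra.
have -> : E y = itg (X y - 2^-1) (X y) (fun x => g x y).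
  have h0 : (0 : R) < 2^-1 by rewrite invr_gt0.
  have dF (x : R) : is_derive x 1 F ((fun=> 1) x).
    apply: approx_is_derive => e e0; exists 1 => // h _.
    rewrite (_ : F (x + h) - F x - 1 * h = 0); last by rewrite /F; ring.
    by rewrite normr0; apply: mulr_ge0 => //; exact: ltW.
  have c1 : continuous (fun _ : R => 1 : R) by move=> x; exact: cvg_cst.
  have Fi : {in `[0, 2^-1] &, {homo F : x x' / x < x'}}.
    by move=> x x' _ _; rewrite ltrD2l.
  have cg : ctson (F 0) (F 2^-1) (fun x => g x y) by rewrite F0 Fh; exact: row_cts.
  rewrite -F0 -[in RHS]Fh (itg_subst h0 dF c1 Fi cg).
  by rewrite /E; congr itg; apply/funext => s; rewrite mulr1.
by apply: itg_g_le_row => //; lra.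
Qed.

(** The segments that end on the arc sweep a region of the disk, so by Tonelli their energies
    integrate to at most the Dirichlet integral. *)
Lemma itg_E_le a b : a <= b -> - (4 / 5) < a -> b < 4 / 5 -> itg a b E <= D.
Proof.
move=> ab a1 b1.
have hy y : a <= y <= b -> `|y| < 4 / 5.
  by move=> /andP[ay yb]; rewrite ltr_norml; apply/andP; split; lra.
have cE : ctson a b E by move=> y /hy; exact: E_continuous.
have mU := energy_measurable fh; have U0 := energy_ge0 f.
have E2 := @fubini_tonelli2 _ _ _ _ R (@lebesgue_measure R) (@lebesgue_measure R) _ mU U0.
have mG := @measurable_fun_fubini_tonelli_G _ _ _ _ R (@lebesgue_measure R) _ mU U0.
have G0 y : (0 <= fubini_G (@lebesgue_measure R) (energy f) y)%E.
  by apply: integral_ge0 => x _; exact: energy_ge0.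
have DE : D%:E = (\int[@lebesgue_measure R]_y fubini_G (@lebesgue_measure R) (energy f) y)%E.
  by rewrite -dirichlet_fin dirichlet_integralE; exact: E2.
rewrite -lee_fin -itg_ereal// DE.
apply: (@le_trans _ _ (\int[@lebesgue_measure R]_(y in `[a, b])
    fubini_G (@lebesgue_measure R) (energy f) y)%E).
  apply: ge0_le_integral => //.
  - by move=> y _; rewrite lee_fin; exact: E_ge0.
  - by apply/measurable_EFinP; have := ctson_integrable cE => /measurable_int/measurable_EFinP.
  - exact: measurable_funTS.
  - by move=> y /=; rewrite in_itv/= => /hy/ltW; exact: E_le_row.
by apply: ge0_subset_integral.
Qed.

Lemma cos_sin_quarter (s : R) : `|s| <= pi / 4 -> 2^-1 <= cos s /\ sin s ^+ 2 <= 2^-1.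
Proof.
rewrite ler_norml => /andP[s1 s2]; have p0 := pi_gt0 R.
have c0 : 0 <= cos s by apply: cos_ge0_pihalf; apply/andP; split; lra.
have : 0 <= cos (s *+ 2) by apply: cos_ge0_pihalf; rewrite [s *+ 2]mulr2n; apply/andP; split; lra.
have := cos2Dsin2 s; rewrite cos_mulr2n => H1 H2.
have H3 : 1 <= 2 * cos s ^+ 2 by move: H2; rewrite mulr2n; lra.
split; last by lra.
nra.
Qed.

Variable S : R.
Hypothesis SP : forall z, nc z <= 7 / 8 -> sqmod (f z) <= S.

(** The point at distance 1/2 to the left of r (cos s, sin s) has squared modulus
    r^2 - r cos s + 1/4 <= 3/4 < (7/8)^2 since cos s >= 1/2. *)
Lemma point_bound (s : R) : `|s| <= pi / 4 ->
  sqmod (f (circ r s)) <= 2 * S + E (r * sin s).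
Proof.
move=> /cos_sin_quarter[c2 s2].
have [r1 r2] : 7 / 8 < r /\ r < 1 by case/andP: r01.
have CS := cos2Dsin2 s.
set c := cos s in c2 CS *; set d := sin s in s2 CS *.
have rd : `|r * d| <= 4 / 5.
  rewrite -(@ler_pXn2r _ 2) ?nnegrE ?divr_ge0// real_normK ?num_real// exprMn.
  have : r ^+ 2 <= 1 by nra.
  have := sqr_ge0 d; nra.
have XE : X (r * d) = r * c.
  rewrite /X (_ : r ^+ 2 - (r * d) ^+ 2 = (r * c) ^+ 2); last by nra.
  by rewrite sqrtr_sqr ger0_norm//; nra.
have := @segment_bound (r * c - 2^-1) (r * d); rewrite -XE => /(_ (fun s hs => X_segment rd hs)).
rewrite subrK XE -circE => h; apply: (le_trans h).
rewrite /E XE lerD2r ler_wpM2l//; apply: SP.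
rewrite -(@ler_pXn2r _ 2) ?nnegrE ?nc_ge0 ?divr_ge0//.
rewrite -[nc _ ^+ 2]/(sqmod _) sqmodE /=; nra.
Qed.

(** Substitute y = r sin (t - a0), whose derivative r cos (t - a0) is at least 7/16 > 1/3 on
    the arc: this accounts for the factor 3 in the comparison function. *)
Lemma arc_bound (a0 : R) :
  itg (a0 - pi / 4) (a0 + pi / 4) (fun t => sqmod (f (circ r (t - a0)))) <= 4 * (S + D).
Proof.
have [r1 r2] : 7 / 8 < r /\ r < 1 by case/andP: r01.
have r0 : 0 < r by lra.
have p0 := pi_gt0 R.
have p4 : pi / 2 < (2 : R) by exact: pihalf_lt2.
set a := a0 - pi / 4; set b := a0 + pi / 4.
have ab : a < b by rewrite /a /b; lra.
have hs t : a <= t <= b -> `|t - a0| <= pi / 4.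
  by rewrite /a /b => /andP[h1 h2]; rewrite ler_norml; apply/andP; split; lra.
pose F t := r * sin (t - a0); pose F' t := r * cos (t - a0).
have dF (t : R) : is_derive t 1 F (F' t).
  apply: approx_is_derive => e e0.
  have er : 0 < e / r by rewrite divr_gt0.
  have [q q0 qP] := derive_approx (is_derive_sin (t - a0)) er.
  exists q => // h /qP; rewrite /F /F'.
  have -> : t + h - a0 = t - a0 + h by ring.
  have -> : r * sin (t - a0 + h) - r * sin (t - a0) - r * cos (t - a0) * h =
    r * (sin (t - a0 + h) - sin (t - a0) - cos (t - a0) * h) by ring.
  by rewrite mulrAC ler_pdivlMr// normrM (gtr0_norm r0) mulrC.
have cshift t : {for t, continuous (fun t : R => t - a0)}.
  by apply: cvgB; [exact: cvg_id|exact: cvg_cst].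
have cF' : continuous F'.
  move=> t; apply: cvgM; first exact: cvg_cst.
  by apply: (continuous_comp (cshift t)); exact: continuous_cos.
have cF : continuous F.
  move=> t; apply: cvgM; first exact: cvg_cst.
  by apply: (continuous_comp (cshift t)); exact: continuous_sin.
have Fi : {in `[a, b] &, {homo F : x y / x < y}}.
  move=> t t'; rewrite !in_itv/= => ht ht' tt'; rewrite /F ltr_pM2l//.
  move: (hs t ht) (hs t' ht'); rewrite !ler_norml => /andP[? ?] /andP[? ?].
  by rewrite ltr_sin ?in_itv/= ?ltrD2r//; apply/andP; split; lra.
have FB t : a <= t <= b -> `|F t| < 4 / 5.
  move=> /hs/cos_sin_quarter[_ h].
  rewrite -(@ltr_pXn2r _ 2) ?nnegrE ?divr_ge0// real_normK ?num_real// exprMn.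
  have : r ^+ 2 <= 1 by nra.
  have := sqr_ge0 (sin (t - a0)); nra.
have ha : a <= a <= b by rewrite lexx ltW.
have hb : a <= b <= b by rewrite lexx ltW.
have [Fa1 Fb1] : - (4 / 5) < F a /\ F b < 4 / 5.
  by move: (FB a ha) (FB b hb); rewrite !ltr_norml => /andP[? ?] /andP[? ?].
have Fab : F a <= F b by apply: ltW; apply: Fi => //; rewrite in_itv.
have cE : ctson (F a) (F b) E.
  move=> y /andP[h1 h2]; apply: E_continuous.
  by rewrite ltr_norml; apply/andP; split; lra.
have IE := itg_subst ab dF cF' Fi cE.
have IED := itg_E_le Fab Fa1 Fb1.
have cEF : ctson a b (fun t => E (F t) * F' t).
  move=> t ht; apply: cvgM; last exact: cF'.
  apply: (@continuous_comp _ _ _ F E); first exact: cF.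
  by apply: E_continuous; exact: FB.
pose h t := 2 * S + 3 * (E (F t) * F' t).
have ch2 : ctson a b (fun t => 3 * (E (F t) * F' t)).
  by move=> t ht; apply: cvgM; [exact: cvg_cst|exact: cEF].
have ch : ctson a b h.
  by move=> t ht; apply: cvgD; [exact: cvg_cst|exact: ch2].
have cf : ctson a b (fun t => sqmod (f (circ r (t - a0)))).
  move=> t _; apply: (@continuous_comp _ _ _ (fun t : R => t - a0) (fun t => sqmod (f (circ r t)))) => //.
  by apply: continuous_sqmod; apply: (f_ccts (hol_has_deriv fh)); rewrite gtr0_norm.
have D0 := D_ge0.
have S0 : 0 <= S by apply: le_trans (SP (z := 0) _); rewrite ?sqr_ge0// nc0 divr_ge0.
apply: (@le_trans _ _ (itg a b h)).
  apply: le_itg => // t ht; have st := hs t ht.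
  apply: (le_trans (point_bound st)); rewrite /h lerD2l -/(F t).
  have [c2 _] := cos_sin_quarter st.
  have E0 := E_ge0 (F t).
  have : 1 <= 3 * F' t by rewrite /F'; nra.
  move: (F' t) (E (F t)) E0 => u w w0 u1; nra.
rewrite /h itgD//; last exact: ctson_cst.
rewrite (itgZ 3 cEF) -IE itg_cst ?(ltW ab)//.
have : b - a < 2 by rewrite /a /b; lra.
have : 0 < b - a by lra.
move: (b - a) (itg _ _ E) IED => u w; nra.
Qed.

End arc.

Lemma itg_split_sum (h : R -> R) (p : nat -> R) n : (forall k, p k <= p k.+1) ->
  (forall t, {for t, continuous h}) ->
  itg (p 0%N) (p n) h = \sum_(k < n) itg (p k) (p k.+1) h.
Proof.
move=> pS ch; elim: n => [|n IH]; first by rewrite big_ord0 itg_pt.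
rewrite big_ord_recr/= -IH itg_split//.
  have /nondecreasing_seqP pn := pS.
  by rewrite pn// pS.
Qed.

Lemma itg_le_sub (a b c d : R) (h : R -> R) : c <= a -> a <= b -> b <= d ->
  (forall t, {for t, continuous h}) -> (forall t, 0 <= h t) -> itg a b h <= itg c d h.
Proof.
move=> ca ab bd ch h0.
have cc a' b' : ctson a' b' h by move=> t _; exact: ch.
rewrite -(@itg_split _ a c d)//; last by rewrite ca (le_trans ab).
rewrite -(@itg_split _ b a d)//; last by rewrite ab.
have : 0 <= itg c a h by apply: itg_ge0.
have : 0 <= itg b d h by apply: itg_ge0.
move: (itg _ _ _) (itg _ _ _) (itg _ _ _) => u v w; lra.
Qed.

Variable f : R[i] -> R[i].
Hypothesis fh : holomorphic_on_disk f.
Hypothesis fD : (dirichlet_integral f < +oo)%E.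

(** The radius 15/16 only has to lie strictly between 7/8 and 1. *)
Lemma bounded_inner : exists S, forall z, nc z <= 7 / 8 -> sqmod (f z) <= S.
Proof.
have r01 : 0 < (15 / 16 : R) < 1 by apply/andP; split; lra.
have [K KP] := tay_coef_bound fh r01.
exists ((K / (1 - 7 / 8 / (15 / 16))) ^+ 2) => z z78.
rewrite /sqmod -/(nc _) (taylor fh); last by lra.
have sr : (7 / 8 : R) < 15 / 16 by lra.
have h := pser_norm sr z78 KP.
by rewrite lerXn2r ?nnegrE ?nc_ge0// (le_trans _ h) ?nc_ge0.
Qed.

(** For r <= 7/8 the circle lies in the disk where |f|^2 <= S. Otherwise the five arcs
    centred at k pi / 2, k < 5, and of opening pi / 2 cover [0, 2 pi], and the k-th one is
    the arc centred at 0 for f rotated k times; hence 20 = 5 * 4. *)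
Lemma hardy_circle_bound : exists C, forall r, 0 < r < 1 ->
  (2 * pi)^-1 * itg 0 (2 * pi) (fun t => sqmod (f (circ r t))) <= C.
Proof.
have [S SP] := bounded_inner; set D := fine (dirichlet_integral f).
have D0 : 0 <= D by exact: D_ge0.
have p0 := pi_gt0 R.
have p1 : 1 <= (2 * pi : R) by have := pihalf_ge1 R; lra.
have S0 : 0 <= S by apply: le_trans (SP (0 : R[i]) _); rewrite ?sqr_ge0// nc0 divr_ge0.
exists (20 * (S + D)) => r /andP[r0 r1].
have ar1 : `|r| < 1 by rewrite gtr0_norm.
have cs t : {for t, continuous (fun t => sqmod (f (circ r t)))}.
  by apply: continuous_sqmod; exact: (f_ccts (hol_has_deriv fh)).
have s0 t : 0 <= sqmod (f (circ r t)) by exact: sqr_ge0.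
rewrite ler_pdivrMl//; last by lra.
have [r78|r78] := leP r (7 / 8).
  apply: (@le_trans _ _ (itg 0 (2 * pi) (fun=> S))).
    apply: le_itg; [by move=> t _|exact: ctson_cst|].
    by move=> t _; apply: SP; rewrite nc_circ gtr0_norm.
  by rewrite itg_cst ?subr0; nra.
pose p (k : nat) : R := k%:R * (pi / 2) - pi / 4.
have pS k : p k <= p k.+1.
  rewrite -subr_ge0 /p -[k.+1%:R]natr1.
  move: (pi : R) p0 => q p0; rewrite [X in 0 <= X](_ : _ = q / 2); last by ring.
  by rewrite divr_ge0// ltW.
apply: (@le_trans _ _ (itg (p 0%N) (p 5%N) (fun t => sqmod (f (circ r t))))).
  by apply: itg_le_sub => //; rewrite /p; lra.
rewrite (itg_split_sum _ pS cs).
apply: (@le_trans _ _ (\sum_(k < 5) 4 * (S + D))); last first.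
  by rewrite sumr_const card_ord -mulr_natl; nra.
apply: ler_sum => k _.
have -> : (fun t => sqmod (f (circ r t))) =
  (fun t => sqmod (rotn k f (circ r (t - k%:R * (pi / 2))))).
  by apply/funext => t; rewrite -circ_rotn.
have kh := rotn_hol (k := k) fh.
have kD : (dirichlet_integral (rotn k f) < +oo)%E by rewrite rotn_dirichlet.
have kS z : nc z <= 7 / 8 -> sqmod (rotn k f z) <= S.
  by move=> hz; rewrite rotnE; apply: SP; rewrite ncM ncX nc_i expr1n mul1r.
have r01 : 7 / 8 < r < 1 by rewrite r78.
have := arc_bound kh kD r01 kS (k%:R * (pi / 2)).
rewrite rotn_dirichlet// -/D; congr (_ <= _); congr itg.
by rewrite /p -natr1; field.
Qed.

Lemma hardy_normsqE r : 0 < r < 1 ->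
  (((2 * pi)^-1)%R%:E *
   \int[@lebesgue_measure R]_(t in `[0%R, (2 * pi)%R])
     (sqmod (f (r%:C * (cos t +i* sin t))))%:E)%E =
  ((2 * pi)^-1 * itg 0 (2 * pi) (fun t => sqmod (f (circ r t))))%:E.
Proof.
move=> /andP[r0 r1]; rewrite EFinM; congr (_ * _)%E.
rewrite -itg_ereal// => t _; apply: continuous_sqmod.
by apply: (f_ccts (hol_has_deriv fh)); rewrite gtr0_norm.
Qed.

Theorem hardy_normsq_fin : (hardy_normsq f < +oo)%E.
Proof.
have [C CP] := hardy_circle_bound.
apply: (@le_lt_trans _ _ C%:E); last exact: ltry.
apply: ge_ereal_sup => _ [r r01 <-].
by rewrite hardy_normsqE// lee_fin; exact: CP.
Qed.

End hardy_bound.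

(** * Compactness of the operator *)

(** (p + q)^2 <= 2 p^2 + 2 q^2 applied to the two terms of the derivative of psi * (v o phi). *)
Lemma sqmod_product_rule (R : realType) (A : R) (a b c v v1 : R[i]) :
  nc v <= A -> nc v1 <= A ->
  sqmod (a * v + b * (v1 * c)) <= 2 * A ^+ 2 * sqmod a + 2 * A ^+ 2 * (sqmod b * sqmod c).
Proof.
move=> hv hv1; rewrite !sqmod_nc.
have h : nc (a * v + b * (v1 * c)) <= A * nc a + A * (nc b * nc c).
  apply: (le_trans (ncD _ _)); rewrite !ncM; apply: lerD.
    by rewrite mulrC ler_wpM2r ?nc_ge0.
  by rewrite mulrCA ler_wpM2r ?mulr_ge0 ?nc_ge0.
have h2 : nc (a * v + b * (v1 * c)) ^+ 2 <= (A * nc a + A * (nc b * nc c)) ^+ 2.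
  by rewrite lerXn2r ?nnegrE ?nc_ge0// (le_trans (nc_ge0 _) h).
apply: (le_trans h2); move: (nc a) (nc b) (nc c) => x y z.
rewrite (_ : 2 * A ^+ 2 * x ^+ 2 + _ = (A * x + A * (y * z)) ^+ 2 + (A * x - A * (y * z)) ^+ 2).
  by rewrite lerDl sqr_ge0.
by ring.
Qed.

Lemma coef_bound_le (R : realType) (a : nat -> R[i]) (s r M : R) : 0 <= s -> s <= r ->
  coef_bound a r M -> coef_bound a s M.
Proof.
move=> s0 sr aM j; apply: le_trans (aM j).
by apply: ler_wpM2l; [exact: nc_ge0|rewrite lerXn2r// nnegrE// (le_trans s0)].
Qed.

Section operator.
Variable R : realType.
Variables (phi psi : R[i] -> R[i])
  (mu : {measure set (measurableTypeR R * measurableTypeR R) -> \bar R}).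
Hypotheses (phi_hol : holomorphic_on_disk phi)
  (mu_density : density_on_disk mu (fun z => sqmod (cderiv phi z)))
  (mu_carleson : dirichlet_carleson mu)
  (psiD : dirichlet_space psi).
Variable r0 : R.
Hypotheses (r0P : 0 < r0 < 1) (phi_r0 : forall z, nc z < 1 -> nc (phi z) <= r0).

Lemma dirichlet_integral_ge0 (f : R[i] -> R[i]) : (0 <= dirichlet_integral f)%E.
Proof. by apply: integral_ge0 => p _; rewrite lee_fin sqr_ge0. Qed.

Lemma hardy_normsq_ge0 (f : R[i] -> R[i]) : (0 <= hardy_normsq f)%E.
Proof.
have h : 0 < (2^-1 : R) < 1 by rewrite invr_gt0 ltr0n/= invf_lt1 ?ltr1n.
apply: le_trans (ereal_sup_ubound _); last by exists 2^-1.
rewrite mule_ge0 ?lee_fin ?invr_ge0 ?mulr_ge0 ?pi_ge0//.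
by apply: integral_ge0 => t _; rewrite lee_fin sqr_ge0.
Qed.

Lemma dirichlet_normsq_ge0 (f : R[i] -> R[i]) : (0 <= dirichlet_normsq f)%E.
Proof.
rewrite /dirichlet_normsq adde_ge0 ?hardy_normsq_ge0// mule_ge0 ?dirichlet_integral_ge0//.
by rewrite lee_fin invr_ge0 pi_ge0.
Qed.

Lemma dirichlet_normsq_fin (f : R[i] -> R[i]) : dirichlet_space f ->
  (dirichlet_normsq f < +oo)%E.
Proof.
move=> [fh fD]; rewrite /dirichlet_normsq lte_add_pinfty ?hardy_normsq_fin//.
by rewrite dirichlet_fin// -EFinM ltry.
Qed.

(** The mixed term of the product rule, i.e. the integral of |psi|^2 against mu. *)
Let cross := (\int[area R]_(p in plane_disk R)
  (sqmod (psi (toC p)) * sqmod (cderiv phi (toC p)))%:E)%E.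

(** The only place where the Carleson hypothesis enters: it is applied to psi. *)
Lemma cross_fin : (cross < +oo)%E.
Proof.
have [psih _] := psiD; have [c c0 cP] := mu_carleson.
have mD := @measurable_plane_disk R.
have mw : measurable_fun (plane_disk R) (EFin \o (fun p => sqmod (cderiv phi (toC p)))).
  by apply/measurable_EFinP; exact: cmeas_sqmod (hol_deriv_cmeas phi_hol).
have mf : measurable_fun (plane_disk R) (fun p => (sqmod (psi (toC p)))%:E).
  by apply/measurable_EFinP; exact: cmeas_sqmod (hol_cmeas psih).
have w0 p : plane_disk R p -> 0 <= sqmod (cderiv phi (toC p)) by move=> _; exact: sqr_ge0.
have f0 p : plane_disk R p -> (0 <= (sqmod (psi (toC p)))%:E)%E.
  by move=> _; rewrite lee_fin sqr_ge0.
have := ge0_integral_density mD mw w0 mu_density mf f0.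
rewrite /cross; under [X in _ = X -> _]eq_integral do rewrite -EFinM.
move=> <-; apply: (le_lt_trans (cP psi psiD)).
have := dirichlet_normsq_fin psiD; have := dirichlet_normsq_ge0 psi.
case: (dirichlet_normsq psi) => // x _ _.
by rewrite -EFinM ltry.
Qed.

Section estimate.
Variables (v v1 : R[i] -> R[i]) (A : R).
Hypotheses (vd : forall w, nc w <= r0 -> has_deriv v w (v1 w))
  (vA : forall w, nc w <= r0 -> nc (v w) <= A)
  (v1A : forall w, nc w <= r0 -> nc (v1 w) <= A).

Let A0 : 0 <= A.
Proof. by apply: le_trans (nc_ge0 _) (vA (w := 0) _); rewrite nc0; case/andP: r0P => /ltW. Qed.

Lemma wcomp_has_deriv z : nc z < 1 -> has_deriv (wcomp psi phi v) z
  (cderiv psi z * v (phi z) + psi z * (v1 (phi z) * cderiv phi z)).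
Proof.
move=> z1; have [psih _] := psiD.
exact: has_derivM (hol_has_deriv psih z1) (has_deriv_comp (hol_has_deriv phi_hol z1) (vd (phi_r0 z1))).
Qed.

Lemma wcomp_hol : holomorphic_on_disk (wcomp psi phi v).
Proof. by move=> z /disk_nc/wcomp_has_deriv/has_deriv_derivable[]. Qed.

Lemma wcomp_deriv_bound z : nc z < 1 -> sqmod (cderiv (wcomp psi phi v) z) <=
  2 * A ^+ 2 * sqmod (cderiv psi z) +
  2 * A ^+ 2 * (sqmod (psi z) * sqmod (cderiv phi z)).
Proof.
move=> z1; have [_ ->] := has_deriv_derivable (wcomp_has_deriv z1).
exact: sqmod_product_rule (vA (phi_r0 z1)) (v1A (phi_r0 z1)).
Qed.

Lemma wcomp_dirichlet_integral : (dirichlet_integral (wcomp psi phi v) <=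
  (2 * A ^+ 2)%:E * (dirichlet_integral psi + cross))%E.
Proof.
have [psih _] := psiD; have mD := @measurable_plane_disk R.
have m1 : measurable_fun (plane_disk R) (fun p => (sqmod (cderiv psi (toC p)))%:E).
  by apply/measurable_EFinP; exact: cmeas_sqmod (hol_deriv_cmeas psih).
have m2 : measurable_fun (plane_disk R)
    (fun p => (sqmod (psi (toC p)) * sqmod (cderiv phi (toC p)))%:E).
  apply/measurable_EFinP; apply: measurable_funM.
    exact: cmeas_sqmod (hol_cmeas psih).
  exact: cmeas_sqmod (hol_deriv_cmeas phi_hol).
have A2 : 0 <= 2 * A ^+ 2 by rewrite mulr_ge0// sqr_ge0.
have s0 (z : R[i]) : 0 <= sqmod z by exact: sqr_ge0.
rewrite /cross -ge0_integralD//; last 2 first.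
- by move=> p _; rewrite lee_fin.
- by move=> p _; rewrite lee_fin mulr_ge0.
rewrite -ge0_integralZl//; last 2 first.
- exact: emeasurable_funD.
- by move=> p _; rewrite -EFinD lee_fin addr_ge0 ?s0// mulr_ge0 ?s0.
rewrite /dirichlet_integral; apply: ge0_le_integral; first exact: mD.
- by move=> p _; rewrite lee_fin s0.
- by apply/measurable_EFinP; exact: cmeas_sqmod (hol_deriv_cmeas wcomp_hol).
- by apply: emeasurable_funM; [exact: measurable_cst|exact: emeasurable_funD].
- move=> p /plane_diskE p1; rewrite -EFinD -EFinM lee_fin mulrDr.
  exact: wcomp_deriv_bound.
Qed.

Lemma wcomp_hardy : (hardy_normsq (wcomp psi phi v) <= (A ^+ 2)%:E * hardy_normsq psi)%E.
Proof.
have [psih psiDi] := psiD.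
apply: ge_ereal_sup => _ [r r01 <-].
rewrite (hardy_normsqE wcomp_hol r01).
apply: (@le_trans _ _ ((A ^+ 2)%:E * ((2 * pi)^-1 * itg 0 (2 * pi)
   (fun t => sqmod (psi (circ r t))))%:E)%E); last first.
  rewrite lee_wpmul2l ?lee_fin ?sqr_ge0//; apply: ereal_sup_ubound.
  by exists r => //; rewrite (hardy_normsqE psih r01).
have ar1 : `|r| < 1 by case/andP: r01 => h1 h2; rewrite gtr0_norm.
have cc f : holomorphic_on_disk f -> ctson 0 (2 * pi) (fun t => sqmod (f (circ r t))).
  by move=> fh t _; apply: continuous_sqmod; exact: (f_ccts (hol_has_deriv fh)).
rewrite -EFinM lee_fin mulrCA ler_wpM2l ?invr_ge0 ?mulr_ge0 ?pi_ge0//.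
rewrite -(itgZ (A ^+ 2) (cc _ psih)).
apply: le_itg; first exact: cc wcomp_hol.
  by move=> t ht; apply: cvgM; [exact: cvg_cst|exact: (cc _ psih)].
move=> t _; rewrite /wcomp !sqmod_nc ncM exprMn mulrC ler_wpM2r ?sqr_ge0//.
by rewrite lerXn2r ?nnegrE ?nc_ge0// vA// phi_r0// nc_circ.
Qed.

Lemma wcomp_dirichlet_space : dirichlet_space (wcomp psi phi v).
Proof.
split; first exact: wcomp_hol.
have [psih psiDi] := psiD.
apply: (le_lt_trans wcomp_dirichlet_integral).
have := cross_fin; have : (0 <= cross)%E.
  by apply: integral_ge0 => p _; rewrite lee_fin mulr_ge0 ?sqr_ge0.
rewrite (dirichlet_fin psiDi).
by case: cross => // x _ _; rewrite -EFinD -EFinM ltry.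
Qed.

End estimate.

(** The bound B depends on phi and psi only: B^2 = |psi|_{H2}^2 + 2 (D + C) / pi, with D the
    Dirichlet integral of psi and C the mixed term. *)
Lemma wcomp_normsq_bound : exists B, 0 <= B /\ forall v v1 A,
  (forall w, nc w <= r0 -> has_deriv v w (v1 w)) ->
  (forall w, nc w <= r0 -> nc (v w) <= A) ->
  (forall w, nc w <= r0 -> nc (v1 w) <= A) ->
  (dirichlet_normsq (wcomp psi phi v) <= ((B * A) ^+ 2)%:E)%E.
Proof.
have [psih psiDi] := psiD.
have H0 := hardy_normsq_ge0 psi; have H1 := hardy_normsq_fin psih psiDi.
have C1 := cross_fin; have C0 : (0 <= cross)%E.
  by apply: integral_ge0 => p _; rewrite lee_fin mulr_ge0 ?sqr_ge0.
have DE := dirichlet_fin psiDi; have D0 := dirichlet_integral_ge0 psi.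
case HE : (hardy_normsq psi) H0 H1 => [H||] // H0 _.
case CE : cross C0 C1 => [C||] // C0 _.
rewrite DE in D0; move: (fine _) DE D0 => D DE D0.
rewrite !lee_fin in H0 C0 D0.
pose B2 := H + pi^-1 * (2 * (D + C)).
have B20 : 0 <= B2.
  by rewrite addr_ge0// mulr_ge0 ?invr_ge0 ?pi_ge0// mulr_ge0// addr_ge0.
exists (Num.sqrt B2); split; first exact: sqrtr_ge0.
move=> v v1 A vd vA v1A; rewrite exprMn sqr_sqrtr//.
have h1 := wcomp_hardy vd vA.
have h2 := wcomp_dirichlet_integral vd vA v1A.
rewrite HE in h1; rewrite DE CE in h2.
have -> : ((B2 * A ^+ 2)%:E = (A ^+ 2)%:E * H%:E + (pi^-1)%:E * ((2 * A ^+ 2)%:E * (D%:E + C%:E)))%E.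
  rewrite -(EFinD D C) -!EFinM -(EFinD (A ^+ 2 * H)); congr EFin; rewrite /B2; ring.
rewrite /dirichlet_normsq leeD// lee_wpmul2l// lee_fin invr_ge0 pi_ge0//.
Qed.

(** The value of the series is bounded by a geometric series of ratio r0 / s; for the
    derivative, half of the gap between r0 and s pays for the factor n. *)
Lemma pser_uniform (s : R) : r0 < s -> exists2 C, 0 < C & forall a K, coef_bound a s K ->
  forall w, nc w <= r0 -> nc (pser a w) <= C * K /\ nc (pser (dcoef a) w) <= C * K.
Proof.
move=> rs; have [r00 _] := andP r0P.
pose q := (r0 + s) / 2.
have rq : r0 < q by rewrite /q; lra.
have qs : q < s by rewrite /q; lra.
have q0 : 0 < q := lt_trans r00 rq.
have h1 : 0 < 1 - r0 / s by rewrite subr_gt0 ltr_pdivrMr ?mul1r// (lt_trans q0).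
have h2 : 0 < 1 - r0 / q by rewrite subr_gt0 ltr_pdivrMr ?mul1r.
have sq : 0 < s - q by rewrite subr_gt0.
pose C1 := (1 - r0 / s)^-1; pose C2 := (s - q)^-1 / (1 - r0 / q).
have C10 : 0 < C1 by rewrite invr_gt0.
have C20 : 0 < C2 by rewrite divr_gt0// invr_gt0.
exists (C1 + C2) => [|a K aK w wr]; first exact: addr_gt0.
have K0 := coef_bound_ge0 aK.
split.
  apply: (le_trans (pser_norm rs wr aK)).
  by rewrite mulrC -/C1 ler_wpM2r// lerDl ltW.
apply: (le_trans (pser_norm rq wr (coef_bound_dcoef q0 qs aK))).
by rewrite mulrAC -/C2 ler_wpM2r// lerDr ltW.
Qed.

Lemma wcomp_maps f : dirichlet_space f -> dirichlet_space (wcomp psi phi f).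
Proof.
move=> [fh _]; have [r00 r01] := andP r0P.
pose s := (r0 + 1) / 2.
have rs : r0 < s by rewrite /s; lra.
have s01 : 0 < s < 1 by apply/andP; rewrite /s; split; lra.
have [C C0 CP] := pser_uniform rs.
have [K KP] := tay_coef_bound fh s01.
have w1 w : nc w <= r0 -> nc w < 1 by move=> h; lra.
apply: (@wcomp_dirichlet_space f (cderiv f) (C * K)) => w wr.
- exact: (hol_has_deriv fh (w1 _ wr)).
- by rewrite (taylor fh (w1 _ wr)); have [] := CP _ _ KP w wr.
- by rewrite (taylor_deriv fh (w1 _ wr)); have [] := CP _ _ KP w wr.
Qed.

(** The Hardy part of the norm dominates every circle mean of |f|^2, hence each of its
    coefficients. *)
Lemma hardy_coef_bound (f : R[i] -> R[i]) (M s : R) :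
  holomorphic_on_disk f -> 0 <= M -> 0 < s < 1 ->
  (dirichlet_norm f <= M%:E)%E -> coef_bound (tay f) s M.
Proof.
move=> fh M0 s01 fM n.
have N0 := dirichlet_normsq_ge0 f.
have fM2 : (dirichlet_normsq f <= (M ^+ 2)%:E)%E.
  rewrite -(sqr_sqrte N0) EFin_expe -/(dirichlet_norm f).
  by rewrite lee_sqr ?sqrte_ge0// lee_fin.
have h : (hardy_normsq f <= (M ^+ 2)%:E)%E.
  apply: le_trans fM2; rewrite /dirichlet_normsq leeDl// mule_ge0 ?dirichlet_integral_ge0//.
  by rewrite lee_fin invr_ge0 pi_ge0.
have := tay_sqmod fh n s01.
have : (2 * pi)^-1 * itg 0 (2 * pi) (fun t => sqmod (f (circ s t))) <= M ^+ 2.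
  rewrite -lee_fin -hardy_normsqE//; apply: le_trans h; apply: ereal_sup_ubound.
  by exists s.
move=> h1 /le_trans/(_ h1); rewrite sqmod_nc -muln2 exprM -exprMn.
by rewrite ler_pXn2r// nnegrE ?mulr_ge0 ?nc_ge0 ?exprn_ge0//; case/andP: s01 => /ltW.
Qed.

(** Norm bounds become Cauchy estimates at a radius s' > s > r0, which pass to the diagonal
    limit b of the coefficients. At radius s the j-th difference is at most 1 / (n + 1) for
    j <= n, by extraction, and at most 2 M (s / s')^n for j > n: the differences tend to 0 uniformly in
    j, hence the images converge in norm. *)
Theorem wcomp_compact : compact_on_dirichlet (wcomp psi phi).
Proof.
split=> [f|u uD [M uM]]; first exact: wcomp_maps.
have M0 : 0 <= M by rewrite -lee_fin; apply: le_trans (uM 0%N); exact: sqrte_ge0.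
have [r00 r01] := andP r0P.
pose s := (2 * r0 + 1) / 3; pose s' := (r0 + 2) / 3.
have rs : r0 < s by rewrite /s; lra.
have ss' : s < s' by rewrite /s /s'; lra.
have s0 : 0 < s := lt_trans r00 rs.
have s'0 : 0 < s' := lt_trans s0 ss'.
have s'01 : 0 < s' < 1 by rewrite s'0 /s'; lra.
have uh n : holomorphic_on_disk (u n) by have [] := uD n.
pose a n := tay (u n).
have aM n : coef_bound (a n) s' M := hardy_coef_bound (uh n) M0 s'01 (uM n).
have aC n j : nc (a n j) <= M / s' ^+ j by rewrite ler_pdivlMr ?exprn_gt0//; exact: aM.
have [k kS [b bP]] := bounded_subsequence aC.
have invS e : 0 < e -> exists N : nat, forall n, (N <= n)%N -> n.+1%:R^-1 < e :> R.
  move=> e0; exists (Num.bound e^-1) => n Nn; rewrite invf_plt ?posrE//.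
  have h : e^-1 < (Num.bound e^-1)%:R by apply: archi_boundP; rewrite invr_ge0 ltW.
  by apply: (lt_le_trans h); rewrite ler_nat; exact: leq_trans Nn (leqnSn n).
have bM : coef_bound b s' M.
  move=> j; rewrite -ler_pdivlMr ?exprn_gt0//; apply/ler_addgt0Pr => e e0.
  have [N NP] := invS e e0.
  have h1 := bP (maxn N j) j (leq_maxr _ _).
  have h2 := NP _ (leq_maxl N j).
  have h3 := aC (k (maxn N j)) j.
  have h4 := ncD (b j - a (k (maxn N j)) j) (a (k (maxn N j)) j).
  rewrite subrK ncBC in h4.
  by apply: (le_trans h4); rewrite addrC lerD// ltW// (lt_trans h1).
have bK := coef_bound_le (ltW s0) (ltW ss') bM.
have [C C0 CP] := pser_uniform rs.
have wr w : nc w <= r0 -> nc w < s by move=> h; exact: le_lt_trans rs.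
exists k => //; exists (wcomp psi phi (pser b)).
  apply: (@wcomp_dirichlet_space (pser b) (pser (dcoef b)) (C * M)) => w hw.
  - exact: pser_has_deriv (wr _ hw) bK.
  - by have [] := CP _ _ bK w hw.
  - by have [] := CP _ _ bK w hw.
pose q := s / s'.
have q01 : 0 <= q < 1 by exact: ratio01 (ltW s0) ss'.
pose K n : R := n.+1%:R^-1 + 2 * M * q ^+ n.
pose d n j := a (k n) j - b j.
(* the two summands of K n bound the head and the tail of the sequence *)
have dK n : coef_bound (d n) s (K n).
  move=> j; have [jn|nj] := leqP j n.
    apply: (@le_trans _ _ n.+1%:R^-1); last first.
      by rewrite /K lerDl !mulr_ge0// exprn_ge0//; case/andP: q01.
    rewrite -[leRHS]mulr1 ler_pM ?nc_ge0 ?exprn_ge0 ?(ltW s0)//.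
      by apply: ltW; exact: bP.
    by rewrite exprn_ile1 ?(ltW s0)//; rewrite /s; lra.
  apply: (@le_trans _ _ (2 * M * q ^+ n)); last by rewrite /K lerDr.
  have sE : s ^+ j = s' ^+ j * q ^+ j.
    by rewrite -exprMn /q mulrC divfK// gt_eqF.
  rewrite sE mulrA ler_pM ?mulr_ge0 ?nc_ge0 ?exprn_ge0 ?(ltW s'0)//.
  - by case/andP: q01.
  - have := ncB (a (k n) j) (b j) => h.
    apply: (le_trans (ler_wpM2r (exprn_ge0 j (ltW s'0)) h)).
    by rewrite mulrDl mulr_natl mulr2n; apply: lerD; [exact: aM|exact: bM].
  - by rewrite ler_wiXn2l// ?(ltnW nj)//; case/andP: q01 => // ? /ltW.
have [B [B0 BP]] := wcomp_normsq_bound.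
have bound n : (dirichlet_norm (fun z => wcomp psi phi (u (k n)) z - wcomp psi phi (pser b) z)%R
    <= (B * (C * K n))%:E)%E.
  pose v w := u (k n) w - pser b w.
  have -> : (fun z => wcomp psi phi (u (k n)) z - wcomp psi phi (pser b) z) = wcomp psi phi v.
    by apply/funext => z; rewrite /wcomp mulrBr.
  have aK := coef_bound_le (ltW s0) (ltW ss') (aM (k n)).
  have vE w : nc w < s -> v w = pser (d n) w.
    move=> ws; rewrite /v (taylor (uh _)); last by apply: lt_trans ws _; rewrite /s; lra.
    apply/esym/csum_to_eq; have := csum_toB (pser_cvg ws aK) (pser_cvg ws bK).
    by rewrite (_ : (fun j => _) = (fun j => d n j * w ^+ j))//; apply/funext => j; rewrite -mulrBl.
  have vd w : nc w <= r0 -> has_deriv v w (pser (dcoef (d n)) w).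
    move=> /wr ws; apply: has_deriv_near (pser_has_deriv ws (dK n)).
    exists (s - nc w); first by rewrite subr_gt0.
    move=> x xw; rewrite vE//; have := ncD (x - w) w; rewrite subrK; lra.
  have CK0 : 0 <= B * (C * K n).
    by rewrite !mulr_ge0 ?(ltW C0)// (coef_bound_ge0 (dK n)).
  apply: lee_sqrE; first by rewrite lee_fin.
  rewrite sqr_sqrte ?dirichlet_normsq_ge0// -EFin_expe.
  apply: (BP v _ (C * K n) vd) => w hw.
    by rewrite vE ?wr//; have [] := CP _ _ (dK n) w hw.
  by have [] := CP _ _ (dK n) w hw.
apply: (@squeeze_cvge _ _ _ _ (cst 0%E) _ (fun n => (B * (C * K n))%:E)).
- by near=> n; rewrite sqrte_ge0/=; exact: bound.
- exact: cvg_cst.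
- apply/fine_cvgP; split; first by near=> n.
  have K0 : K n @[n --> \oo] --> (0 : R).
    rewrite -[0]addr0; apply: cvgD; first exact: cvg_harmonic.
    rewrite -(mulr0 (2 * M)); apply: cvgM; first exact: cvg_cst.
    by apply: cvg_expr; case/andP: q01 => q0 q1; rewrite ger0_norm.
  rewrite (_ : 0 = B * (C * 0)); last by rewrite !mulr0.
  by apply: cvgM; [exact: cvg_cst|apply: cvgM => //; exact: cvg_cst].
Unshelve. all: by end_near. Qed.

End operator.

Unset Implicit Arguments.

Theorem theorem2p5 (R : realType) (phi : R[i] -> R[i])
    (mu : {measure set (measurableTypeR R * measurableTypeR R) -> \bar R})
    (phi_hol : holomorphic_on_disk phi)
    (phi_self : phi @` disk R `<=` disk R)
    (phi_closure : closure (phi @` disk R : set R[i]^o) `<=` disk R)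
    (mu_density : density_on_disk mu (fun z => sqmod (cderiv phi z)))
    (mu_carleson : dirichlet_carleson mu) :
  forall psi : R[i] -> R[i], dirichlet_space psi ->
    compact_on_dirichlet (wcomp psi phi).
Proof.
have [r0 r0P phi_r0] := compact_image_radius phi_self phi_closure.
by move=> psi psiD; apply: (wcomp_compact phi_hol mu_density mu_carleson psiD r0P phi_r0).
Qed.
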